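(* There are Turing degrees $\mathbf{a},\mathbf{b}\in\mathbf{LFS}$ such that $\mathbf{a}\vee\mathbf{b}\notin\mathbf{LFS}$.
   Context: Oracles are languages $X\subseteq\{0,1\}^*$, identified with subsets of $\mathbb{N}$ (the $(n+1)$-th string in length-lexicographic order corresponds to $n$) and with infinite binary sequences. Oracle computations are measured in the usual complexity-theoretic model: the machine has a query tape, and once a string $x$ is written on it, the answer to ''is $x\in X$?'' is obtained in time $O(1)$. An oracle $X$ is \emph{low for speed} if for every computable (decidable) language $L$: whenever some oracle Turing machine $M$ with oracle $X$ decides $L$ within time bound $f$ (i.e. $time(M^X,x)\le f(x)$ for all inputs $x$), there exist a Turing machine $M'$ without oracle and a polynomial $p$ such that $M'$ decides $L$ within time bound $p\circ f$. $\mathbf{LFS}$ denotes the set of Turing degrees containing at least one low for speed set; $\mathbf{a}\vee\mathbf{b}$ is the Turing degree of $A\oplus B$ for $A\in\mathbf{a}$, $B\in\mathbf{b}$. *)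

(* Defs.v *)
From HB Require Import structures.
From mathcomp Require Import all_boot.
Set Implicit Arguments. Unset Strict Implicit. Unset Printing Implicit Defensive.

Definition lang := seq bool -> bool.

(* index of a string in length-lexicographic order: value of the binary number 1s, minus 1 *)
Definition str2nat (s : seq bool) : nat :=
  (foldl (fun acc (b : bool) => acc.*2 + b) 1 s).-1.

Fixpoint bin_digits (fuel m : nat) : seq bool :=
  match fuel with
  | 0 => [::]
  | f.+1 => if m is 0 then [::] else rcons (bin_digits f m./2) (odd m)
  end.

Definition nat2str (n : nat) : seq bool := behead (bin_digits n.+1 n.+1).

Definition join (A B : lang) : lang := fun s =>
  let n := str2nat s in if odd n then B (nat2str n./2) else A (nat2str n./2).

Definition Sym := option bool.           (* None = blank *)
Inductive Move := MoveL | MoveR | MoveS.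

(* bi-infinite tape as a zipper *)
Record Tape := mkTape { tleft : seq Sym; thead : Sym; tright : seq Sym }.

Definition blank_tape : Tape := mkTape [::] None [::].

Definition tape_write (t : Tape) (a : Sym) : Tape := mkTape (tleft t) a (tright t).

Definition tape_move (t : Tape) (m : Move) : Tape :=
  match m with
  | MoveL => match tleft t with
             | [::] => mkTape [::] None (thead t :: tright t)
             | a :: l => mkTape l a (thead t :: tright t)
             end
  | MoveR => match tright t with
             | [::] => mkTape (thead t :: tleft t) None [::]
             | a :: r => mkTape (thead t :: tleft t) a r
             end
  | MoveS => t
  end.

Definition tape_word (t : Tape) : seq bool :=
  pmap id (rev (tleft t) ++ thead t :: tright t).

Definition input_tape (x : seq bool) : Tape :=
  match x with
  | [::] => blank_tape
  | b :: r => mkTape [::] (Some b) (map Some r)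
  end.

(* An oracle TM with n states and k.+1 work tapes (tape 0 holds the input)
   plus one oracle query tape. *)
Record OTM (n k : nat) := mkOTM {
  start : 'I_n; acc : 'I_n; rej : 'I_n;
  qry : 'I_n; qyes : 'I_n; qno : 'I_n;
  delta : 'I_n -> k.+1.-tuple Sym -> Sym ->
          'I_n * k.+1.-tuple (Sym * Move) * (Sym * Move) }.

Record Cfg (n k : nat) := mkCfg {
  cst : 'I_n; ctapes : 'I_k.+1 -> Tape; cq : Tape }.

Section Run.
Variables (n k : nat) (M : OTM n k) (X : lang).

Definition halted (c : Cfg n k) : bool := (cst c == acc M) || (cst c == rej M).

Definition step (c : Cfg n k) : Cfg n k :=
  if halted c then c
  else if cst c == qry M then
    mkCfg (if X (tape_word (cq c)) then qyes M else qno M) (ctapes c) blank_tape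
  else
    let: (q', w, (a, m)) :=
       delta M (cst c) [tuple thead (ctapes c i) | i < k.+1] (thead (cq c)) in
    mkCfg q' (fun i => let: (b, mv) := tnth w i in tape_move (tape_write (ctapes c i) b) mv)
          (tape_move (tape_write (cq c) a) m).

Definition init (x : seq bool) : Cfg n k :=
  mkCfg (start M) (fun i => if i == ord0 then input_tape x else blank_tape) blank_tape.

Definition run (x : seq bool) (t : nat) : Cfg n k := iter t step (init x).

Definition decides (L : lang) : Prop :=
  forall x, exists t, halted (run x t) /\ (cst (run x t) == acc M) = L x.

Definition decides_within (L : lang) (f : seq bool -> nat) : Prop :=
  forall x, exists t, t <= f x /\ halted (run x t) /\ (cst (run x t) == acc M) = L x.
End Run.

(* machines "without oracle" are run with the empty oracle *)
Definition empty_oracle : lang := fun _ => false.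

Definition computable (L : lang) : Prop :=
  exists n k (M : OTM n k), decides M empty_oracle L.

Definition peval (p : seq nat) (m : nat) : nat :=
  \sum_(i < size p) nth 0 p i * m ^ i.

Definition low_for_speed (X : lang) : Prop :=
  forall L : lang, computable L ->
  forall n k (M : OTM n k) (f : seq bool -> nat),
    decides_within M X L f ->
    exists n' k' (M' : OTM n' k') (p : seq nat),
      decides_within M' empty_oracle L (fun x => peval p (f x)).

Definition turing_red (A B : lang) : Prop :=
  exists n k (M : OTM n k), decides M B A.

Definition turing_equiv (A B : lang) : Prop := turing_red A B /\ turing_red B A.

(* a Turing degree (given by a representative) lies in LFS *)
Definition in_LFS (A : lang) : Prop := exists C, turing_equiv C A /\ low_for_speed C.

(* Main.v *)
Require Import Defs.
From mathcomp Require Import all_boot.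
From mathcomp Require Import zify.
From Stdlib Require Import FunctionalExtensionality ClassicalEpsilon.
Import Defs.
Set Implicit Arguments. Unset Strict Implicit. Unset Printing Implicit Defensive.

(* For a binary sequence alpha let A(alpha) be the set of the words 0^(2^i) with alpha(i) = 1.
   Only log t + 1 of these words have length at most t, so the finitely many possibilities for
   A(alpha) up to length t are coded by the numbers g = O(t). If alpha is generic, then every
   machine M with M^A(alpha) deciding a computable L gives no wrong answer with any oracle
   A(beta), for beta extending a suitable finite part of alpha: otherwise a wrong answer would
   have been forced. Hence running M for g steps with the oracle coded by g, for g = 1, 2, ...,
   decides L with polynomial slowdown, so A(alpha) is low for speed.

   Both members of a pair can be made generic while their join computes an arbitrary set G:
   while one sequence is extended to force a requirement the other is extended by zeros, so that
   common ones are free to mark the positions where a bit of G is coded.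

   Let L be the computable language of the words x such that the machine coded by the number e of
   leading ones of x rejects x within about 2^|x| steps, and let G(e) tell whether L contains a
   word with e leading ones. A machine with code e that decides L never halts on such words
   before time 2^|x|, and then G(e) = 0. An oracle C computing G finds this out in a time that
   depends on e only, and then rejects in time O(|x|). So C is not low for speed. *)

(** * Stack programs and their compilation *)

(** Lowness and computability speak of concrete transition tables. All algorithms are therefore
    written as programs over stacks and compiled with a constant factor of slowdown, and simulated
    machines are themselves data of such programs. A bound [f] may be smaller than the length of the
    input, so the guessing machine must not even read its whole input: with guess g it copies at
    most g letters and simulates g - 1 steps, g serving both as oracle and as clock. A computable L
    comes without any useful time bound. A machine N deciding it enters only through its agreement
    with M, a condition on pairs of machines. There are countably many pairs, so the condition can
    be forced. The finite part of alpha, of length j, depends on the pair and is wired into the new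
    machine; the guesses advance by 2^j and hence all extend it. On the negative side C is an
    arbitrary set of the degree of the join, reached by a reduction with no time bound, so the cost
    of consulting C must be kept apart from the length of the input. Lowness is applied to the true
    running time of the resulting machine, and the word that refutes it is built from the code of
    the machine that lowness returns. *)

Inductive sop := Keep | Pop | Push of bool.

Definition appop (o : sop) (s : seq bool) : seq bool :=
  match o with Keep => s | Pop => behead s | Push b => b :: s end.

Section Language.
Variables F V : finType.

(** The query word can only grow at its end and is reset by [Ask], just as the query step of an
    [OTM] leaves a blank query tape. *)
Record st := St { fc : F; sk : V -> seq bool; qw : seq bool }.

Definition tops (s : st) : V -> option bool := fun v => ohead (sk s v).

Record eff := Eff { ef : F; eops : V -> sop; eqr : option bool }.

Inductive cmd : Type :=
| Act of (F -> (V -> option bool) -> eff)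
| Ask of (F -> bool -> F)
| Seq of cmd & cmd
| While of (F -> (V -> option bool) -> bool) & cmd
| If of (F -> (V -> option bool) -> bool) & cmd & cmd.

Definition aeff (e : eff) (s : st) : st :=
  St (ef e) (fun v => appop (eops e v) (sk s v)) (qw s ++ seq_of_opt (eqr e)).

Variable X : lang.

(** [ExLe] makes the time an upper bound, so that costs can be rounded to simple expressions
    anywhere in a derivation. *)
Inductive exec : cmd -> st -> nat -> st -> Prop :=
| ExAct a s : exec (Act a) s 1 (aeff (a (fc s) (tops s)) s)
| ExAsk h s : exec (Ask h) s 1 (St (h (fc s) (X (qw s))) (sk s) [::])
| ExSeq c1 c2 s t1 s1 t2 s2 :
    exec c1 s t1 s1 -> exec c2 s1 t2 s2 -> exec (Seq c1 c2) s (t1 + t2) s2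
| ExWhileF (g : F -> (V -> option bool) -> bool) c s : g (fc s) (tops s) = false -> exec (While g c) s 1 s
| ExWhileT (g : F -> (V -> option bool) -> bool) c s t1 s1 t2 s2 : g (fc s) (tops s) ->
    exec c s t1 s1 -> exec (While g c) s1 t2 s2 -> exec (While g c) s (1 + t1 + t2) s2
| ExIfT (g : F -> (V -> option bool) -> bool) c1 c2 s t s' : g (fc s) (tops s) ->
    exec c1 s t s' -> exec (If g c1 c2) s t.+1 s'
| ExIfF (g : F -> (V -> option bool) -> bool) c1 c2 s t s' : g (fc s) (tops s) = false ->
    exec c2 s t s' -> exec (If g c1 c2) s t.+1 s'
| ExLe c s t t' s' : exec c s t s' -> t <= t' -> exec c s t' s'.

(* Control points; leaving the command is [None] in [option (ctl c)]. *)
Fixpoint ctl (c : cmd) : finType :=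
  match c with
  | Act _ | Ask _ => unit
  | Seq c1 c2 => (ctl c1 + ctl c2)%type
  | While _ c => option (ctl c)
  | If _ c1 c2 => option (ctl c1 + ctl c2)%type
  end.

Fixpoint ent (c : cmd) : ctl c :=
  match c return ctl c with
  | Act _ => tt
  | Ask _ => tt
  | Seq c1 _ => inl (ent c1)
  | While _ _ => None
  | If _ _ _ => None
  end.

Inductive ins (P : Type) :=
| IAct of eff & option P
| IAsk of (bool -> F) & option P.

Definition mapins P P' (f : option P -> option P') (i : ins P) : ins P' :=
  match i with IAct e o => IAct e (f o) | IAsk h o => IAsk h (f o) end.

Definition nop (f : F) : eff := Eff f (fun=> Keep) None.

Fixpoint dec (c : cmd) : ctl c -> F -> (V -> option bool) -> ins (ctl c) :=
  match c return ctl c -> F -> (V -> option bool) -> ins (ctl c) with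
  | Act a => fun _ f tp => IAct (a f tp) None
  | Ask h => fun _ f tp => IAsk (h f) None
  | Seq c1 c2 => fun p f tp =>
      match p with
      | inl p => mapins (fun o => Some (if o is Some q then inl q else inr (ent c2)))
                        (dec p f tp)
      | inr p => mapins (omap inr) (dec p f tp)
      end
  | While g c => fun p f tp =>
      match p with
      | None => IAct (nop f) (if g f tp then Some (Some (ent c)) else None)
      | Some p => mapins (@Some _) (dec p f tp)
      end
  | If g c1 c2 => fun p f tp =>
      match p with
      | None => IAct (nop f) (Some (Some (if g f tp then inl (ent c1) else inr (ent c2))))
      | Some (inl p) => mapins (omap (Some \o inl)) (dec p f tp)
      | Some (inr p) => mapins (omap (Some \o inr)) (dec p f tp)
      end
  end.

Definition lstep c (p : ctl c) (s : st) : option (ctl c) * st :=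
  match dec p (fc s) (tops s) with
  | IAct e o => (o, aeff e s)
  | IAsk h o => (o, St (h (X (qw s))) (sk s) [::])
  end.

Inductive lruns c : nat -> option (ctl c) * st -> option (ctl c) * st -> Prop :=
| LRefl z : lruns 0 z z
| LStep t p s z : lruns t (lstep p s) z -> lruns t.+1 (Some p, s) z.

Lemma lruns_trans c t1 t2 (z1 z2 z3 : option (ctl c) * st) :
  lruns t1 z1 z2 -> lruns t2 z2 z3 -> lruns (t1 + t2) z1 z3.
Proof. by move=> H; elim: H => // t p s z _ IH /IH; rewrite addSn; constructor. Qed.

Lemma aeff_nop s : aeff (nop (fc s)) s = s.
Proof. by case: s => f k q; rewrite /aeff /= cats0. Qed.

Lemma mapins_id P f (i : ins P) : f =1 id -> mapins f i = i.
Proof. by move=> E; case: i => [e o|h o] /=; rewrite E. Qed.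

Lemma mapins_comp P P' P'' (f : option P' -> option P'') (g : option P -> option P') i :
  mapins f (mapins g i) = mapins (f \o g) i.
Proof. by case: i. Qed.

Lemma eq_mapins P P' (f g : option P -> option P') i : f =1 g -> mapins f i = mapins g i.
Proof. by move=> E; case: i => [e o|h o] /=; rewrite E. Qed.

(** [e] places the code of [c] inside [c0], and [k] is where [c0] goes on when [c] ends. The
    simulation is proved for all embeddings because a subcommand has its own type of control points,
    while the induction must follow it inside the whole program. *)
Definition embeds c c0 (e : ctl c -> ctl c0) (k : option (ctl c0)) : Prop :=
  forall p f tp, dec (e p) f tp = mapins (fun o => if o is Some q then Some (e q) else k) (dec p f tp).

Lemma exec_lruns_emb c s t s' : exec c s t s' ->
  forall c0 (e : ctl c -> ctl c0) k, embeds e k ->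
  exists2 n, n <= t & lruns n (Some (e (ent c)), s) (k, s').
Proof.
elim=> {c s t s'}.
- move=> a s c0 e k E; exists 1 => //; apply: LStep; rewrite /lstep E /=; exact: LRefl.
- move=> a s c0 e k E; exists 1 => //; apply: LStep; rewrite /lstep E /=; exact: LRefl.
- move=> c1 c2 s t1 s1 t2 s2 _ IH1 _ IH2 c0 e k E.
  have [|n1 le1 H1] := IH1 c0 (e \o inl) (Some (e (inr (ent c2)))).
    move=> p f tp; rewrite /= E /= mapins_comp; apply: eq_mapins; by case.
  have [|n2 le2 H2] := IH2 c0 (e \o inr) k.
    move=> p f tp; rewrite /= E /= mapins_comp; apply: eq_mapins; by case.
  exists (n1 + n2); first exact: leq_add.
  exact: lruns_trans H1 H2.
- move=> g c s gF c0 e k E; exists 1 => //; apply: LStep; rewrite /lstep E /= gF aeff_nop.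
  exact: LRefl.
- move=> g c s t1 s1 t2 s2 gT _ IH1 _ IH2 c0 e k E.
  have [|n1 le1 H1] := IH1 c0 (e \o some) (Some (e None)).
    move=> p f tp; rewrite /= E /= mapins_comp; apply: eq_mapins; by case.
  have [n2 le2 H2] := IH2 c0 e k E.
  exists (1 + n1 + n2); first by rewrite leq_add // leq_add2l.
  rewrite -addnA; apply: LStep; rewrite /lstep E /= gT aeff_nop.
  exact: lruns_trans H1 H2.
- move=> g c1 c2 s t s' gT _ IH c0 e k E.
  have [|n le1 H] := IH c0 (e \o Some \o inl) k.
    move=> p f tp; rewrite /= E /= mapins_comp; apply: eq_mapins; by case.
  by exists n.+1 => //; apply: LStep; rewrite /lstep E /= gT aeff_nop.
- move=> g c1 c2 s t s' gT _ IH c0 e k E.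
  have [|n le1 H] := IH c0 (e \o Some \o inr) k.
    move=> p f tp; rewrite /= E /= mapins_comp; apply: eq_mapins; by case.
  by exists n.+1 => //; apply: LStep; rewrite /lstep E /= gT aeff_nop.
- move=> c s t t' s' _ IH le_tt' c0 e k E; have [n le H] := IH c0 e k E.
  by exists n => //; apply: leq_trans le_tt'.
Qed.

Lemma exec_lruns c s t s' : exec c s t s' ->
  exists2 n, n <= t & lruns (c := c) n (Some (ent c), s) (None, s').
Proof.
move=> H; apply: (exec_lruns_emb H (e := id)) => p f tp.
by rewrite mapins_id //; case.
Qed.

End Language.

Section Compile.
Variables (F V : finType) (c : cmd F V) (v0 : V) (f0 : F) (out : F -> bool).

Let P : finType := ctl c.
(** A query leaves the machine in one of two fixed states, which forgets the control point. So
    besides the stacks there is a flag tape for every pair of control point and finite store: the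
    current pair is marked before the query and recovered from its mark afterwards. *)
Let W : finType := (V + P * F)%type.
Let K := #|{: W}|.

Definition vt (w : W) : 'I_K.+1 := if w == inl v0 then ord0 else lift ord0 (enum_rank w).

(** Tape 0 has to be the input stack [v0]. The slot that [v0] would get from the enumeration stays
    idle, and [tw] sends it to [None]. *)
Definition tw (i : 'I_K.+1) : option W :=
  if unlift ord0 i is Some j then
    if enum_val j == inl v0 then None else Some (enum_val j)
  else Some (inl v0).

Lemma vtK w : tw (vt w) = Some w.
Proof.
rewrite /vt /tw; have [->|ne] := eqVneq w (inl v0); first by rewrite unlift_none.
by rewrite liftK enum_rankK (negPf ne).
Qed.

Lemma vt_eq0 v : (vt (inl v) == ord0) = (v == v0).
Proof.
rewrite /vt; case: (eqVneq (inl v : W) (inl v0)) => [[->]|ne]; first by rewrite !eqxx.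
by case: (eqVneq v v0) ne => [->|_ _]; rewrite ?eqxx // eq_sym (negPf (neq_lift _ _)).
Qed.

Lemma vt_inr pf : (vt (inr pf) == ord0) = false.
Proof. by rewrite /vt /= eq_sym (negPf (neq_lift _ _)). Qed.

(* [inl (inr _)] is the middle of an [Act], where the pushed bits remain to be written;
   [inr (inl _)] collects the query and halting states; [inr (inr b)] follows a query. *)
Let Q : finType := ((P * F) + (option P * F * {ffun V -> option bool}) + (option bool + bool))%type.

Let rk (q : Q) : 'I_#|{: Q}| := enum_rank q.

Definition wr_act (e : eff F V) (w : option W) (a : Sym) : Sym * Move :=
  if w is Some (inl v) then
    match eops e v with Keep => (a, MoveS) | Pop => (None, MoveR) | Push _ => (a, MoveL) end
  else (a, MoveS).

Definition wr_mid (pend : {ffun V -> option bool}) (w : option W) (a : Sym) : Sym * Move :=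
  if w is Some (inl v) then if pend v is Some b then (Some b, MoveS) else (a, MoveS)
  else (a, MoveS).

Definition wr_save (pf : P * F) (w : option W) (a : Sym) : Sym * Move :=
  if w == Some (inr pf) then (Some true, MoveS) else (a, MoveS).

Definition wr_erase (w : option W) (a : Sym) : Sym * Move :=
  if w is Some (inr _) then (None, MoveS) else (a, MoveS).

Definition pend_of (e : eff F V) : {ffun V -> option bool} :=
  [ffun v => if eops e v is Push b then Some b else None].

Definition cdelta (q : 'I_#|{: Q}|) (ts : K.+1.-tuple Sym) (a : Sym) :
    'I_#|{: Q}| * K.+1.-tuple (Sym * Move) * (Sym * Move) :=
  let wrt w := [tuple w (tw i) (tnth ts i) | i < K.+1] in
  let tp v := tnth ts (vt (inl v)) in
  match enum_val q with
  | inl (inl (p, f)) =>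
      match dec p f tp with
      | IAct e nx => (rk (inl (inr (nx, ef e, pend_of e))), wrt (wr_act e),
                      if eqr e is Some b then (Some b, MoveR) else (a, MoveS))
      | IAsk _ _ => (rk (inr (inl None)), wrt (wr_save (p, f)), (a, MoveS))
      end
  | inl (inr (nx, f, pend)) =>
      (rk (if nx is Some p then inl (inl (p, f)) else inr (inl (Some (out f)))),
       wrt (wr_mid pend), (a, MoveS))
  | inr (inl _) => (q, wrt (fun=> pair^~ MoveS), (a, MoveS))
  | inr (inr b) =>
      if [pick pf | tnth ts (vt (inr pf)) == Some true] is Some (p, f) then
        if dec p f tp is IAsk h nx then
          (rk (inl (inr (nx, h b, [ffun=> None]))), wrt wr_erase, (a, MoveS))
        else (q, wrt wr_erase, (a, MoveS))
      else (q, wrt wr_erase, (a, MoveS))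
  end.

Definition cotm : OTM #|{: Q}| K :=
  mkOTM (rk (inl (inl (ent c, f0)))) (rk (inr (inl (Some true)))) (rk (inr (inl (Some false))))
        (rk (inr (inl None))) (rk (inr (inr true))) (rk (inr (inr false))) cdelta.

(* Stacks grow to the left, so that the input tape is the stack holding the input. *)
Definition srep (s : seq bool) (t : Tape) : Prop :=
  exists a r, thead t :: tright t = map Some s ++ nseq a None /\ tleft t = nseq r None.

Lemma srep_head s t : srep s t -> thead t = ohead s.
Proof. by case=> a [r [E _]]; case: s E => [|b s] /= []; case: a => // a []. Qed.

Lemma srep_pop s t : srep s t -> srep (behead s) (tape_move (tape_write t None) MoveR).
Proof.
case: t => l h r [a [n [/= E1 E2]]].
have [a0 Er] : exists a0, r = map Some (behead s) ++ nseq a0 None.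
  by case: s E1 => [|b s] /= => [|[_ ->]]; [case: a => // a [_ ->]; exists a | exists a].
have R : exists a', (if r is b :: r' then b :: r' else [:: None]) = map Some (behead s) ++ nseq a' None.
  case: r Er {E1} => [|x r] Er; last by exists a0.
  by exists 1; case: (behead s) Er => //; case: (a0).
have [a' R'] := R.
exists a', n.+1; by case: r {E1 Er R} R' => [|x r] /= <-; rewrite E2.
Qed.

Lemma srep_push b s t : srep s t -> srep (b :: s) (tape_write (tape_move t MoveL) (Some b)).
Proof.
case: t => l h r [a [n [/= E1 E2]]].
case: l E2 => [|x l] /= E2; exists a; first by exists 0; rewrite E1.
by exists n.-1; split; [rewrite E1 | case: n E2 => // n [_ ->]].
Qed.

Arguments tape_write : simpl never.

Lemma tape_write_same t : tape_write t (thead t) = t.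
Proof. by case: t. Qed.

Definition qrep (w : seq bool) : Tape := mkTape (map Some (rev w)) None [::].

Lemma qrep_word w : tape_word (qrep w) = w.
Proof.
rewrite /tape_word /= -map_rev revK pmap_cat cats0.
by elim: w => //= b w ->.
Qed.

Definition stacks_rep (sk : V -> seq bool) (ct : 'I_K.+1 -> Tape) : Prop :=
  (forall v, srep (sk v) (ct (vt (inl v)))) /\ (forall pf, thead (ct (vt (inr pf))) = None).

Definition crep (cf : Cfg #|{: Q}| K) (z : option P * st F V) : Prop :=
  [/\ cst cf = rk (if z.1 is Some p then inl (inl (p, fc z.2)) else inr (inl (Some (out (fc z.2))))),
      stacks_rep (sk z.2) (ctapes cf) & cq cf = qrep (qw z.2)].

Variable X : lang.

Lemma rk_eq q q' : (rk q == rk q') = (q == q').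
Proof. exact/inj_eq/enum_rank_inj. Qed.

Lemma cstep_delta (cf : Cfg #|{: Q}| K) q : cst cf = rk q ->
  (if q is inr (inl _) then false else true) ->
  step cotm X cf =
    let r := cdelta (rk q) [tuple thead (ctapes cf i) | i < K.+1] (thead (cq cf)) in
    mkCfg r.1.1
      (fun i => let: (b, mv) := tnth r.1.2 i in tape_move (tape_write (ctapes cf i) b) mv)
      (tape_move (tape_write (cq cf) r.2.1) r.2.2).
Proof.
move=> Eq nq; rewrite /step /halted Eq /= !rk_eq.
by case: q nq {Eq} => [q|[o|b]] //= _; case: (cdelta _ _ _) => [[q' w] [a m]].
Qed.

Lemma tnth_wrt (w : option W -> Sym -> Sym * Move) (ct : 'I_K.+1 -> Tape) i :
  tnth [tuple w (tw j) (tnth [tuple thead (ct l) | l < K.+1] j) | j < K.+1] i = w (tw i) (thead (ct i)).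
Proof. by rewrite !tnth_mktuple. Qed.

Lemma tops_stacks_rep sk ct : stacks_rep sk ct ->
  (fun v => tnth [tuple thead (ct l) | l < K.+1] (vt (inl v))) = (fun v => ohead (sk v)).
Proof.
by case=> R _; apply: functional_extensionality => v; rewrite tnth_mktuple (srep_head (R v)).
Qed.

Lemma cstep_mid cf nx f pend sk0 qw0 :
  cst cf = rk (inl (inr (nx, f, pend))) ->
  (forall v, srep (sk0 v) (if pend v is Some b then tape_write (ctapes cf (vt (inl v))) (Some b)
                        else ctapes cf (vt (inl v)))) ->
  (forall pf, thead (ctapes cf (vt (inr pf))) = None) ->
  cq cf = qrep qw0 ->
  crep (step cotm X cf) (nx, St f sk0 qw0).
Proof.
move=> Eq R1 R2 Rq; rewrite (cstep_delta Eq) // /cdelta /rk enum_rankK.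
split => /=; first by [].
- split=> [v|pf].
    rewrite tnth_wrt vtK /wr_mid; have := R1 v; case: (pend v) => [b|] //=; rewrite ?tape_write_same.
  by rewrite tnth_wrt vtK /wr_mid tape_write_same R2.
- by rewrite tape_write_same.
Qed.

(** An [Act] takes two machine steps, since a push has to move left before it can write. An [Ask]
    takes four: setting the flag, the query itself, recovering and erasing the flag, and the middle
    step. *)
Lemma cstep_sim cf p s : crep cf (Some p, s) ->
  exists2 n, n <= 4 & crep (iter n (step cotm X) cf) (lstep X p s).
Proof.
case: s => f sk0 qw0 [/= Eq [R1 R2] Rq].
have Et := tops_stacks_rep (conj R1 R2).
have := cstep_delta Eq isT; rewrite /cdelta {1}/rk enum_rankK Et /lstep /=.
rewrite -/(tops (St f sk0 qw0)).
case Ed: (dec p f _) => [e nx|h nx] E1.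
- exists 2 => //=; rewrite E1; apply: cstep_mid => //=.
  + move=> v; rewrite tnth_wrt vtK /wr_act ffunE.
    case: (eops e v) => [||b].
    * by rewrite /= tape_write_same.
    * exact: srep_pop.
    * by move: (srep_push b (R1 v)); rewrite -{1}[ctapes cf _]tape_write_same.
  + by move=> pf; rewrite tnth_wrt vtK /wr_act /= ?tape_write_same R2.
  + rewrite Rq; case: (eqr e) => [b|] /=; last by rewrite cats0.
    by rewrite /qrep rev_cat /=.
- exists 4 => //=; rewrite E1 /=.
  set cf1 := mkCfg _ _ _; pose ct := ctapes cf1.
  have ctV v : ct (vt (inl v)) = ctapes cf (vt (inl v)).
    by rewrite /ct /= tnth_wrt vtK /wr_save /= tape_write_same.
  have ctW pf : thead (ct (vt (inr pf))) = if pf == (p, f) then Some true else None.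
    rewrite /ct /= tnth_wrt vtK /wr_save (inj_eq (@Some_inj _)).
    rewrite (inj_eq (f := @inr V (P * F))); last by move=> ? ? [].
    by case: ifP => _ /=; rewrite ?tape_write_same ?R2.
  have -> : step cotm X cf1 = mkCfg (rk (inr (inr (X qw0)))) ct blank_tape.
    rewrite /step /halted /cf1 /= !rk_eq /= ?eqxx tape_write_same Rq qrep_word.
    by case: (X qw0).
  set cf2 := mkCfg _ _ _.
  have := @cstep_delta cf2 (inr (inr (X qw0))) erefl isT.
  have Rct : stacks_rep sk0 (fun i => if tw i is Some (inr _) then blank_tape else ct i).
    by split=> [v|pf]; rewrite vtK // ctV.
  have Et2 : (fun v => tnth [tuple thead (ct l) | l < K.+1] (vt (inl v))) = (fun v => ohead (sk0 v)).
    by apply: functional_extensionality => v; rewrite tnth_mktuple ctV (srep_head (R1 v)).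
  rewrite /cdelta {1}/rk enum_rankK /= Et2.
  case: pickP => [[p' f'] /=|/(_ (p, f))]; last by rewrite tnth_mktuple ctW eqxx.
  rewrite tnth_mktuple ctW; case: (eqVneq (p', f') (p, f)) => [[-> ->]|] // _; rewrite Ed => ->.
  apply: cstep_mid => //=.
  + by move=> v; rewrite tnth_wrt vtK /= ffunE tape_write_same ctV.
  + by move=> pf; rewrite tnth_wrt vtK /wr_erase /=.
Qed.

Lemma lruns_crep n z z' : lruns X (c := c) n z z' -> forall cf, crep cf z ->
  exists2 m, m <= 4 * n & crep (iter m (step cotm X) cf) z'.
Proof.
elim=> {n z z'} [z cf H|n p s z _ IH cf H]; first by exists 0.
have [m1 le1 H1] := cstep_sim H.
have [m2 le2 H2] := IH _ H1.
by exists (m2 + m1); [lia | rewrite iterD].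
Qed.

Definition init_st (x : seq bool) : st F V :=
  St f0 (fun v => if v == v0 then x else [::]) [::].

Lemma crep_init x : crep (init cotm x) (Some (ent c), init_st x).
Proof.
split=> //=; split=> [v|pf]; last by rewrite vt_inr.
rewrite vt_eq0; case: (v == v0); last by exists 1, 0.
case: x => [|b x]; first by exists 1, 0.
by exists 0, 0; rewrite /= cats0.
Qed.

Lemma cotm_correct x t s : exec X c (init_st x) t s ->
  exists2 m, m <= 4 * t &
    halted cotm (run cotm X x m) /\ (cst (run cotm X x m) == acc cotm) = out (fc s).
Proof.
move=> /exec_lruns [n le_nt H].
have [m le_m [/= E _ _]] := lruns_crep H (crep_init x).
exists m; first by apply: leq_trans le_m _; rewrite leq_mul2l le_nt orbT.
by rewrite /halted /run E /= !rk_eq; case: (out _).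
Qed.

End Compile.

(** The machine is chosen before the oracle, so one compilation serves for machines without oracle
    and for machines using [C]. *)
Lemma compile (F V : finType) (c : cmd F V) (v0 : V) (f0 : F) (out : F -> bool) :
  exists n k (M : OTM n k), forall X x t s, exec X c (init_st v0 f0 x) t s ->
    exists2 m, m <= 4 * t &
      halted M (run M X x m) /\ (cst (run M X x m) == acc M) = out (fc s).
Proof.
by exists _, _, (cotm c v0 f0 out) => X x t s; apply: cotm_correct.
Qed.

(** * Simulation of oracle machines by stack programs *)

Section Lift.
Variables (F1 F2 V1 V2 : finType).

Definition sjoin (k1 : V1 -> seq bool) (k2 : V2 -> seq bool) : V1 + V2 -> seq bool :=
  fun v => match v with inl v => k1 v | inr v => k2 v end.

Fixpoint liftL (c : cmd F1 V1) : cmd (F1 * F2)%type (V1 + V2)%type :=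
  match c with
  | Act a => Act (fun f (tp : V1 + V2 -> option bool) =>
      let e := a f.1 (tp \o inl) in
      Eff (ef e, f.2) (fun v => if v is inl v then eops e v else Keep) (eqr e))
  | Ask h => Ask _ (fun f b => (h f.1 b, f.2))
  | Seq c1 c2 => Seq (liftL c1) (liftL c2)
  | While g c => While (fun f (tp : V1 + V2 -> option bool) => g f.1 (tp \o inl)) (liftL c)
  | If g c1 c2 =>
      If (fun f (tp : V1 + V2 -> option bool) => g f.1 (tp \o inl)) (liftL c1) (liftL c2)
  end.

Fixpoint liftR (c : cmd F2 V2) : cmd (F1 * F2)%type (V1 + V2)%type :=
  match c with
  | Act a => Act (fun f (tp : V1 + V2 -> option bool) =>
      let e := a f.2 (tp \o inr) in
      Eff (f.1, ef e) (fun v => if v is inr v then eops e v else Keep) (eqr e))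
  | Ask h => Ask _ (fun f b => (f.1, h f.2 b))
  | Seq c1 c2 => Seq (liftR c1) (liftR c2)
  | While g c => While (fun f (tp : V1 + V2 -> option bool) => g f.2 (tp \o inr)) (liftR c)
  | If g c1 c2 =>
      If (fun f (tp : V1 + V2 -> option bool) => g f.2 (tp \o inr)) (liftR c1) (liftR c2)
  end.

Variable X : lang.

Lemma exec_liftL c s t s' f2 k2 : exec X c s t s' ->
  exec X (liftL c) (St (fc s, f2) (sjoin (sk s) k2) (qw s)) t
                 (St (fc s', f2) (sjoin (sk s') k2) (qw s')).
Proof.
elim=> {c s t s'}.
- move=> a s /=.
  have -> : sjoin (sk (aeff (a (fc s) (tops s)) s)) k2 =
     fun v => appop (if v is inl v then eops (a (fc s) (tops s)) v else Keep) (sjoin (sk s) k2 v).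
    by apply: functional_extensionality; case.
  exact: (ExAct X _ (St (fc s, f2) (sjoin (sk s) k2) (qw s))).
- move=> h s; exact: (ExAsk X _ (St (fc s, f2) (sjoin (sk s) k2) (qw s))).
- by move=> *; apply: ExSeq; eassumption.
- by move=> *; apply: ExWhileF.
- by move=> *; apply: ExWhileT; try eassumption.
- by move=> *; apply: ExIfT.
- by move=> *; apply: ExIfF.
- by move=> *; apply: ExLe; eassumption.
Qed.

Lemma exec_liftR c s t s' f1 k1 : exec X c s t s' ->
  exec X (liftR c) (St (f1, fc s) (sjoin k1 (sk s)) (qw s)) t
                 (St (f1, fc s') (sjoin k1 (sk s')) (qw s')).
Proof.
elim=> {c s t s'}.
- move=> a s /=.
  have -> : sjoin k1 (sk (aeff (a (fc s) (tops s)) s)) =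
     fun v => appop (if v is inr v then eops (a (fc s) (tops s)) v else Keep) (sjoin k1 (sk s) v).
    by apply: functional_extensionality; case.
  exact: (ExAct X _ (St (f1, fc s) (sjoin k1 (sk s)) (qw s))).
- move=> h s; exact: (ExAsk X _ (St (f1, fc s) (sjoin k1 (sk s)) (qw s))).
- by move=> *; apply: ExSeq; eassumption.
- by move=> *; apply: ExWhileF.
- by move=> *; apply: ExWhileT; try eassumption.
- by move=> *; apply: ExIfT.
- by move=> *; apply: ExIfF.
- by move=> *; apply: ExLe; eassumption.
Qed.

End Lift.

Lemma exec_act (F V : finType) X (a : F -> (V -> option bool) -> eff F V) f k w f' k' w' :
  aeff (a f (fun v => ohead (k v))) (St f k w) = St f' k' w' ->
  exec X (Act a) (St f k w) 1 (St f' k' w').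
Proof. by move=> <-; apply: (ExAct X a (St f k w)). Qed.

Section Sim.
Variables (n k : nat) (M : OTM n k).

(* [None] is the query tape. *)
Definition tid : finType := option 'I_k.+1.

Definition tape_of (c : Cfg n k) (i : tid) : Tape := if i is Some j then ctapes c j else cq c.

Definition simF : finType := ('I_n * {ffun tid -> option bool})%type.

(* [(i, true, _)] and [(i, false, _)] hold the cells to the left and to the right of the head
   of tape [i]; the last component selects one of the two bits encoding a symbol. *)
Definition simV : finType := (tid * bool * bool)%type.

Definition sbit (b : bool) (a : Sym) : bool := if b then isSome a else odflt false a.

Definition simsk (L R : tid -> seq Sym) : simV -> seq bool :=
  fun v => let: (i, d, b) := v in map (sbit b) (if d then L i else R i).

Definition dectop (tp : simV -> option bool) i d : Sym :=
  if tp (i, d, true) is Some true then tp (i, d, false) else None.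

Lemma dectopE L R i d :
  dectop (fun v => ohead (simsk L R v)) i d = head None (if d then L i else R i).
Proof.
rewrite /dectop /=; case: d; [case: (L i)|case: (R i)] => //= -[a|] l //=.
Qed.

Definition mvL (mv : Move) (a : Sym) (l r : seq Sym) : seq Sym :=
  match mv with MoveL => behead l | MoveR => a :: l | MoveS => l end.
Definition mvR (mv : Move) (a : Sym) (l r : seq Sym) : seq Sym :=
  match mv with MoveL => a :: r | MoveR => behead r | MoveS => r end.
Definition mvH (mv : Move) (a : Sym) (l r : seq Sym) : Sym :=
  match mv with MoveL => head None l | MoveR => head None r | MoveS => a end.

Definition simdelta (f : simF) : 'I_n * (tid -> Sym * Move) :=
  let: (q', w, am) := delta M f.1 [tuple f.2 (Some i) | i < k.+1] (f.2 None) in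
  (q', fun i => if i is Some j then tnth w j else am).

Definition sim_act : simF -> (simV -> option bool) -> eff simF simV := fun f tp =>
  let: (q', w) := simdelta f in
  Eff (q', [ffun i => match (w i).2 with
                      | MoveL => dectop tp i true
                      | MoveR => dectop tp i false
                      | MoveS => (w i).1 end])
      (fun v => let: (i, d, b) := v in
         match (w i).2, d with
         | MoveL, true | MoveR, false => Pop
         | MoveL, false | MoveR, true => Push (sbit b (w i).1)
         | MoveS, _ => Keep
         end) None.

Variable X : lang.

Lemma exec_sim_act f L R w :
  let: (q', wr) := simdelta f in
  exec X (Act sim_act) (St f (simsk L R) w) 1
    (St (q', [ffun i => mvH (wr i).2 (wr i).1 (L i) (R i)] : {ffun _ -> _})
        (simsk (fun i => mvL (wr i).2 (wr i).1 (L i) (R i))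
               (fun i => mvR (wr i).2 (wr i).1 (L i) (R i))) w).
Proof.
case E: (simdelta f) => [q' wr]; apply: exec_act; rewrite /sim_act E /aeff /= cats0; congr St.
- congr pair; apply/ffunP => i; rewrite !ffunE; case: (wr i) => a [] //=; exact: dectopE.
- apply: functional_extensionality => -[[i d] b] /=.
  by case: (wr i) => a [] /=; case: d => //=; rewrite behead_map.
Qed.

(** To the right of the head of the input tape only [d] cells have to agree, because a run with [d]
    steps left cannot see further; this permits a simulation on a prefix of the input. Comparing by
    [nth None] ignores trailing blanks. *)
Definition srel (d : nat) (c : Cfg n k) (f : simF) (L R : tid -> seq Sym) : Prop :=
  [/\ f.1 = cst c, forall i, f.2 i = thead (tape_of c i),
      forall i j, nth None (L i) j = nth None (tleft (tape_of c i)) j &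
      forall i j, (i == Some ord0 -> j < d) ->
        nth None (R i) j = nth None (tright (tape_of c i)) j].

Lemma tape_mv_head t a mv :
  thead (tape_move (tape_write t a) mv) = mvH mv a (tleft t) (tright t).
Proof. by case: t => l h r; case: mv => //=; [case: l | case: r]. Qed.

Lemma tape_mv_left t a mv j :
  nth None (tleft (tape_move (tape_write t a) mv)) j = nth None (mvL mv a (tleft t) (tright t)) j.
Proof. by case: t => l h r; case: mv => //=; [case: l | case: r]. Qed.

Lemma tape_mv_right t a mv j :
  nth None (tright (tape_move (tape_write t a) mv)) j = nth None (mvR mv a (tleft t) (tright t)) j.
Proof. by case: t => l h r; case: mv => //=; [case: l | case: r]. Qed.

Lemma srel_step d c f L R : srel d.+1 c f L R -> ~~ halted M c -> cst c != qry M ->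
  let: (q', wr) := simdelta f in
  srel d (step M X c) (q', [ffun i => mvH (wr i).2 (wr i).1 (L i) (R i)] : {ffun _ -> _})
    (fun i => mvL (wr i).2 (wr i).1 (L i) (R i)) (fun i => mvR (wr i).2 (wr i).1 (L i) (R i)).
Proof.
case=> E1 E2 E3 E4 nh nq; rewrite /step (negPf nh) (negPf nq) /simdelta E1.
have -> : [tuple f.2 (Some i) | i < k.+1] = [tuple thead (ctapes c i) | i < k.+1].
  by apply: eq_from_tnth => i; rewrite !tnth_mktuple E2.
rewrite (E2 None) /=; case: (delta _ _ _ _) => [[q' w] [a m]].
pose wr (i : tid) := if i is Some j then tnth w j else (a, m); set c' := mkCfg _ _ _.
suff: srel d c' (q', [ffun i => mvH (wr i).2 (wr i).1 (L i) (R i)] : {ffun _ -> _})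
  (fun i => mvL (wr i).2 (wr i).1 (L i) (R i)) (fun i => mvR (wr i).2 (wr i).1 (L i) (R i)) by [].
have Et i : tape_of c' i = tape_move (tape_write (tape_of c i) (wr i).1) (wr i).2.
  by case: i => [i|] //=; case: (tnth w i).
split=> //.
- move=> i; rewrite ffunE Et tape_mv_head; case: (wr i).2 => //=.
    by rewrite -!nth0 E3.
  by rewrite -!nth0 E4.
- move=> i j; rewrite Et tape_mv_left; case: (wr i).2 => //=.
    by rewrite !nth_behead E3.
  by case: j => //= j; rewrite E3.
- move=> i j jd; rewrite Et tape_mv_right; case: (wr i).2 => //=.
  + by case: j jd => //= j jd; rewrite E4 // => /jd /ltnW /ltnW.
  + by rewrite !nth_behead E4.
  + by rewrite E4 // => /jd /ltnW.
Qed.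

Lemma srel_le d d' c f L R : d' <= d -> srel d c f L R -> srel d' c f L R.
Proof.
move=> le [E1 E2 E3 E4]; split=> // i j H; apply: E4 => /H jd; exact: leq_trans jd le.
Qed.

Definition updT T (L : tid -> T) i x : tid -> T := fun j => if j == i then x else L j.

Definition query_word (f : simF) (L R : tid -> seq Sym) : seq bool :=
  pmap id (rev (L None) ++ f.2 None :: R None).

Lemma pmap_nth_eq (l l' : seq Sym) :
  (forall j, nth None l j = nth None l' j) -> pmap id l = pmap id l'.
Proof.
elim: l l' => [|a l IH] l' E.
  elim: l' E => // a l' IH E /=; have /= <- := E 0; rewrite /= -IH // => j.
  by have := E j.+1 => /= <-; rewrite nth_nil.
case: l' E => [|a' l'] E.
  have /= -> := E 0; rewrite /= (IH [::]) // => j.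
  by have /= -> := E j.+1; rewrite nth_nil.
by have /= -> := E 0; rewrite /= (IH l') // => j; have := E j.+1.
Qed.

Lemma pmap_rev (l : seq Sym) : pmap id (rev l) = rev (pmap id l).
Proof.
elim: l => //= a l IH; rewrite rev_cons -cats1 pmap_cat IH /=.
by case: a => [b|] /=; rewrite ?cats0 // rev_cons cats1.
Qed.

Lemma srel_word d c f L R : srel d c f L R -> query_word f L R = tape_word (cq c).
Proof.
case=> _ E2 E3 E4; rewrite /query_word /tape_word !pmap_cat /= (E2 None) !pmap_rev.
by rewrite (pmap_nth_eq (E3 None)) (@pmap_nth_eq (R None) (tright (cq c))) // => j; apply: E4.
Qed.

Definition after_query (f : simF) (b : bool) : simF :=
  (if b then qyes M else qno M, [ffun i => if i == None then None else f.2 i]).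

Lemma srel_query d c f L R : srel d c f L R -> ~~ halted M c -> cst c = qry M ->
  srel d (step M X c) (after_query f (X (query_word f L R))) (updT L None [::]) (updT R None [::]).
Proof.
move=> S nh Eq; have [E1 E2 E3 E4] := S; rewrite (srel_word S).
rewrite /step (negPf nh) Eq eqxx /after_query; split=> //=.
- by move=> i; rewrite ffunE; case: i => [i|] //=; rewrite E2.
- by move=> i j; rewrite /updT; case: i => [i|] //=; rewrite E3.
- by move=> i j; rewrite /updT; case: i => [i|] //= H; rewrite E4.
Qed.

Definition clear_heads (f : simF) : simF := (f.1, [ffun=> None]).

Definition sim_clear : cmd simF simV :=
  Seq (Act (fun f _ => nop simV (clear_heads f)))
      (While (fun _ tp => [exists v, tp v != None])
             (Act (fun f _ => Eff f (fun=> Pop) None))).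

Lemma exec_sim_clear m f sk0 w : (forall v, size (sk0 v) <= m) ->
  exec X sim_clear (St f sk0 w) (2 * m + 2) (St (clear_heads f) (fun=> [::]) w).
Proof.
move=> H; have -> : 2 * m + 2 = 1 + (2 * m + 1) by lia.
apply: ExSeq; first by apply: exec_act; rewrite /aeff /= cats0.
elim: m sk0 H => [|m IH] sk0 H.
  have -> : sk0 = fun=> [::].
    by apply: functional_extensionality => v; apply/nilP; rewrite /nilp -leqn0.
  by apply: ExWhileF => /=; apply/existsP => -[].
have [E|nE] := boolP [exists v, ohead (sk0 v) != None].
  have -> : 2 * m.+1 + 1 = 1 + 1 + (2 * m + 1) by lia.
  apply: (ExWhileT (s1 := St (clear_heads f) (fun v => behead (sk0 v)) w)) => //.
    by apply: exec_act; rewrite /aeff /= cats0.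
  by apply: IH => v; rewrite size_behead; have := H v; lia.
have -> : sk0 = fun=> [::].
  apply: functional_extensionality => v; move/existsPn/(_ v): nE.
  by case: (sk0 v).
by apply: (ExLe (t := 1)); [apply: ExWhileF => /=; apply/existsP => -[] | lia].
Qed.

Definition init_simf (q : 'I_n) (a : Sym) : simF :=
  (q, [ffun i => if i == Some ord0 then a else None]).

Definition init_simR (x : seq Sym) : tid -> seq Sym :=
  fun i => if i == Some ord0 then x else [::].

Lemma srel_init d x x' : (forall j, j <= d -> nth None (map Some x') j = nth None (map Some x) j) ->
  srel d (init M x) (init_simf (start M) (head None (map Some x')))
    (fun=> [::]) (init_simR (behead (map Some x'))).
Proof.
move=> H; split=> //=.
- move=> i; rewrite ffunE; case: i => [i|] //=; rewrite (inj_eq (@Some_inj _)).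
  by case: (i == ord0) => //=; rewrite -nth0 H //; case: (x).
- by move=> [i|] j //=; case: (i == ord0) => //; case: (x).
- move=> [i|] j //; rewrite /init_simR /= (inj_eq (@Some_inj _)); case: (i == ord0) => //= jd.
  by rewrite nth_behead H ?jd //; case: (x); rewrite //= nth_nil.
Qed.

Definition sim_step (hq : cmd simF simV) : cmd simF simV :=
  If (fun f _ => f.1 == qry M) hq (Act sim_act).

(** The queried word spans both sides of the head. The head symbol and the left part are first
    shifted to the right stack, which is then emptied onto the real query tape. The time is left
    open: this query serves the decoding part, whose cost enters as a constant for each index. *)
Definition real_query : cmd simF simV :=
  Seq (Act (fun (f : simF) _ => Eff (f.1, [ffun i => if i == None then None else f.2 i])
        (fun v => let: (i, d, b) := v in
           if (i == None) && ~~ d then Push (sbit b (f.2 None)) else Keep) None))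
 (Seq (While (fun f tp => tp (None, true, true) != None)
        (Act (fun f tp => Eff f (fun v => let: (i, d, b) := v in
           if i == None then (if d then Pop else Push (sbit b (dectop tp None true))) else Keep) None)))
 (Seq (While (fun f tp => tp (None, false, true) != None)
        (Act (fun f tp => Eff f (fun v => let: (i, d, b) := v in
           if (i == None) && ~~ d then Pop else Keep) (dectop tp None false))))
      (Ask _ (fun (f : simF) b => (if b then qyes M else qno M, f.2))))).

Lemma exec_real_query f L R : exists t,
  exec X real_query (St f (simsk L R) [::]) t
    (St (after_query f (X (query_word f L R)))
        (simsk (updT L None [::]) (updT R None [::])) [::]).
Proof.
set f' : simF := (f.1, [ffun i => if i == None then None else f.2 i]).
pose R1 := updT R None (f.2 None :: R None).
have H1 : exec X (Act (fun (f : simF) _ => Eff (f.1, [ffun i => if i == None then None else f.2 i])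
        (fun v => let: (i, d, b) := v in
           if (i == None) && ~~ d then Push (sbit b (f.2 None)) else Keep) None))
     (St f (simsk L R) [::]) 1 (St f' (simsk L R1) [::]).
  apply: exec_act; rewrite /aeff /=; congr St.
  apply: functional_extensionality => -[[i d] b] /=; rewrite /R1 /updT.
  by case: eqP => [->|_]; case: d.
have H2 l r : exists t, exec X (While (fun f tp => tp (None, true, true) != None)
        (Act (fun f tp => Eff f (fun v => let: (i, d, b) := v in
           if i == None then (if d then Pop else Push (sbit b (dectop tp None true))) else Keep) None)))
     (St f' (simsk (updT L None l) (updT R None r)) [::]) t
     (St f' (simsk (updT L None [::]) (updT R None (catrev l r))) [::]).
  elim: l r => [|a l IH] r; first by exists 1; apply: ExWhileF.
  have [t Ht] := IH (a :: r); exists (1 + 1 + t); apply: ExWhileT Ht => //=.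
  apply: exec_act; rewrite /aeff /=; congr St.
  apply: functional_extensionality => -[[i d] b]; rewrite dectopE /= /updT.
  by case: d; case: (i == None).
have H3 rr w : exists t, exec X (While (fun f tp => tp (None, false, true) != None)
        (Act (fun f tp => Eff f (fun v => let: (i, d, b) := v in
           if (i == None) && ~~ d then Pop else Keep) (dectop tp None false))))
     (St f' (simsk (updT L None [::]) (updT R None rr)) w) t
     (St f' (simsk (updT L None [::]) (updT R None [::])) (w ++ pmap id rr)).
  elim: rr w => [|a rr IH] w; first by exists 1; rewrite cats0; apply: ExWhileF.
  have [t Ht] := IH (w ++ seq_of_opt a); exists (1 + 1 + t).
  apply: (ExWhileT (s1 := St f' (simsk (updT L None [::]) (updT R None rr)) (w ++ seq_of_opt a))) => //=.
    apply: exec_act; rewrite /aeff /=; congr St; last by rewrite dectopE.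
    apply: functional_extensionality => -[[i d] b] /=; rewrite /updT.
    by case: d; case: (i == None).
  by case: a Ht => [a|] /=; rewrite -?catA.
have EL : updT L None (L None) = L.
  by apply: functional_extensionality => i; rewrite /updT; case: eqP => [->|].
have [t2 {}H2] := H2 (L None) (f.2 None :: R None); rewrite EL in H2.
have [t3 {}H3] := H3 (catrev (L None) (f.2 None :: R None)) [::].
exists (1 + (t2 + (t3 + 1))).
apply: ExSeq; first exact: H1.
apply: ExSeq; first exact: H2.
apply: ExSeq; first exact: H3.
have := ExAsk X (fun (f : simF) b => (if b then qyes M else qno M, f.2))
  (St f' (simsk (updT L None [::]) (updT R None [::])) (pmap id (catrev (L None) (f.2 None :: R None)))).
rewrite /query_word catrevE /after_query.
congr (exec _ _ _ _ (St _ _ _)); apply: functional_extensionality => -[[i d] b] //=.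
Qed.

Definition sim_run : cmd simF simV :=
  While (fun f _ => ~~ ((f.1 == acc M) || (f.1 == rej M))) (sim_step real_query).

Lemma exec_sim_run m c f L R : srel m c f L R -> halted M (iter m (step M X) c) ->
  exists t f' L' R', exec X sim_run (St f (simsk L R) [::]) t (St f' (simsk L' R') [::]) /\
    f'.1 = cst (iter m (step M X) c).
Proof.
elim: m c f L R => [|m IH] c f L R S H.
  have [E _ _ _] := S; exists 1, f, L, R; split=> //; apply: ExWhileF => /=.
  by rewrite E -/(halted M c) H.
have [E _ _ _] := S.
have [h|nh] := boolP (halted M c).
  have St j : iter j (step M X) c = c by elim: j => //= j ->; rewrite /step h.
  exists 1, f, L, R; split; last by rewrite St.
  by apply: ExWhileF => /=; rewrite E -/(halted M c) h.
rewrite iterSr in H *.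
have [Eq|nq] := eqVneq (cst c) (qry M).
  have S' := srel_query (srel_le (leqnSn m) S) nh Eq.
  have [t [f' [L' [R' [Ht E']]]]] := IH _ _ _ _ S' H.
  have [tq Hq] := exec_real_query f L R.
  exists (1 + tq.+1 + t), f', L', R'; split=> //; apply: ExWhileT Ht => /=.
    by rewrite E -/(halted M c).
  by apply: ExIfT => //=; rewrite E Eq.
have := srel_step S nh nq; have := exec_sim_act f L R [::].
case: (simdelta f) => q' wr Ha S'.
have [t [f' [L' [R' [Ht E']]]]] := IH _ _ _ _ S' H.
exists (1 + 2 + t), f', L', R'; split=> //; apply: ExWhileT Ht => /=.
  by rewrite E -/(halted M c).
by apply: ExIfF => //=; rewrite E (negPf nq).
Qed.

End Sim.

(** * Sparse sets coded by binary sequences *)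

Local Notation nt n := (nseq n true).

Section ListStore.
Variable m : nat.

Definition stk (l : seq (seq bool)) : 'I_m -> seq bool := fun i => nth [::] l i.
Definition lops (o : seq sop) : 'I_m -> sop := fun i => nth Keep o i.

Fixpoint zapp (o : seq sop) (l : seq (seq bool)) : seq (seq bool) :=
  match o, l with
  | x :: o', s :: l' => appop x s :: zapp o' l'
  | _, _ => l
  end.

Lemma zappE o l : size o <= size l ->
  (fun v => appop (lops o v) (stk l v)) = stk (zapp o l).
Proof.
move=> le; apply: functional_extensionality => v; rewrite /lops /stk; move: (nat_of_ord v).
elim: l o le => [|s l IH] [|x o] //= le [|j] //=; exact: IH.
Qed.

Lemma exec_actl (F : finType) X (a : F -> ('I_m -> option bool) -> eff F 'I_m) o f l w f' l' :
  a f (fun v => ohead (stk l v)) = Eff f' (lops o) None -> size o <= size l ->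
  zapp o l = l' -> exec X (Act a) (St f (stk l) w) 1 (St f' (stk l') w).
Proof. by move=> E le <-; apply: exec_act; rewrite E /aeff /= cats0 zappE. Qed.

End ListStore.

Lemma exec_le F V X (c : cmd F V) s t t' s' : t <= t' -> exec X c s t s' -> exec X c s t' s'.
Proof. by move=> le H; apply: ExLe H le. Qed.

(* The subset of 0^* coded by [al]: it contains 0^(2^i) iff [al i]. *)
Definition pw (al : nat -> bool) (c : nat) : bool :=
  has (fun i => (c == 2 ^ i) && al i) (iota 0 c).

Definition powset (al : nat -> bool) : lang := fun y => ~~ has id y && pw al (count negb y).

Definition bit (g i : nat) : bool := odd (g %/ 2 ^ i).

Lemma pwP (al : nat -> bool) c : reflect (exists2 i, c = 2 ^ i & al i) (pw al c).
Proof.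
apply: (iffP hasP) => [[i _ /andP[/eqP-> ?]]|[i -> ai]]; first by exists i.
by exists i; rewrite ?eqxx // mem_iota add0n ltn_expl.
Qed.

Lemma pw_pow al i : pw al (2 ^ i) = al i.
Proof.
apply/pwP/idP => [[j E]|ai]; last by exists i.
by have /eqP := E; rewrite eqn_exp2l // => /eqP ->.
Qed.

(** Halving the length and the guess together moves bit i + 1 to bit i. At the first odd length only
    the value 1 is a power of two, and the answer is the parity of what is left of the guess. This
    is the loop of [lookup]. *)
Lemma pw_half g c : ~~ odd c -> pw (bit g) c = pw (bit g./2) c./2.
Proof.
move=> ev; apply/pwP/pwP => -[i E b].
  case: i E b => [|i] E b; first by rewrite E in ev.
  exists i; first by rewrite E expnS mul2n doubleK.
  by move: b; rewrite /bit expnS divnMA divn2.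
exists i.+1; first by rewrite expnS mul2n -E; lia.
by move: b; rewrite /bit expnS divnMA divn2.
Qed.

Lemma pw_odd g c : odd c -> pw (bit g) c = (c == 1) && odd g.
Proof.
move=> oc; apply/pwP/andP => [[[|i] E]|[/eqP-> og]].
- by rewrite E /bit divn1.
- by move: oc; rewrite E expnS mul2n odd_double.
- by exists 0; rewrite // /bit divn1.
Qed.

Section Lookup.
Variable X : lang.

(* Stack 0 is the input, 1 the guess, 2 the clock, 5 the length of the queried word, all but
   the first in unary; the others are temporaries. *)
Definition lookV : finType := 'I_7.
Local Notation "'# i" := (@Ordinal 7 i isT) (at level 8).
(* (the queried word contains a true; answer; keep halving; parities of C and Z) *)
Definition lookF : finType := (bool * bool * bool * bool * bool)%type.

Definition ne (V : Type) (v : V) : (V -> option bool) -> bool := fun tp => isSome (tp v).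

Definition copyU : cmd lookF lookV :=
  Seq (While (fun _ => ne '#1) (Act (fun f _ => Eff f (@lops 7 [:: Keep; Pop; Keep; Keep; Push true]) None)))
      (While (fun _ => ne '#4)
         (Act (fun f _ => Eff f (@lops 7 [:: Keep; Push true; Keep; Push true; Pop]) None))).

Definition halve : cmd lookF lookV :=
  While (fun _ tp => ne '#5 tp || ne '#3 tp)
    (Act (fun f tp => let: (bad, ans, go, pc, pz) := f in
       Eff (bad, ans, go, pc (+) ne '#5 tp, pz (+) ne '#3 tp)
           (@lops 7 [:: Keep; Keep; Keep; Pop; if pz && ne '#3 tp then Push true else Keep; Pop;
                        if pc && ne '#5 tp then Push true else Keep]) None)).

Definition unhalve : cmd lookF lookV :=
  While (fun _ tp => ne '#6 tp || ne '#4 tp)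
    (Act (fun f tp =>
       Eff f (@lops 7 [:: Keep; Keep; Keep; if ne '#4 tp then Push true else Keep; Pop;
                          if ne '#6 tp then Push true else Keep; Pop]) None)).

(** [halve] consumes its argument, hence the copy of the guess on stack 3. At an odd length the
    quotient on stack 6 is empty exactly when the length was 1. The answer is [false] unless set
    there, which is right for length 0. The last loop clears all temporaries at once. *)
Definition lookup : cmd lookF lookV :=
  Seq copyU
 (Seq (While (fun (f : lookF) tp => let: (bad, ans, go, pc, pz) := f in ne '#5 tp && go)
   (Seq (Act (fun (f : lookF) _ => let: (bad, ans, go, pc, pz) := f in
               nop lookV (bad, ans, go, false, false)))
   (Seq halve
        (If (fun (f : lookF) _ => let: (bad, ans, go, pc, pz) := f in pc)
            (Act (fun (f : lookF) tp => let: (bad, ans, go, pc, pz) := f in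
                    nop lookV (bad, pz && ~~ ne '#6 tp, false, pc, pz)))
            unhalve))))
   (While (fun _ tp => [|| ne '#3 tp, ne '#4 tp, ne '#5 tp | ne '#6 tp])
      (Act (fun f _ => Eff f (@lops 7 [:: Keep; Keep; Keep; Pop; Pop; Pop; Pop]) None)))).

Lemma exec_copyU f x g w z c d q :
  exec X copyU (St f (@stk 7 [:: x; nt g; w; z; [::]; c; d]) q) (4 * g + 2)
             (St f (@stk 7 [:: x; nt g; w; nt g ++ z; [::]; c; d]) q).
Proof.
have -> : 4 * g + 2 = (2 * g + 1) + (2 * g + 1) by lia.
have A h t : exec X (While (fun _ => ne '#1)
       (Act (fun f _ => Eff f (@lops 7 [:: Keep; Pop; Keep; Keep; Push true]) None)))
    (St f (@stk 7 [:: x; nt h; w; z; nt t; c; d]) q) (2 * h + 1)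
    (St f (@stk 7 [:: x; [::]; w; z; nt (h + t); c; d]) q).
  elim: h t => [|h IH] t; first by apply: (ExWhileF _ (g := fun _ => ne '#1)).
  have -> : 2 * h.+1 + 1 = 1 + 1 + (2 * h + 1) by lia.
  rewrite [h.+1 + t]addSnnS; apply: (ExWhileT _ _ (IH t.+1)) => //.
  exact: exec_actl.
have B h u z' : exec X (While (fun _ => ne '#4)
         (Act (fun f _ => Eff f (@lops 7 [:: Keep; Push true; Keep; Push true; Pop]) None)))
    (St f (@stk 7 [:: x; nt u; w; nt z' ++ z; nt h; c; d]) q) (2 * h + 1)
    (St f (@stk 7 [:: x; nt (h + u); w; nt (h + z') ++ z; [::]; c; d]) q).
  elim: h u z' => [|h IH] u z'; first by apply: (ExWhileF _ (g := fun _ => ne '#4)).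
  have -> : 2 * h.+1 + 1 = 1 + 1 + (2 * h + 1) by lia.
  rewrite [h.+1 + u]addSnnS [h.+1 + z']addSnnS; apply: (ExWhileT _ _ (IH u.+1 z'.+1)) => //.
  exact: exec_actl.
apply: ExSeq; first exact: (A g 0).
by have := B (g + 0) 0 0; rewrite !addn0.
Qed.

Lemma exec_halve bad ans go pc pz x u w q z t c d :
  exec X halve (St (bad, ans, go, pc, pz) (@stk 7 [:: x; u; w; nt z; nt t; nt c; nt d]) q)
     (2 * (z + c) + 1)
     (St (bad, ans, go, pc (+) odd c, pz (+) odd z)
         (@stk 7 [:: x; u; w; [::]; nt (t + (z + pz)./2); [::]; nt (d + (c + pc)./2)]) q).
Proof.
move E: (z + c) => k; move: (leqnn k); rewrite -{1}E => {E}.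
elim: k pc pz z t c d => [|k IH] pc pz z t c d.
  case: z => //; case: c => // _ ; rewrite /= !addbF.
  by case: pc; case: pz; rewrite !addn0; apply: ExWhileF.
case Ez: ((0 < c) || (0 < z)) => le; last first.
  have [-> ->] : z = 0 /\ c = 0 by lia.
  apply: (exec_le (t := 1)); first lia.
  by case: pc; case: pz; rewrite !addn0; apply: ExWhileF.
have -> : 2 * k.+1 + 1 = 1 + 1 + (2 * k + 1) by lia.
have := IH (pc (+) (0 < c)) (pz (+) (0 < z)) z.-1 (t + (pz && (0 < z))) c.-1 (d + (pc && (0 < c))).
have -> : pc (+) (0 < c) (+) odd c.-1 = pc (+) odd c by lia.
have -> : pz (+) (0 < z) (+) odd z.-1 = pz (+) odd z by lia.
have -> : t + (pz && (0 < z)) + (z.-1 + (pz (+) (0 < z)))./2 = t + (z + pz)./2 by lia.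
have -> : d + (pc && (0 < c)) + (c.-1 + (pc (+) (0 < c)))./2 = d + (c + pc)./2 by lia.
move=> H; apply: (ExWhileT _ _ (H _)); last by lia.
  by move: Ez; case: (c); case: (z).
by case: (c) => [|c']; case: (z) => [|z']; case: (pc); case: (pz); apply: exec_actl => //=;
   rewrite ?addn0 ?addn1.
Qed.

Lemma exec_unhalve f x u w q z t c d :
  exec X unhalve (St f (@stk 7 [:: x; u; w; nt z; nt t; nt c; nt d]) q) (2 * (t + d) + 1)
     (St f (@stk 7 [:: x; u; w; nt (t + z); [::]; nt (d + c); [::]]) q).
Proof.
move E: (t + d) => k; move: (leqnn k); rewrite -{1}E => {E}.
elim: k z t c d => [|k IH] z t c d.
  by case: t => //; case: d => // _; apply: ExWhileF.
case Ez: ((0 < d) || (0 < t)) => le; last first.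
  have [-> ->] : t = 0 /\ d = 0 by lia.
  by apply: (exec_le (t := 1)); [lia | apply: ExWhileF].
have -> : 2 * k.+1 + 1 = 1 + 1 + (2 * k + 1) by lia.
have := IH (z + (0 < t)) t.-1 (c + (0 < d)) d.-1.
have -> : t.-1 + (z + (0 < t)) = t + z by lia.
have -> : d.-1 + (c + (0 < d)) = d + c by lia.
move=> H; apply: (ExWhileT _ _ (H _)); last by lia.
  by move: Ez; case: (d); case: (t).
by case: (d) => [|d']; case: (t) => [|t']; apply: exec_actl => //=; rewrite ?addn0 ?addn1.
Qed.

Lemma exec_lookup bad pc pz x g w c q : exists pc' pz' go',
  exec X lookup (St (bad, false, true, pc, pz) (@stk 7 [:: x; nt g; w; [::]; [::]; nt c; [::]]) q)
     (20 * (c + g + 2) ^ 2)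
     (St (bad, pw (bit g) c, go', pc', pz') (@stk 7 [:: x; nt g; w; [::]; [::]; [::]; [::]]) q).
Proof.
rewrite /lookup; set body := (X in Seq copyU (Seq (While _ X) _)).
(* The bound on what remains on the four temporaries pays for the final clearing loop. *)
have loop k z c0 pc0 pz0 : c0 <= k -> exists pc' pz' go' z' t' c' d',
   [/\ z' + t' + c' + d' <= z + c0 &
   exec X (While (fun (f : lookF) tp => let: (bad, ans, go, pc, pz) := f in ne '#5 tp && go) body)
     (St (bad, false, true, pc0, pz0) (@stk 7 [:: x; nt g; w; nt z; [::]; nt c0; [::]]) q)
     (k * (4 * (z + c0) + 5) + 1)
     (St (bad, pw (bit z) c0, go', pc', pz') (@stk 7 [:: x; nt g; w; nt z'; nt t'; nt c'; nt d']) q)].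
  elim: k z c0 pc0 pz0 => [|k IH] z c0 pc0 pz0.
    case: c0 => // _; exists pc0, pz0, true, z, 0, 0, 0; split; first by lia.
    by apply: ExWhileF.
  have [->|c_gt0] := posnP c0.
    exists pc0, pz0, true, z, 0, 0, 0; split; first by lia.
    by apply: (exec_le (t := 1)); [lia | apply: ExWhileF].
  move=> le_c.
  have H1 : exec X (Act (fun (f : lookF) _ => let: (bad, ans, go, pc, pz) := f in
               nop lookV (bad, ans, go, false, false)))
     (St (bad, false, true, pc0, pz0) (@stk 7 [:: x; nt g; w; nt z; [::]; nt c0; [::]]) q) 1
     (St (bad, false, true, false, false) (@stk 7 [:: x; nt g; w; nt z; [::]; nt c0; [::]]) q).
    by apply: exec_act; rewrite /aeff /= cats0.
  have H2 := exec_halve bad false true false false x (nt g) w q z 0 c0 0.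
  rewrite /= !add0n !addn0 in H2.
  case oc: (odd c0) H2 => H2.
    exists true, (odd z), false, 0, z./2, 0, c0./2; split; first by lia.
    rewrite pw_odd //; have -> : (c0 == 1) && odd z = odd z && ~~ ne '#6 (fun v : 'I_7 => ohead (@stk 7 [:: x; nt g; w; [::]; nt z./2; [::]; nt c0./2] v)).
      rewrite andbC; congr andb; rewrite /ne /=.
      by case: c0 oc {le_c c_gt0 H1 H2} => [|[|c0]].
    apply: (exec_le (t := 1 + (1 + ((2 * (z + c0) + 1) + 2)) + 1)); first by nia.
    apply: ExWhileT; first by case: (c0) c_gt0.
      apply: ExSeq; first exact: H1.
      apply: ExSeq; first exact: H2.
      apply: ExIfT => //.
      by apply: exec_act; rewrite /aeff /= cats0.
    by apply: ExWhileF => //=; case: (c0./2).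
  have [|pc' [pz' [go' [z' [t' [c' [d' [le' H3]]]]]]]] := IH z./2 c0./2 false (odd z).
    by lia.
  exists pc', pz', go', z', t', c', d'; split; first by lia.
  rewrite pw_half ?oc //.
  apply: (exec_le (t := 1 + (1 + ((2 * (z + c0) + 1) + (2 * (z./2 + c0./2) + 1).+1)) +
                     (k * (4 * (z./2 + c0./2) + 5) + 1))).
    have : k * (4 * (z./2 + c0./2) + 5) <= k * (4 * (z + c0) + 5) by rewrite leq_mul //; lia.
    by lia.
  apply: ExWhileT; first by case: (c0) c_gt0.
    apply: ExSeq; first exact: H1.
    apply: ExSeq; first exact: H2.
    apply: ExIfF => //.
    exact: (exec_unhalve (bad, false, true, false, odd z) x (nt g) w q 0 z./2 0 c0./2).
  by rewrite !addn0.
have [pc' [pz' [go' [z' [t' [c' [d' [le' H]]]]]]]] := loop c g c pc pz (leqnn c).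
exists pc', pz', go'.
apply: (exec_le (t := (4 * g + 2) + ((c * (4 * (g + c) + 5) + 1) + (2 * (g + c) + 1)))).
  by rewrite -mulnn; nia.
apply: ExSeq; first by (have := exec_copyU (bad, false, true, pc, pz) x g w [::] (nt c) [::] q; rewrite cats0; apply).
apply: ExSeq; first exact: H.
move: (g + c) le' => K {H loop}.
elim: K z' t' c' d' => [|K IH] z' t' c' d' le'.
  have [-> -> -> ->] : [/\ z' = 0, t' = 0, c' = 0 & d' = 0] by split; lia.
  exact: ExWhileF.
case Ez: [|| 0 < z', 0 < t', 0 < c' | 0 < d'].
  have -> : 2 * K.+1 + 1 = 1 + 1 + (2 * K + 1) by lia.
  apply: (ExWhileT _ _ (IH z'.-1 t'.-1 c'.-1 d'.-1 _)); last by lia.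
    by move: Ez; rewrite /ne /=; case: (z'); case: (t'); case: (c'); case: (d').
  apply: exec_actl => //=; rewrite ?addn0.
  by case: (z') => [|?]; case: (t') => [|?]; case: (c') => [|?]; case: (d').
have [-> -> -> ->] : [/\ z' = 0, t' = 0, c' = 0 & d' = 0] by split; lia.
by apply: (exec_le (t := 1)); [lia | apply: ExWhileF].
Qed.

End Lookup.

(** * Generic sparse sets are low for speed *)

Section SimAndStore.
Variables (n k m : nat) (F2 : finType) (M : OTM n k).
Let F : finType := (simF n k * F2)%type.
Let V : finType := (simV k + 'I_m)%type.

Definition ojoin (o1 : simV k -> sop) (o2 : seq sop) : V -> sop :=
  fun v => match v with inl v => o1 v | inr v => lops o2 v end.

Definition jstk (L R : tid k -> seq Sym) (l : seq (seq bool)) : V -> seq bool :=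
  sjoin (simsk L R) (@stk m l).

Lemma exec_actj X (a : F -> (V -> option bool) -> eff F V) o1 o2 f f' L R L' R' l l' w :
  a f (fun v => ohead (jstk L R l v)) = Eff f' (ojoin o1 o2) None ->
  (forall i d b, appop (o1 (i, d, b)) (map (sbit b) (if d then L i else R i)) =
                 map (sbit b) (if d then L' i else R' i)) ->
  size o2 <= size l -> zapp o2 l = l' ->
  exec X (Act a) (St f (jstk L R l) w) 1 (St f' (jstk L' R' l') w).
Proof.
move=> E H le <-; apply: exec_act; rewrite E /aeff /= cats0; congr St.
apply: functional_extensionality => -[[[i d] b]|v] /=; first exact: H.
by rewrite -(@zappE m o2 l le).
Qed.

End SimAndStore.

Section GuessedRun.
Local Notation "'# i" := (inr (@Ordinal 7 i isT)) (at level 8).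
Variables (n k : nat) (M : OTM n k) (X : lang).

Let F : finType := (simF n k * lookF)%type.
Let V : finType := (simV k + 'I_7)%type.
Local Notation K := (fun _ : simV k => Keep).
Local Notation jst := (@jstk k 7).

(** Membership in [powset] depends only on the presence of a [true] and on the number of [false]. So
    the simulated query tape can be consumed cell by cell in any order, with one flag and one
    counter, and no word has to be assembled. *)
Definition note (f : F) (a : Sym) : F :=
  let: (s, (bad, ans, go, pc, pz)) := f in (s, (bad || (a == Some true), ans, go, pc, pz)).

Definition pushC (a : Sym) : seq sop :=
  [:: Keep; Keep; Keep; Keep; Keep; if a == Some false then Push true else Keep].

Definition drain (d : bool) : cmd F V :=
  While (fun _ (tp : V -> option bool) => tp (inl (None, d, true)) != None)
    (Act (fun (f : F) (tp : V -> option bool) =>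
       let a := dectop (fun v => tp (inl v)) None d in
       Eff (note f a)
         (ojoin (fun v => let: (i, d', b) := v in if (i == None) && (d' == d) then Pop else Keep)
                (pushC a)) None)).

Definition guess_query : cmd F V :=
  Seq (Act (fun (f : F) _ => let: (s, (bad, ans, go, pc, pz)) := f in
         Eff (s.1, [ffun i => if i == None then None else s.2 i],
              (s.2 None == Some true, false, true, pc, pz)) (ojoin K (pushC (s.2 None))) None))
 (Seq (drain true)
 (Seq (drain false)
 (Seq (liftR _ _ lookup)
      (Act (fun (f : F) _ => let: (s, (bad, ans, go, pc, pz)) := f in
         nop V ((if ~~ bad && ans then qyes M else qno M), s.2, (bad, ans, go, pc, pz))))))).

Definition cntf (l : seq Sym) := count (pred1 (Some false)) l.
Definition hast (l : seq Sym) := has (pred1 (Some true)) l.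

Lemma powset_cells al (l : seq Sym) :
  powset al (pmap id l) = ~~ hast l && pw al (cntf l).
Proof.
have E1 : has id (pmap id l) = hast l by elim: l => //= -[[]|] l.
have E2 : count negb (pmap id l) = cntf l by elim: l {E1} => //= -[[]|] l //= ->.
by rewrite /powset E1 E2.
Qed.

Lemma exec_drain d s bad ans go pc pz L R c x u w q :
  exec X (drain d) (St (s, (bad, ans, go, pc, pz)) (jst L R [:: x; u; w; [::]; [::]; nt c; [::]]) q)
     (2 * size (if d then L None else R None) + 1)
     (St (s, (bad || hast (if d then L None else R None), ans, go, pc, pz))
         (jst (if d then updT L None [::] else L) (if d then R else updT R None [::])
            [:: x; u; w; [::]; [::]; nt (cntf (if d then L None else R None) + c); [::]]) q).
Proof.
move E: (if d then L None else R None) => l; elim: l bad c L R E => [|a l IH] bad c L R E.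
  have -> : (if d then updT L None [::] else L) = L.
    case: d E => // E; apply: functional_extensionality => i; rewrite /updT -E.
    by case: eqP => [->|].
  have -> : (if d then R else updT R None [::]) = R.
    case: d E => // E; apply: functional_extensionality => i; rewrite /updT -E.
    by case: eqP => [->|].
  rewrite orbF /= add0n; apply: ExWhileF => /=.
  by rewrite /tops /jstk /= E.
pose L1 := if d then updT L None l else L; pose R1 := if d then R else updT R None l.
have -> : 2 * size (a :: l) + 1 = 1 + 1 + (2 * size l + 1) by rewrite /=; lia.
have := IH (bad || (a == Some true)) ((a == Some false) + c) L1 R1.
have -> : (if d then L1 None else R1 None) = l by rewrite /L1 /R1; case: (d).
have -> : (if d then updT L1 None [::] else L1) = if d then updT L None [::] else L.
  rewrite /L1; case: (d) => //; apply: functional_extensionality => i; rewrite /updT.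
  by case: eqP.
have -> : (if d then R1 else updT R1 None [::]) = if d then R else updT R None [::].
  rewrite /R1; case: (d) => //; apply: functional_extensionality => i; rewrite /updT.
  by case: eqP.
rewrite -orbA [hast (a :: l)]/= addnA [_ + (a == _)]addnC => H.
apply: (ExWhileT _ _ (H erefl)) => /=; first by rewrite /tops /jstk /= E.
apply: (@exec_actj _ _ _ _ _ _ (fun v => let: (i, d', b) := v in
          if (i == None) && (d' == d) then Pop else Keep) (pushC a)) => //=.
- rewrite (dectopE L R) E /=; by case: (bad).
- move=> i d' b {IH H}; rewrite /L1 /R1 /updT {L1 R1}.
  by case: d E => E; case: d'; rewrite /= ?andbF //; case: eqP => [->|] //=; rewrite E.
- by case: (a == Some false).
Qed.

(** [B] bounds each half of the query tape, so the counted length is at most [2 * B + 1]; the square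
    is the cost of [lookup] for that length. *)
Definition qcost (B g : nat) : nat := 20 * (2 * B + g + 3) ^ 2 + 4 * B + 4.

Lemma exec_guess_query s fl L R B g x w :
  (forall i, size (L i) <= B) -> (forall i, size (R i) <= B) ->
  exists fl', exec X guess_query (St (s, fl) (jst L R [:: x; nt g; w; [::]; [::]; [::]; [::]]) [::])
    (qcost B g)
    (St (after_query M s (powset (bit g) (query_word s L R)), fl')
        (jst (updT L None [::]) (updT R None [::]) [:: x; nt g; w; [::]; [::]; [::]; [::]]) [::]).
Proof.
move=> BL BR; case: fl => [[[[bad ans] go] pc] pz].
set s' : simF n k := (s.1, [ffun i => if i == None then None else s.2 i]).
pose c0 : nat := s.2 None == Some false.
have H1 := exec_drain true s' (s.2 None == Some true) false true pc pz L R c0 x (nt g) w [::].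
have H2 := exec_drain false s' ((s.2 None == Some true) || hast (L None)) false true pc pz
  (updT L None [::]) R (cntf (L None) + c0) x (nt g) w [::].
rewrite /= in H1 H2.
set bad2 := _ || hast (R None) in H2; set c := _ + (_ + c0) in H2.
have [pc' [pz' [go' H3]]] := exec_lookup X bad2 pc pz x g w c [::].
exists (bad2, pw (bit g) c, go', pc', pz').
have le_c : c <= 2 * B + 1.
  have cL : cntf (L None) <= size (L None) := count_size _ _.
  have cR : cntf (R None) <= size (R None) := count_size _ _.
  rewrite /c /c0; apply: leq_trans (leq_add cR (leq_add cL (leq_b1 _))) _.
  by move: (BL None) (BR None); move: (size _) (size _) => a1 a2; lia.
apply: (exec_le (t := 1 + ((2 * size (L None) + 1) + ((2 * size (R None) + 1) +
   (20 * (c + g + 2) ^ 2 + 1))))).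
  rewrite /qcost; have : (c + g + 2) ^ 2 <= (2 * B + g + 3) ^ 2 by rewrite leq_exp2r; lia.
  have := BL None; have := BR None; lia.
apply: (ExSeq (s1 := St (s', (s.2 None == Some true, false, true, pc, pz))
    (jst L R [:: x; nt g; w; [::]; [::]; nt c0; [::]]) [::])).
  apply: (@exec_actj _ _ _ _ _ _ K (pushC (s.2 None))) => //=.
  by rewrite /c0; case: (s.2 None == Some false).
apply: ExSeq; first exact: H1.
apply: ExSeq; first exact: H2.
apply: ExSeq; first exact: (exec_liftR (s := St _ _ _) (s' := St _ _ _) _ _ H3).
apply: exec_act; rewrite /aeff /= /after_query /query_word powset_cells; congr (St (_, _, _) _ _).
have -> : hast (rev (L None) ++ s.2 None :: R None) = bad2.
  by rewrite /hast has_cat has_rev /= /bad2 orbA [X in X || _]orbC.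
have -> // : cntf (rev (L None) ++ s.2 None :: R None) = c.
by rewrite /cntf count_cat count_rev /= addnA addnC.
Qed.

Definition clocked_run : cmd F V :=
  While (fun (f : F) (tp : V -> option bool) =>
           ~~ ((f.1.1 == acc M) || (f.1.1 == rej M)) && isSome (tp '#2))
    (Seq (Act (fun (f : F) _ => Eff f (ojoin K [:: Keep; Keep; Pop]) None))
         (If (fun (f : F) _ => f.1.1 == qry M) guess_query (liftL _ _ (Act (@sim_act n k M))))).

(** A step lengthens a half tape by at most one cell and uses up one unit of the clock, so the sum
    of size and clock never grows. The same clock is the depth to which [srel] is required, since
    that depth also drops by one with each step. *)
Lemma exec_clocked_run B g w x c s fl L R :
  let Y := powset (bit g) in
  srel w c s L R -> (forall i, size (L i) + w <= B) -> (forall i, size (R i) + w <= B) ->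
  exists s' fl' L' R' w', [/\
    exec X clocked_run (St (s, fl) (jst L R [:: x; nt g; nt w; [::]; [::]; [::]; [::]]) [::])
      (w * (qcost B g + 3) + 1)
      (St (s', fl') (jst L' R' [:: x; nt g; nt w'; [::]; [::]; [::]; [::]]) [::]),
    s'.1 = cst (iter w (step M Y) c),
    (forall i, size (L' i) <= B), (forall i, size (R' i) <= B) & w' <= w].
Proof.
move=> Y; elim: w c s fl L R => [|w IH] c s fl L R S BL BR.
  have [E _ _ _] := S; exists s, fl, L, R, 0; split=> //.
  - by apply: ExWhileF; rewrite /= andbF.
  - by move=> i; have := BL i; lia.
  - by move=> i; have := BR i; lia.
have [E _ _ _] := S.
have [h|nh] := boolP (halted M c).
  have Sth j : iter j (step M Y) c = c by elim: j => //= j ->; rewrite /step h.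
  exists s, fl, L, R, w.+1; split=> //.
  - apply: (exec_le (t := 1)); first lia.
    by apply: ExWhileF; rewrite /= E -/(halted M c) h.
  - by rewrite Sth.
  - by move=> i; have := BL i; lia.
  - by move=> i; have := BR i; lia.
have Hpop fl0 : exec X (Act (fun (f : F) _ => Eff f (ojoin K [:: Keep; Keep; Pop]) None))
    (St (s, fl0) (jst L R [:: x; nt g; nt w.+1; [::]; [::]; [::]; [::]]) [::]) 1
    (St (s, fl0) (jst L R [:: x; nt g; nt w; [::]; [::]; [::]; [::]]) [::]).
  exact: (@exec_actj _ _ _ _ _ _ K ([:: Keep; Keep; Pop])).
have [Eq|nq] := eqVneq (cst c) (qry M).
  have [|i|fl1 Hq] := @exec_guess_query s fl L R B g x (nt w).
  - by move=> i; have := BL i; lia.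
  - by have := BR i; lia.
  have S' := srel_query Y (srel_le (leqnSn w) S) nh Eq.
  have [||s' [fl' [L' [R' [w' [H E' BL' BR' lew]]]]]] := IH _ _ fl1 _ _ S'.
  - by move=> i; rewrite /updT; case: eqP => _; have := BL i => /=; lia.
  - by move=> i; rewrite /updT; case: eqP => _; have := BR i => /=; lia.
  exists s', fl', L', R', w'; split=> //; last 2 first.
    by rewrite iterSr.
    lia.
  apply: (exec_le (t := 1 + (1 + (qcost B g).+1) + (w * (qcost B g + 3) + 1))); first by lia.
  apply: ExWhileT H => /=; first by rewrite E -/(halted M c) nh.
  apply: ExSeq; first exact: Hpop.
  by apply: ExIfT => //=; rewrite E Eq.
have := srel_step Y S nh nq; have := exec_sim_act M X s L R [::].
case: (simdelta M s) => q' wr Ha S'.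
have [||s' [fl' [L' [R' [w' [H E' BL' BR' lew]]]]]] := IH _ _ fl _ _ S'.
- move=> i; have := BL i; case: (wr i) => a [] /=; rewrite ?size_behead; lia.
- move=> i; have := BR i; case: (wr i) => a [] /=; rewrite ?size_behead; lia.
exists s', fl', L', R', w'; split=> //; last 2 first.
  by rewrite iterSr.
  lia.
apply: (exec_le (t := 1 + (1 + 2) + (w * (qcost B g + 3) + 1))).
  by rewrite /qcost; lia.
apply: ExWhileT H => /=; first by rewrite E -/(halted M c) nh.
apply: ExSeq; first exact: Hpop.
apply: ExIfF; first by rewrite /= E (negPf nq).
exact: (exec_liftL (s := St _ _ _) (s' := St _ _ _) _ _ Ha).
Qed.

End GuessedRun.

Section GuessLoop.
Local Notation "'# i" := (inr (@Ordinal 7 i isT)) (at level 8).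
Variables (n k : nat) (M : OTM n k) (X : lang).

Let F : finType := (simF n k * lookF)%type.
Let V : finType := (simV k + 'I_7)%type.
Local Notation K := (fun _ : simV k => Keep).
Local Notation jst := (@jstk k 7).
Local Notation nil_ := (fun _ : tid k => [::]).
Local Notation sK o := (Act (fun (f : F) (_ : V -> option bool) => Eff f (ojoin K o) None)).
Local Notation whilene i c := (While (fun (_ : F) (tp : V -> option bool) => isSome (tp '#i)) c).

Fixpoint pushU (j : nat) : cmd F V :=
  if j is j'.+1 then Seq (sK [:: Keep; Push true]) (pushU j')
  else Act (fun (f : F) _ => nop V f).

Lemma exec_pushU j f g x : exec X (pushU j) (St f (jst nil_ nil_ [:: x; nt g; [::]; [::]; [::]; [::]; [::]]) [::])
  j.+1 (St f (jst nil_ nil_ [:: x; nt (j + g); [::]; [::]; [::]; [::]; [::]]) [::]).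
Proof.
elim: j g => [|j IH] g; first by apply: exec_act; rewrite /aeff.
rewrite [j.+1 + g]addSnnS -[j.+2]add1n.
by apply: ExSeq (IH g.+1); apply: (@exec_actj _ _ _ _ _ _ K [:: Keep; Push true]).
Qed.

Definition prep : cmd F V :=
  Seq (whilene 1 (sK [:: Keep; Pop; Keep; Keep; Push true]))
      (whilene 4 (sK [:: Keep; Push true; Push true; Push true; Pop])).

Lemma exec_prep f g x : exec X prep (St f (jst nil_ nil_ [:: x; nt g; [::]; [::]; [::]; [::]; [::]]) [::])
  (4 * g + 2) (St f (jst nil_ nil_ [:: x; nt g; nt g; nt g; [::]; [::]; [::]]) [::]).
Proof.
have -> : 4 * g + 2 = (2 * g + 1) + (2 * g + 1) by lia.
have A h t : exec X (whilene 1 (sK [:: Keep; Pop; Keep; Keep; Push true]))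
    (St f (jst nil_ nil_ [:: x; nt h; [::]; [::]; nt t; [::]; [::]]) [::]) (2 * h + 1)
    (St f (jst nil_ nil_ [:: x; [::]; [::]; [::]; nt (h + t); [::]; [::]]) [::]).
  elim: h t => [|h IH] t; first exact: ExWhileF.
  have -> : 2 * h.+1 + 1 = 1 + 1 + (2 * h + 1) by lia.
  rewrite [h.+1 + t]addSnnS; apply: (ExWhileT _ _ (IH t.+1)) => //.
  exact: (@exec_actj _ _ _ _ _ _ K [:: Keep; Pop; Keep; Keep; Push true]).
have B h u : exec X (whilene 4 (sK [:: Keep; Push true; Push true; Push true; Pop]))
    (St f (jst nil_ nil_ [:: x; nt u; nt u; nt u; nt h; [::]; [::]]) [::]) (2 * h + 1)
    (St f (jst nil_ nil_ [:: x; nt (h + u); nt (h + u); nt (h + u); [::]; [::]; [::]]) [::]).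
  elim: h u => [|h IH] u; first exact: ExWhileF.
  have -> : 2 * h.+1 + 1 = 1 + 1 + (2 * h + 1) by lia.
  rewrite [h.+1 + u]addSnnS; apply: (ExWhileT _ _ (IH u.+1)) => //.
  exact: (@exec_actj _ _ _ _ _ _ K [:: Keep; Push true; Push true; Push true; Pop]).
apply: ExSeq; first exact: (A g 0).
by have := B (g + 0) 0; rewrite !addn0.
Qed.

(** At most [g] letters are moved to stack 6, with stack 3 as the budget; [put_input] then returns
    them to the input and writes them on the simulated tape. So the cost depends on [g] and not on
    the length of [x]. *)
Definition take_input : cmd F V :=
  While (fun (_ : F) tp => isSome (tp '#3) && isSome (tp '#0))
    (Act (fun f tp => Eff f (ojoin K [:: Pop; Keep; Keep; Pop; Keep; Keep;
                                         Push (odflt false (tp '#0))]) None)).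

Lemma exec_take_input f g x u w z d : exists2 z', z' <= z &
  exec X take_input (St f (jst nil_ nil_ [:: x; nt u; nt w; nt z; [::]; [::]; d]) g) (2 * z + 1)
    (St f (jst nil_ nil_ [:: drop z x; nt u; nt w; nt z'; [::]; [::]; catrev (take z x) d]) g).
Proof.
elim: z x d => [|z IH] x d.
  by exists 0; rewrite ?drop0 ?take0 //; apply: ExWhileF.
case: x => [|b x].
  by exists z.+1 => //; apply: (exec_le (t := 1)); [lia | apply: ExWhileF].
have [z' le H] := IH x (b :: d); exists z'; first by lia.
have -> : 2 * z.+1 + 1 = 1 + 1 + (2 * z + 1) by lia.
apply: (ExWhileT _ _ H) => //.
exact: (@exec_actj _ _ _ _ _ _ K [:: Pop; Keep; Keep; Pop; Keep; Keep; Push b]).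
Qed.

Definition pushR (tp : V -> option bool) (j : 'I_7) : simV k -> sop := fun v =>
  let: (i, d, b) := v in
  if (i == Some ord0) && ~~ d then Push (sbit b (tp (inr j))) else Keep.

Definition put_input : cmd F V :=
  whilene 6 (Act (fun (f : F) (tp : V -> option bool) =>
    Eff f (ojoin (pushR tp (@Ordinal 7 6 isT))
      [:: Push (odflt false (tp '#6)); Keep; Keep; Keep; Keep; Keep; Pop]) None)).

Lemma exec_put_input f g x u w z d r :
  exec X put_input (St f (jst nil_ (init_simR (map Some r)) [:: x; nt u; nt w; nt z; [::]; [::]; d]) g)
    (2 * size d + 1)
    (St f (jst nil_ (init_simR (map Some (catrev d r)))
       [:: catrev d x; nt u; nt w; nt z; [::]; [::]; [::]]) g).
Proof.
elim: d x r => [|b d IH] x r; first exact: ExWhileF.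
have -> : 2 * (size (b :: d)) + 1 = 1 + 1 + (2 * size d + 1) by rewrite /=; lia.
apply: (ExWhileT _ _ (IH (b :: x) (b :: r))) => //.
apply: exec_actj => //=.
move=> i d' b'; rewrite /= /init_simR.
by case: d' => //=; rewrite ?andbF //= andbT; case: eqP.
Qed.

Definition popR0 : simV k -> sop := fun v =>
  let: (i, d, b) := v in if (i == Some ord0) && ~~ d then Pop else Keep.

(** The first letter goes under the head, which leaves at most [g - 1] copied cells to its right.
    Popping the clock brings the number of simulated steps down to the same [g - 1]. *)
Definition start_sim : cmd F V :=
  Act (fun (f : F) (tp : V -> option bool) =>
    Eff (init_simf k (start M) (dectop (fun v => tp (inl v)) (Some ord0) false), f.2)
        (ojoin popR0 [:: Keep; Keep; Pop]) None).

Lemma exec_start_sim f g x u w z r :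
  exec X start_sim (St f (jst nil_ (init_simR r) [:: x; nt u; nt w; nt z; [::]; [::]; [::]]) g) 1
    (St (init_simf k (start M) (head None r), f.2)
       (jst nil_ (init_simR (behead r)) [:: x; nt u; nt w.-1; nt z; [::]; [::]; [::]]) g).
Proof.
apply: (@exec_actj _ _ _ _ _ _ popR0 [:: Keep; Keep; Pop]) => //=.
- by rewrite (dectopE nil_ (init_simR r)) /= /init_simR eqxx.
- move=> i d b; rewrite /= /init_simR; case: d => /=; rewrite ?andbF //= andbT.
  by case: eqP => //= _; rewrite behead_map.
- by case: w.
Qed.

Definition drop3 : cmd F V := whilene 3 (sK [:: Keep; Keep; Keep; Pop]).
Definition drop2 : cmd F V := whilene 2 (sK [:: Keep; Keep; Pop]).

Lemma exec_drop3 f g L R x u w z : exec X drop3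
  (St f (jst L R [:: x; u; w; nt z; [::]; [::]; [::]]) g) (2 * z + 1)
  (St f (jst L R [:: x; u; w; [::]; [::]; [::]; [::]]) g).
Proof.
elim: z => [|z IH]; first exact: ExWhileF.
have -> : 2 * z.+1 + 1 = 1 + 1 + (2 * z + 1) by lia.
by apply: (ExWhileT _ _ IH) => //; apply: (@exec_actj _ _ _ _ _ _ K [:: Keep; Keep; Keep; Pop]).
Qed.

Lemma exec_drop2 f g L R x u w : exec X drop2
  (St f (jst L R [:: x; u; nt w; [::]; [::]; [::]; [::]]) g) (2 * w + 1)
  (St f (jst L R [:: x; u; [::]; [::]; [::]; [::]; [::]]) g).
Proof.
elim: w => [|w IH]; first exact: ExWhileF.
have -> : 2 * w.+1 + 1 = 1 + 1 + (2 * w + 1) by lia.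
by apply: (ExWhileT _ _ IH) => //; apply: (@exec_actj _ _ _ _ _ _ K [:: Keep; Keep; Pop]).
Qed.

Definition try_guess : cmd F V :=
  Seq prep (Seq take_input (Seq put_input (Seq start_sim (Seq drop3
    (Seq (clocked_run M) (Seq drop2 (liftL _ _ (sim_clear n k)))))))).

Definition icost (g : nat) : nat := g * (qcost (2 * g) g + 3) + 20 * g + 20.

Lemma exec_try_guess f g x : 0 < g -> exists f',
  exec X try_guess (St f (jst nil_ nil_ [:: x; nt g; [::]; [::]; [::]; [::]; [::]]) [::]) (icost g)
    (St f' (jst nil_ nil_ [:: x; nt g; [::]; [::]; [::]; [::]; [::]]) [::]) /\
  f'.1.1 = cst (run M (powset (bit g)) x g.-1).
Proof.
move=> g_gt0.
have [z' lez H2] := exec_take_input f [::] x g g g [::].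
have H3 := exec_put_input f [::] (drop g x) g g z' (catrev (take g x) [::]) [::].
have E1 : catrev (catrev (take g x) [::]) (drop g x) = x.
  by rewrite !catrevE cats0 revK cat_take_drop.
have E2 : catrev (catrev (take g x) [::]) [::] = take g x.
  by rewrite !catrevE !cats0 revK.
have E3 : init_simR (map Some [::]) = nil_.
  by apply: functional_extensionality => i; rewrite /init_simR; case: eqP.
rewrite E1 E2 E3 in H3.
have H4 := exec_start_sim f [::] x g g z' (map Some (take g x)).
have Hd : srel g.-1 (init M x) (init_simf k (start M) (head None (map Some (take g x))))
    nil_ (init_simR (behead (map Some (take g x)))).
  by apply: srel_init => j le_j; rewrite map_take nth_take //; lia.
(* A half tape starts with fewer than [g] cells and gains at most one in each of [g - 1] steps;
   hence the bound [2 * g]. *)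
have [||s [fl [L [R [w' [H5 Es BL BR lew]]]]]] :=
  @exec_clocked_run n k M X (2 * g) g g.-1 x _ _ f.2 _ _ Hd.
- by move=> i /=; lia.
- move=> i; rewrite /init_simR; case: eqP => _ /=; last by lia.
  by rewrite size_behead size_map size_take; case: ifP; lia.
have H6 : exec X (sim_clear n k) (St s (simsk L R) [::]) (4 * g + 2) (St (clear_heads s) (simsk nil_ nil_) [::]).
  have -> : simsk nil_ nil_ = fun=> [::].
    by apply: functional_extensionality => -[[i []] b].
  have -> : 4 * g + 2 = 2 * (2 * g) + 2 by lia.
  by apply: exec_sim_clear => -[[i d] b] /=; rewrite size_map; case: d.
exists (clear_heads s, fl); split; last exact: Es.
apply: (exec_le (t := (4 * g + 2) + ((2 * g + 1) + ((2 * g + 1) + (1 + ((2 * z' + 1) +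
  ((g.-1 * (qcost (2 * g) g + 3) + 1) + ((2 * w' + 1) + (4 * g + 2))))))))).
  rewrite /icost; have : g.-1 * (qcost (2 * g) g + 3) <= g * (qcost (2 * g) g + 3).
    by rewrite leq_mul2r leq_pred orbT.
  by move: (g * _) (_.-1 * _) => A B; lia.
apply: ExSeq; first exact: exec_prep.
apply: ExSeq; first exact: H2.
apply: ExSeq.
  apply: exec_le H3; rewrite catrevE cats0 size_rev size_take.
  by case: ifP; lia.
apply: ExSeq; first exact: H4.
apply: ExSeq; first exact: exec_drop3.
apply: ExSeq; first exact: H5.
apply: ExSeq; first exact: exec_drop2.
exact: (exec_liftL (s := St _ _ _) (s' := St _ _ _) _ _ H6).
Qed.

Definition is_halt (q : 'I_n) := (q == acc M) || (q == rej M).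

Definition guess_loop (j : nat) : cmd F V :=
  While (fun (f : F) _ => ~~ is_halt f.1.1) (Seq (pushU j) try_guess).

(** The loop may stop before the [m]-th guess, on a guess that codes a different oracle. Therefore
    the conclusion only says that the run at the stopping guess halts; that its verdict is right
    will follow from genericity. *)
Lemma exec_guess_loop j m f g x G : 0 < j -> g + m * j <= G ->
  0 < m -> ~~ is_halt f.1.1 ->
  halted M (run M (powset (bit (g + m * j))) x (g + m * j).-1) ->
  exists s f' m',
    [/\ exec X (guess_loop j) (St f (jst nil_ nil_ [:: x; nt g; [::]; [::]; [::]; [::]; [::]]) [::])
          (m * (icost G + j + 2) + 1) s,
        fc s = f', 0 < m' &
        f'.1.1 = cst (run M (powset (bit (g + m' * j))) x (g + m' * j).-1) /\ halted M (run M (powset (bit (g + m' * j))) x (g + m' * j).-1)].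
Proof.
move=> j_gt0; elim: m f g => // m IH f g leG _ nh H.
have [|f1 [Ht Ef]] := @exec_try_guess f (j + g) x; first by lia.
have Hb : exec X (Seq (pushU j) try_guess)
   (St f (jst nil_ nil_ [:: x; nt g; [::]; [::]; [::]; [::]; [::]]) [::]) (icost G + j + 1)
   (St f1 (jst nil_ nil_ [:: x; nt (j + g); [::]; [::]; [::]; [::]; [::]]) [::]).
  apply: (exec_le (t := j.+1 + icost (j + g))); last by apply: ExSeq; [exact: exec_pushU | exact: Ht].
  rewrite addSn [j + _]addnC addn1 !ltnS leq_add2r /icost /qcost.
  have le1 : j + g <= G by nia.
  have le2 : (2 * (2 * (j + g)) + (j + g) + 3) ^ 2 <= (2 * (2 * G) + G + 3) ^ 2.
    by rewrite leq_exp2r; lia.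
  have le3 : (j + g) * (20 * (2 * (2 * (j + g)) + (j + g) + 3) ^ 2 + 4 * (2 * (j + g)) + 4 + 3)
    <= G * (20 * (2 * (2 * G) + G + 3) ^ 2 + 4 * (2 * G) + 4 + 3).
    apply: leq_mul => //; move: (_ ^ 2) (_ ^ 2) le2 => A B; lia.
  by move: (_ * (_ + 3)) (_ * (_ + 3)) le3 => A B; lia.
have Egj : g + 1 * j = j + g by lia.
case Hh: (halted M (run M (powset (bit (j + g))) x (j + g).-1)).
  exists (St f1 (jst nil_ nil_ [:: x; nt (j + g); [::]; [::]; [::]; [::]; [::]]) [::]), f1, 1.
  rewrite Egj; split=> //.
  apply: (exec_le (t := 1 + (icost G + j + 1) + 1)); first by rewrite mulSn; lia.
  apply: (ExWhileT _ Hb) => //; apply: ExWhileF => /=.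
  by rewrite /is_halt Ef -/(halted M _) Hh.
have m_gt0 : 0 < m.
  by case: (m) H Hh => // H; rewrite Egj in H; rewrite H.
have [|||s [f2 [m' [Hs Ef2 m'_gt0 P]]]] := IH f1 (j + g) _ m_gt0.
- by rewrite mulSn in leG; lia.
- by rewrite /is_halt Ef -/(halted M _) Hh.
- by rewrite mulSn addnA [g + j]addnC in H.
exists s, f2, m'.+1; split=> //; last by rewrite mulSn addnA [g + j]addnC.
apply: (exec_le (t := 1 + (icost G + j + 1) + (m * (icost G + j + 2) + 1))); first by rewrite mulSn; lia.
by apply: (ExWhileT _ Hb).
Qed.


End GuessLoop.

(** * Halting and locality of oracle runs *)

Section Runs.
Variables (n k : nat) (M : OTM n k).

Lemma run_halted X x t t' : halted M (run M X x t) -> t <= t' -> run M X x t' = run M X x t.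
Proof.
move=> h /subnK <-; elim: (t' - t) => // d IH; rewrite addSn /run iterS -/(run _ _ _ _) IH.
by rewrite /step h.
Qed.

Lemma run_halted_eq X x t t' :
  halted M (run M X x t) -> halted M (run M X x t') -> run M X x t = run M X x t'.
Proof.
case/orP: (leq_total t t') => le h h'; first by rewrite (run_halted h le).
by rewrite (run_halted h' le).
Qed.

Definition cells (t : Tape) := size (tleft t) + size (tright t).

Lemma size_tape_word t : size (tape_word t) <= (cells t).+1.
Proof.
rewrite /tape_word size_pmap; apply: leq_trans (count_size _ _) _.
by rewrite size_cat size_rev /= /cells addnS.
Qed.

Lemma cells_move t a mv : cells (tape_move (tape_write t a) mv) <= (cells t).+1.
Proof. by case: t => [[|? l] h [|? r]]; case: mv; rewrite /cells /tape_write /=; lia. Qed.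

Lemma cells_run X x t : cells (cq (run M X x t)) <= t.
Proof.
elim: t => // t IH; rewrite /run iterS -/(run _ _ _ _) /step.
case: ifP => _; first exact: leqW.
case: ifP => // _; case: (delta _ _ _ _) => [[q w] [a mv]] /=.
exact: leq_trans (cells_move _ _ _) _.
Qed.

(** Each step adds at most one cell to the query tape, and the head adds one more symbol; so the
    query made after t steps has length at most t + 1. *)
Lemma run_use X Y x t : (forall y, size y <= t -> X y = Y y) -> run M X x t = run M Y x t.
Proof.
elim: t => // t IH H; rewrite /run !iterS -!/(run _ _ _ _).
rewrite -IH => [|y le]; last by apply: H; lia.
rewrite /step; do 2 case: ifP => // _.
rewrite H //; apply: leq_trans (size_tape_word _) _.
by rewrite ltnS; apply: cells_run.
Qed.

End Runs.

(** * Generic sequences and the polynomial bound *)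

Definition coefs (A d : nat) : seq nat := mkseq (fun i => A * 'C(d, i)) d.+1.

(** The binomial theorem. The power is one of [m.+1], since a time bound may take the value 0. *)
Lemma peval_coefs A d m : peval (coefs A d) m = A * m.+1 ^ d.
Proof.
rewrite /peval size_mkseq -[m.+1]add1n expnDn big_distrr /=.
apply: eq_bigr => i _; rewrite nth_mkseq // -mulnA exp1n mul1n.
by case: i.
Qed.

(** A machine [N] stands in for a computable language, so that the condition ranges over countably
    many pairs and makes sense for machines that do not always halt. *)
Definition consistent n k (M : OTM n k) n' k' (N : OTM n' k') (X : lang) : Prop :=
  forall x t t', halted M (run M X x t) -> halted N (run N empty_oracle x t') ->
    (cst (run M X x t) == acc M) = (cst (run N empty_oracle x t') == acc N).

(** By [inconsistent_use] the first alternative also depends on finitely many bits only, so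
    genericity is a single density requirement for each pair of machines. *)
Definition generic (al : nat -> bool) : Prop :=
  forall n k (M : OTM n k) n' k' (N : OTM n' k'),
    ~ consistent M N (powset al) \/
    exists j, forall be, (forall i, i < j -> be i = al i) -> consistent M N (powset be).

Fixpoint anum (al : nat -> bool) (j : nat) : nat :=
  if j is j'.+1 then al 0 + 2 * anum (fun i => al i.+1) j' else 0.

Lemma anum_lt al j : anum al j < 2 ^ j.
Proof. by elim: j al => // j IH al; rewrite expnS /=; have := IH (fun i => al i.+1); lia. Qed.

Lemma anum_add al i j : anum al (i + j) = anum al i + 2 ^ i * anum (fun l => al (i + l)) j.
Proof.
elim: i al => [|i IH] al; first by rewrite mul1n.
by rewrite addSn /= IH expnS mulnDr addnA mulnA.
Qed.

(** The multiple of [2 ^ j] is arbitrary: all guesses congruent to [anum al j] modulo [2 ^ j] code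
    oracles that extend the same finite part. *)
Lemma bit_anum al i j h : i < j -> bit (anum al j + 2 ^ j * h) i = al i.
Proof.
move=> lt_ij; rewrite -(subnKC lt_ij) addSnnS anum_add /= addn0.
set m := j - i.+1; set y := anum (fun l => al (i + l.+1)) m.
have -> : anum al i + 2 ^ i * (al i + 2 * y) + 2 ^ (i + m.+1) * h =
          (al i + 2 * (y + 2 ^ m * h)) * 2 ^ i + anum al i.
  by rewrite expnD expnS; lia.
rewrite /bit divnMDl ?expn_gt0 // divn_small ?anum_lt // addn0 mul2n oddD odd_double addbF.
by case: (al i).
Qed.

Lemma powset_use al be j y : (forall i, i < j -> al i = be i) -> size y < 2 ^ j ->
  powset al y = powset be y.
Proof.
move=> E le; rewrite /powset; congr andb.
have lt : count negb y < 2 ^ j by apply: leq_ltn_trans le; apply: count_size.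
by apply/pwP/pwP => -[i Ei]; exists i => //; [rewrite -E | rewrite E] => //;
   rewrite Ei ltn_exp2l in lt.
Qed.

Lemma qcost_bound G : qcost (2 * G) G + 3 <= 523 * G.+1 ^ 2.
Proof.
(* Here 5G + 3 is at most 5(G + 1); as 20 * 25 = 500, a surplus of 23 (G + 1)^2 covers the linear
   terms. *)
rewrite /qcost; have le : (2 * (2 * G) + G + 3) ^ 2 <= 25 * G.+1 ^ 2.
  by rewrite -(expnMn 5 _ 2) leq_exp2r; lia.
have : G.+1 <= G.+1 ^ 2 by rewrite -{1}[G.+1]expn1 leq_pexp2l.
lia.
Qed.

Lemma icost_bound G : icost G <= 1000 * G.+1 ^ 3.
Proof.
rewrite /icost; have le := qcost_bound G.
have le1 : G * (qcost (2 * G) G + 3) <= 523 * G.+1 ^ 3.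
  rewrite [_ ^ 3]expnS mulnCA; apply: leq_mul => //.
have : G.+1 <= G.+1 ^ 3 by rewrite -{1}[G.+1]expn1 leq_pexp2l.
lia.
Qed.

(** At most [K0 * t] guesses of cubic cost each, hence degree 4. In the application [t] and [u] are
    the successors of the halting time and of the given bound. *)
Lemma total_bound K0 P sg t u : 0 < t -> t <= u ->
  sg.+1 + (K0 * t * (icost (K0 * t) + P + 2) + 1) <=
  (sg + 2 + K0 * (1000 * (K0 + 1) ^ 3 + P + 2)) * u ^ 4.
Proof.
move=> t_gt0 le_u; apply: (leq_trans (n := (sg + 2 + K0 * (1000 * (K0 + 1) ^ 3 + P + 2)) * t ^ 4)); last first.
  by rewrite leq_mul2l leq_exp2r // le_u orbT.
have le1 : (K0 * t).+1 <= (K0 + 1) * t by rewrite mulnDl; lia.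
have le2 : icost (K0 * t) <= 1000 * (K0 + 1) ^ 3 * t ^ 3.
  by apply: leq_trans (icost_bound _) _; rewrite -mulnA leq_mul2l -expnMn leq_exp2r.
have T3 : 0 < t ^ 3 by rewrite expn_gt0 t_gt0.
have T4 : 0 < t ^ 4 by rewrite expn_gt0 t_gt0.
have le3 : icost (K0 * t) + P + 2 <= (1000 * (K0 + 1) ^ 3 + P + 2) * t ^ 3.
  rewrite -addnA -[X in _ <= X * _]addnA mulnDl leq_add // leq_pmulr //.
have le4 : K0 * t * (icost (K0 * t) + P + 2) <= K0 * (1000 * (K0 + 1) ^ 3 + P + 2) * t ^ 4.
  by rewrite [t ^ 4]expnS -[X in _ <= X]mulnACA leq_mul.
rewrite mulnDl; apply: leq_trans (leq_add (leq_pmulr (sg + 2) T4) le4).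
by move: (_ * _) => Y; lia.
Qed.

Lemma powset_low al : generic al -> low_for_speed (powset al).
Proof.
move=> gen L [n' [k' [N decN]]] n k M f decM.
have [[]|[j Hj]] := gen _ _ M _ _ N.
  move=> x t t' h h'; have [t0 [_ [h0 E0]]] := decM x; have [t1 [h1 E1]] := decN x.
  by rewrite (run_halted_eq h h0) (run_halted_eq h' h1) E0 E1.
(* The guesses are [sg + m * P], all with the wired low bits [sg]. The factor 4 comes from rounding
   the time up to a power of two and from the extra top bit of the guess. *)
pose P := 2 ^ j; pose sg := anum al j; pose K0 := 4 * P.
have P_gt0 : 0 < P by rewrite expn_gt0.
have ok be x t : (forall i, i < j -> be i = al i) -> halted M (run M (powset be) x t) ->
    (cst (run M (powset be) x t) == acc M) = L x.
  move=> E h; have [t1 [h1 E1]] := decN x; rewrite -E1; exact: Hj.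
have ok_bit m x t : halted M (run M (powset (bit (sg + m * P))) x t) ->
    (cst (run M (powset (bit (sg + m * P))) x t) == acc M) = L x.
  by apply: ok => i lt_ij; rewrite mulnC bit_anum.
pose F : finType := (simF n k * lookF)%type.
pose V : finType := (simV k + 'I_7)%type.
pose c : cmd F V := Seq (pushU n k sg) (guess_loop M P).
pose f0 : F := (clear_heads (start M, [ffun=> None]), (false, false, false, false, false)).
have [nn [kk [M' HM']]] := compile c (inr (@Ordinal 7 0 isT)) f0 (fun f => f.1.1 == acc M).
pose A := 4 * (sg + 2 + K0 * (1000 * (K0 + 1) ^ 3 + P + 2)).
exists nn, kk, M', (coefs A 4) => x; rewrite peval_coefs.
have [t0 [le_t0 [h0 _]]] := decM x.
suff [s Hs Es] : exists2 s, exec empty_oracle c (init_st (inr (@Ordinal 7 0 isT)) f0 x)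
    (sg.+1 + (K0 * t0.+1 * (icost (K0 * t0.+1) + P + 2) + 1)) s & ((fc s).1.1 == acc M) = L x.
  have [m le_m [hm Em]] := HM' _ _ _ _ Hs.
  exists m; split; last by split=> //; rewrite Em.
  apply: leq_trans le_m _; rewrite /A -[4 * _ * _ ^ _]mulnA leq_mul2l /=.
  exact: total_bound.
have Einit : init_st (inr (@Ordinal 7 0 isT)) f0 x =
   St f0 (@jstk k 7 (fun=> [::]) (fun=> [::]) [:: x; nt 0; [::]; [::]; [::]; [::]; [::]]) [::] :> st F V.
  congr St; apply: functional_extensionality => -[[[i []] b]|v] //=.
  by case: v => -[|[|[|[|[|[|[|//]]]]]]].
have H1 := exec_pushU empty_oracle sg f0 0 x; rewrite addn0 -Einit in H1.
(* The loop tests its state before the first guess, so a start state that already halts is treated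
   apart. *)
have [hs|nhs] := boolP (is_halt M (start M)).
  exists (St f0 (@jstk k 7 (fun=> [::]) (fun=> [::]) [:: x; nt sg; [::]; [::]; [::]; [::]; [::]]) [::]); last first.
    exact: (ok al x 0 (fun=> fun=> erefl) hs).
  apply: (exec_le (t := sg.+1 + 1)); first by lia.
  by apply: ExSeq; [exact: H1 | apply: ExWhileF; rewrite /= hs].
have [e [lt_e le_e]] : exists e, t0 < 2 ^ e /\ 2 ^ e <= 2 * t0.+1.
  elim: (t0) => [|t [e [lt le]]]; first by exists 0.
  have [lt1|ge1] := ltnP t.+1 (2 ^ e); first by exists e; lia.
  by exists e.+1; rewrite expnS; lia.
(* The guess spells [al] up to [j + e], beyond everything that [t0] steps can query. The top bit
   makes the guess exceed [t0] as a clock even if all those bits are 0. *)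
pose m := 2 ^ e + anum (fun l => al (j + l)) e.
have Eg : sg + m * P = anum al (j + e) + 2 ^ (j + e) * 1.
  by rewrite anum_add expnD /m /sg /P; lia.
have leG : sg + m * P <= K0 * t0.+1.
  have := anum_lt al (j + e); rewrite Eg muln1 expnD -/P /K0 => lt1.
  have : P * 2 ^ e <= P * (2 * t0.+1) by rewrite leq_mul2l le_e orbT.
  by lia.
have lt_t0 : t0 < 2 ^ (j + e) by apply: leq_trans lt_e _; rewrite leq_pexp2l // leq_addl.
have m_gt0 : 0 < m by rewrite /m addn_gt0 expn_gt0.
have hg : halted M (run M (powset (bit (sg + m * P))) x (sg + m * P).-1).
  have Er : run M (powset (bit (sg + m * P))) x t0 = run M (powset al) x t0.
    apply: run_use => y le_y; apply: (powset_use (j := j + e)); last exact: leq_ltn_trans lt_t0.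
    by move=> i lt_i; rewrite Eg bit_anum.
  rewrite (run_halted (t := t0)) ?Er // Eg muln1; lia.
have [s [f' [m' [H2 Ef _ [Eq hq]]]]] :=
  exec_guess_loop empty_oracle (f := f0) P_gt0 leG m_gt0 nhs hg.
exists s; last by rewrite Ef Eq ok_bit.
apply: exec_le (ExSeq H1 H2); rewrite leq_add2l leq_add2r leq_mul2r; apply/orP; right.
by apply: leq_trans leG; nia.
Qed.

(** * A generic pair coding an arbitrary set *)

Section Forcing.
Variables (P : nat -> seq bool -> Prop) (G : nat -> bool).

Definition force (Q : seq bool -> Prop) (a : seq bool) : seq bool :=
  if excluded_middle_informative (exists u, Q (a ++ u)) is left H
  then a ++ proj1_sig (constructive_indefinite_description _ H) else a.

Lemma forceP Q a : exists u, force Q a = a ++ u /\ (Q (a ++ u) \/ forall v, ~ Q (a ++ u ++ v)).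
Proof.
rewrite /force; case: excluded_middle_informative => [H|nH].
  by case: constructive_indefinite_description => u /= Qu; exists u; split=> //; left.
exists [::]; rewrite cats0; split=> //; right => v Qv; apply: nH; by exists v.
Qed.

(** The second sequence ends in [false] at the position where the first one stores [G s]; so a
    stored bit is never taken for a mark, and marks are exactly the common ones. *)
Definition stage (s : nat) (ab : seq bool * seq bool) : seq bool * seq bool :=
  let a1 := force (P s) ab.1 in
  let b1 := ab.2 ++ nseq (size a1 - size ab.1) false in
  let b2 := force (P s) b1 in
  let a2 := a1 ++ nseq (size b2 - size b1) false in
  (a2 ++ [:: true; G s], b2 ++ [:: true; false]).

Fixpoint stages (s : nat) : seq bool * seq bool :=
  if s is s'.+1 then stage s' (stages s') else ([::], [::]).

Definition extends (be : nat -> bool) (u : seq bool) := forall i, i < size u -> be i = nth false u i.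

Lemma extends_cat be u v : extends be (u ++ v) -> extends be u.
Proof. by move=> H i lt; rewrite H ?size_cat ?nth_cat ?lt //; lia. Qed.

Lemma stageP s : size (stages s).1 = size (stages s).2 -> exists u v,
  [/\ (stages s.+1).1 = (stages s).1 ++ u ++ nseq (size v) false ++ [:: true; G s],
   (stages s.+1).2 = (stages s).2 ++ nseq (size u) false ++ v ++ [:: true; false],
   P s ((stages s).1 ++ u) \/ (forall v, ~ P s ((stages s).1 ++ u ++ v)) &
   P s ((stages s).2 ++ nseq (size u) false ++ v) \/
     (forall v', ~ P s ((stages s).2 ++ nseq (size u) false ++ v ++ v'))].
Proof.
move=> E; rewrite /= /stage; move: (stages s) E => [a b] /= E.
have [u [-> Hu]] := forceP (P s) a.
rewrite size_cat addKn.
have [v [-> Hv]] := forceP (P s) (b ++ nseq (size u) false).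
rewrite !size_cat addKn -!catA in Hv *.
exists u, v; split=> //.
by case: Hv => [Hv|Hv]; [left | right => v'; have := Hv v'; rewrite -!catA].
Qed.

Lemma size_stages s : size (stages s).1 = size (stages s).2.
Proof.
elim: s => // s IH; have [u [v [-> -> _ _]]] := stageP IH.
by rewrite !size_cat !size_nseq /= IH.
Qed.

Lemma stages_grow s : exists u v, (stages s.+1).1 = (stages s).1 ++ u /\
  (stages s.+1).2 = (stages s).2 ++ v.
Proof. by have [u [v [-> -> _ _]]] := stageP (size_stages s); do 2 eexists. Qed.

Lemma leq_size_stages s : s <= size (stages s).1.
Proof.
elim: s => // s IH; have [u [v [-> _ _ _]]] := stageP (size_stages s).
by rewrite !size_cat /=; lia.
Qed.

(** Stage [i.+1] is longer than [i], so its entry [i] exists and no later stage changes it. *)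
Lemma extends_limit (st : nat -> seq bool) : (forall s, exists u, st s.+1 = st s ++ u) ->
  (forall s, s <= size (st s)) -> forall s, extends (fun i => nth false (st i.+1) i) (st s).
Proof.
move=> grow big s i lt_i.
have mono d t : i < size (st t) -> nth false (st (t + d)) i = nth false (st t) i /\ i < size (st (t + d)).
  move=> lt; elim: d => [|d [IH1 IH2]]; first by rewrite addn0.
  have [u E] := grow (t + d); rewrite addnS E nth_cat IH2 size_cat; split=> //.
  by apply: leq_trans IH2 _; apply: leq_addr.
have [le|le] := leqP s i.+1.
  by have [<- _] := mono (i.+1 - s) s lt_i; rewrite subnKC.
by have [<- _] := mono (s - i.+1) i.+1 (big i.+1); rewrite subnKC // ltnW.
Qed.

Lemma generic_pair : exists al be (len : nat -> nat),
  [/\ forall s, (exists2 u, extends al u & P s u) \/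
                (exists2 u, extends al u & forall v, ~ P s (u ++ v)),
      forall s, (exists2 u, extends be u & P s u) \/
                (exists2 u, extends be u & forall v, ~ P s (u ++ v)),
      len 0 = 0 &
      forall s, exists m, [/\ len s <= m, forall i, len s <= i < m -> ~~ (al i && be i),
         al m && be m, al m.+1 = G s /\ be m.+1 = false & len s.+1 = m.+2]].
Proof.
pose al i := nth false (stages i.+1).1 i; pose be i := nth false (stages i.+1).2 i.
have Ha s : extends al (stages s).1.
  apply: (@extends_limit (fun s => (stages s).1)) => {}s; last exact: leq_size_stages.
  by have [u [v [E _]]] := stages_grow s; exists u.
have Hb s : extends be (stages s).2.
  apply: (@extends_limit (fun s => (stages s).2)) => {}s; last by rewrite -size_stages leq_size_stages.
  by have [u [v [_ E]]] := stages_grow s; exists v.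
exists al, be, (fun s => size (stages s).1); split=> // s;
  have [u [v [Ea Eb Pa Pb]]] := stageP (size_stages s).
- have := Ha s.+1; rewrite Ea catA => /extends_cat H.
  by case: Pa => [Pa|Pa]; [left | right]; exists ((stages s).1 ++ u) => // v'; rewrite -catA.
- have := Hb s.+1; rewrite Eb catA [X in extends _ X]catA => /extends_cat H; rewrite catA in Pb.
  case: Pb => [Pb|Pb]; [left | right]; exists (((stages s).2 ++ nseq (size u) false) ++ v) => //.
  by move=> v'; rewrite -!catA.
- have Ha1 := Ha s.+1; have Hb1 := Hb s.+1; rewrite Ea in Ha1; rewrite Eb in Hb1.
  set l := size (stages s).1 in Ha1 *.
  have nth_a i : nth false ((stages s).1 ++ i) =1 fun j => if j < l then nth false (stages s).1 j else nth false i (j - l).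
    by move=> j; rewrite nth_cat.
  have nth_b i : nth false ((stages s).2 ++ i) =1 fun j => if j < l then nth false (stages s).2 j else nth false i (j - l).
    by move=> j; rewrite nth_cat -size_stages.
  have Sa : size ((stages s).1 ++ u ++ nseq (size v) false ++ [:: true; G s]) = l + size u + size v + 2.
    by rewrite !size_cat size_nseq /= -/l; lia.
  have Sb : size ((stages s).2 ++ nseq (size u) false ++ v ++ [:: true; false]) = l + size u + size v + 2.
    by rewrite !size_cat size_nseq /= -size_stages -/l; lia.
  have Ka j : j < size u + size v + 2 -> al (l + j) = nth false (u ++ nseq (size v) false ++ [:: true; G s]) j.
    by move=> lt; rewrite Ha1 ?Sa ?nth_a; [rewrite ltnNge leq_addr /= addKn | lia].
  have Kb j : j < size u + size v + 2 -> be (l + j) = nth false (nseq (size u) false ++ v ++ [:: true; false]) j.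
    by move=> lt; rewrite Hb1 ?Sb ?nth_b; [rewrite ltnNge leq_addr /= addKn | lia].
  exists (l + (size u + size v)); split.
  + by lia.
  + move=> i /andP[le lt]; rewrite -(subnKC le) Ka ?Kb; try lia.
    rewrite !nth_cat !size_nseq !nth_nseq !if_same.
    have [lt1|ge1] := ltnP (i - l) (size u); first by rewrite andbF.
    by have -> : i - l - size u < size v by lia.
  + rewrite Ka ?Kb; try lia.
    by rewrite !catA !nth_cat !size_cat !size_nseq ltnn subnn /=.
  + have -> : (l + (size u + size v)).+1 = l + (size u + size v + 1) by lia.
    rewrite Ka ?Kb; try lia.
    rewrite !catA !nth_cat !size_cat !size_nseq.
    have -> : size u + size v + 1 < size u + size v = false by lia.
    by rewrite addKn.
  + by rewrite Ea Sa; lia.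
Qed.

End Forcing.

(** * Enumeration of machines and existence of a generic pair *)

Definition move_of (o : option bool) : Move :=
  match o with None => MoveS | Some true => MoveL | Some false => MoveR end.
Definition of_move (m : Move) : option bool :=
  match m with MoveS => None | MoveL => Some true | MoveR => Some false end.

Lemma of_moveK m : move_of (of_move m) = m. Proof. by case: m. Qed.

Definition otm_sig (nk : nat * nat) : countType :=
    ('I_nk.1 * 'I_nk.1 * 'I_nk.1 * 'I_nk.1 * 'I_nk.1 * 'I_nk.1 *
     {ffun 'I_nk.1 * nk.2.+1.-tuple (option bool) * option bool ->
        'I_nk.1 * nk.2.+1.-tuple (option bool * option bool) * (option bool * option bool)})%type.

Definition otm_code : countType := {nk : nat * nat & otm_sig nk}.

Definition otm_of (c : otm_code) : OTM (tag c).1 (tag c).2 :=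
  let: (s, a, r, q, y, no, d) := tagged c in
  mkOTM s a r q y no (fun p t h => let: (p', w, am) := d (p, t, h) in
     (p', [tuple of map (fun am => (am.1, move_of am.2)) w], (am.1, move_of am.2))).

(** The numbers of states and tapes are part of the code, so both machines have the same type only
    up to an equality of indices. An equality of dependent pairs can be rewritten in statements
    about them. *)
Lemma otm_ofP n k (M : OTM n k) : exists c : otm_code,
  existT (fun nk => OTM nk.1 nk.2) (tag c) (otm_of c) = existT _ (n, k) M.
Proof.
case: M => s a r q y no d.
pose f : {ffun 'I_n * k.+1.-tuple (option bool) * option bool ->
    'I_n * k.+1.-tuple (option bool * option bool) * (option bool * option bool)} := [ffun x : 'I_n * k.+1.-tuple (option bool) * option bool =>
  let: (p', w, am) := d x.1.1 x.1.2 x.2 in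
  (p', [tuple of map (fun am : Sym * Move => (am.1, of_move am.2)) w], (am.1, of_move am.2))].
exists (existT otm_sig (n, k) (s, a, r, q, y, no, f)) => /=.
congr existT; rewrite /otm_of /=; congr mkOTM.
do 3 (apply: functional_extensionality => ?); rewrite ffunE /=.
case: (d _ _ _) => [[p' w] [b m]] /=; rewrite of_moveK; congr (_, _, _).
by apply: eq_from_tnth => i; rewrite !tnth_map /= of_moveK; case: (tnth w i).
Qed.

(** A disagreement is witnessed by a halting run of [t] steps, which queries words of length at most
    [t]; these are governed by the first [t] bits, since t < 2^t. *)
Lemma inconsistent_use n k (M : OTM n k) n' k' (N : OTM n' k') al :
  ~ consistent M N (powset al) ->
  exists j, forall be, (forall i, i < j -> be i = al i) -> ~ consistent M N (powset be).
Proof.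
move=> nc; apply: NNPP => H; apply: nc => x t t' h h'; apply: NNPP => ne.
apply: H; exists t => be E co; apply: ne.
have Er : run M (powset be) x t = run M (powset al) x t.
  apply: run_use => y le; apply: (powset_use (j := t)) => //.
  exact: leq_ltn_trans le (ltn_expl _ _).
by rewrite -Er; apply: co => //; rewrite Er.
Qed.

Lemma exists_generic_pair (G : nat -> bool) : exists al be (len : nat -> nat),
  [/\ generic al, generic be, len 0 = 0 &
      forall s, exists m, [/\ len s <= m, forall i, len s <= i < m -> ~~ (al i && be i),
         al m && be m, al m.+1 = G s /\ be m.+1 = false & len s.+1 = m.+2]].
Proof.
(* [P s u] says that [u] already forces the pair with number [s] to disagree. A number that codes no
   pair gives an unsatisfiable requirement. *)
pose P s u := if (unpickle s : option (otm_code * otm_code)) is Some (c1, c2)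
  then forall be, extends be u -> ~ consistent (otm_of c1) (otm_of c2) (powset be) else False.
have gen al : (forall s, (exists2 u, extends al u & P s u) \/
                (exists2 u, extends al u & forall v, ~ P s (u ++ v))) -> generic al.
  move=> H n k M n' k' N.
  have [c1 E1] := otm_ofP M; have [c2 E2] := otm_ofP N.
  suff : ~ consistent (otm_of c1) (otm_of c2) (powset al) \/ exists j, forall be,
    (forall i, i < j -> be i = al i) -> consistent (otm_of c1) (otm_of c2) (powset be).
    pose Q (x y : {nk : nat * nat & OTM nk.1 nk.2}) :=
      ~ consistent (projT2 x) (projT2 y) (powset al) \/ exists j, forall be,
      (forall i, i < j -> be i = al i) -> consistent (projT2 x) (projT2 y) (powset be).
    by rewrite -/(Q (existT (fun nk => OTM nk.1 nk.2) _ (otm_of c1)) (existT (fun nk => OTM nk.1 nk.2) _ (otm_of c2))) E1 E2.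
  have := H (pickle (c1, c2)); rewrite /P pickleK => -[[u Eu Pu]|[u Eu Pu]].
    by left; apply: Pu.
  (* If some extension of [u] led to a disagreement, a finite piece of it would force that
     disagreement, although no extension of [u] does. *)
  right; exists (size u) => be Eb; apply: NNPP => nc.
  have [j Hj] := inconsistent_use nc.
  apply: (Pu (mkseq (fun i => be (size u + i)) j)) => ga Eg; apply: Hj => i lt.
  have [lt_u|ge_u] := ltnP i (size u).
    by rewrite Eb // Eu // Eg ?nth_cat ?lt_u // size_cat; lia.
  rewrite Eg ?nth_cat ?size_cat ?size_mkseq; last by lia.
  by rewrite ltnNge ge_u /= nth_mkseq ?subnKC //; lia.
have [al [be [len [Ha Hb H0 Hl]]]] := generic_pair P G.
by exists al, be, len; split=> //; apply: gen.
Qed.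

(** * A hard computable language *)

(** Time is forgotten for the hard language, which only has to be computable, and for the decoding,
    where one bound per index is enough. *)
Definition execs (F V : finType) X (c : cmd F V) s s' := exists t, exec X c s t s'.

Section Exs.
Variables (F V : finType) (X : lang).
Implicit Types (c : cmd F V) (s : st F V).

Lemma execs_seq c1 c2 s s1 s2 : execs X c1 s s1 -> execs X c2 s1 s2 -> execs X (Seq c1 c2) s s2.
Proof. by move=> [t1 H1] [t2 H2]; exists (t1 + t2); apply: ExSeq H2. Qed.

Lemma execs_whileF (g : F -> (V -> option bool) -> bool) c s :
  g (fc s) (tops s) = false -> execs X (While g c) s s.
Proof. by exists 1; apply: ExWhileF. Qed.

Lemma execs_whileT (g : F -> (V -> option bool) -> bool) c s s1 s2 : g (fc s) (tops s) ->
  execs X c s s1 -> execs X (While g c) s1 s2 -> execs X (While g c) s s2.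
Proof. by move=> Hg [t1 H1] [t2 H2]; exists (1 + t1 + t2); apply: ExWhileT H2. Qed.

Lemma execs_if (g : F -> (V -> option bool) -> bool) c1 c2 s s' :
  execs X (if g (fc s) (tops s) then c1 else c2) s s' -> execs X (If g c1 c2) s s'.
Proof.
by case E: (g _ _) => -[t H]; exists t.+1; [apply: ExIfT | apply: ExIfF].
Qed.

End Exs.

Lemma execs_actl m (F : finType) X (a : F -> ('I_m -> option bool) -> eff F 'I_m) o f l w f' l' :
  a f (fun v => ohead (stk l v)) = Eff f' (lops o) None -> size o <= size l ->
  zapp o l = l' -> execs X (Act a) (St f (stk l) w) (St f' (stk l') w).
Proof. by move=> E le E'; exists 1; apply: exec_actl E'. Qed.

(* Prefix codes: [cut n s] splits off [n] serialised trees. *)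
Fixpoint cut (n : nat) (s : seq bool) : seq bool * seq bool :=
  match s, n with
  | b :: s', n'.+1 => let: (t, r) := cut (if b then n.+1 else n') s' in (b :: t, r)
  | _, _ => ([::], s)
  end.

Lemma cut_cat n s : (cut n s).1 ++ (cut n s).2 = s.
Proof.
elim: s n => [|b s IH] [|n] //=; have := IH (if b then n.+2 else n).
by case: (cut _ s) => t r /= ->.
Qed.

Lemma cut0 s : cut 0 s = ([::], s). Proof. by case: s. Qed.

Definition drop_tree s := (cut 1 s).2.

(** The string is a stack of trees in prefix code, and the opcodes are: nothing, duplicate, swap,
    drop, push a leaf, join, split, select. As a node is [true] followed by its subtrees, joining
    the two top trees just pushes [true] and splitting removes it; a leaf splits into two leaves. *)
Definition op_sem (b1 b2 b3 : bool) (s : seq bool) : seq bool :=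
  match b1, b2, b3 with
  | false, false, false => s
  | false, false, true => (cut 1 s).1 ++ s
  | false, true, false =>
      (cut 1 (drop_tree s)).1 ++ (cut 1 s).1 ++ drop_tree (drop_tree s)
  | false, true, true => drop_tree s
  | true, false, false => false :: s
  | true, false, true => true :: s
  | true, true, false =>
      match s with true :: r => r | false :: _ => false :: s | [::] => [::] end
  | true, true, true =>
      if ohead s == Some true then drop_tree (drop_tree s)
      else (cut 1 (drop_tree s)).1 ++ drop_tree (drop_tree (drop_tree s))
  end.

(** An incomplete last opcode is filled up with [false], in agreement with the interpreter, which
    reads [false] from an empty stack. So every bit string is a code. *)
Fixpoint run_code (K s : seq bool) : seq bool :=
  match K with
  | [::] => s
  | [:: a] => op_sem a false false s
  | [:: a; b] => op_sem a b false s
  | a :: b :: c :: K' => run_code K' (op_sem a b c s)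
  end.

Section Ops.
Variable X : lang.
Local Notation "'# i" := (@Ordinal 4 i isT) (at level 8).
Local Notation cmd4 := (cmd bool 'I_4).
Local Notation sa o := (Act (fun (f : bool) (_ : 'I_4 -> option bool) => Eff f (@lops 4 o) None)).
Local Notation whilene i c := (While (fun (_ : bool) (tp : 'I_4 -> option bool) => isSome (tp '#i)) c).
(* 0 : memory, 1 and 2 : temporaries, 3 : number of trees still to be read *)
Local Notation st4 f s a b q := (St f (@stk 4 [:: s; a; b; [::]]) q).

Definition cut_to (toB : bool) : cmd4 :=
  Seq (sa [:: Keep; Keep; Keep; Push true])
 (Seq (While (fun _ (tp : 'I_4 -> option bool) => isSome (tp '#3) && isSome (tp '#0))
    (Act (fun f (tp : 'I_4 -> option bool) => let b := odflt false (tp '#0) in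
       Eff f (@lops 4 [:: Pop; if toB then Keep else Push b; if toB then Push b else Keep;
                          if b then Push true else Pop]) None)))
   (whilene 3 (sa [:: Keep; Keep; Keep; Pop]))).

Lemma execs_cut_to toB f s a b q :
  execs X (cut_to toB) (st4 f s a b q)
    (st4 f (drop_tree s) (if toB then a else catrev (cut 1 s).1 a)
       (if toB then catrev (cut 1 s).1 b else b) q).
Proof.
apply: (execs_seq (s1 := St f (@stk 4 [:: s; a; b; nt 1]) q)).
  exact: (execs_actl X (o := [:: Keep; Keep; Keep; Push true])).
have loop n : exists m, execs X (While (fun _ (tp : 'I_4 -> option bool) => isSome (tp '#3) && isSome (tp '#0))
    (Act (fun f (tp : 'I_4 -> option bool) => let b := odflt false (tp '#0) in
       Eff f (@lops 4 [:: Pop; if toB then Keep else Push b; if toB then Push b else Keep;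
                          if b then Push true else Pop]) None)))
   (St f (@stk 4 [:: s; a; b; nt n]) q)
   (St f (@stk 4 [:: (cut n s).2; if toB then a else catrev (cut n s).1 a;
       if toB then catrev (cut n s).1 b else b; nt m]) q).
  elim: s n a b => [|x s IH] n a b.
    by exists n; case: toB; apply: execs_whileF => /=; rewrite andbF.
  case: n => [|n]; first by exists 0; case: toB {IH}; apply: execs_whileF.
  have [m Hm] := IH (if x then n.+2 else n) (if toB then a else x :: a) (if toB then x :: b else b).
  exists m; rewrite [cut _ _]/= (surjective_pairing (cut _ s)).
  apply: (execs_whileT (s1 := St f (@stk 4 [:: s; if toB then a else x :: a; if toB then x :: b else b;
        nt (if x then n.+2 else n)]) q)) => //.
    exists 1; apply: (exec_actl X (o := [:: Pop; if toB then Keep else Push x; if toB then Push x else Keep;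
                          if x then Push true else Pop])) => //.
    by case: (x); case: toB {Hm IH}.
  by case: toB Hm {IH}.
have [m Hm] := loop 1.
apply: execs_seq Hm _; elim: m => [|m IH]; first exact: execs_whileF.
apply: execs_whileT IH => //.
exact: (execs_actl X (o := [:: Keep; Keep; Keep; Pop])).
Qed.

Definition back (fromB : bool) : cmd4 :=
  if fromB then
    While (fun (_ : bool) (tp : 'I_4 -> option bool) => isSome (tp '#2))
      (Act (fun f tp => Eff f (@lops 4 [:: Push (odflt false (tp '#2)); Keep; Pop]) None))
  else While (fun (_ : bool) (tp : 'I_4 -> option bool) => isSome (tp '#1))
      (Act (fun f tp => Eff f (@lops 4 [:: Push (odflt false (tp '#1)); Pop]) None)).

Lemma execs_backA f s a b q :
  execs X (back false) (st4 f s a b q) (st4 f (catrev a s) [::] b q).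
Proof.
elim: a s => [|x a IH] s; first exact: execs_whileF.
apply: execs_whileT (IH (x :: s)) => //.
exact: (execs_actl X (o := [:: Push x; Pop])).
Qed.

Lemma execs_backB f s a b q :
  execs X (back true) (st4 f s a b q) (st4 f (catrev b s) a [::] q).
Proof.
elim: b s => [|x b IH] s; first exact: execs_whileF.
apply: execs_whileT (IH (x :: s)) => //.
exact: (execs_actl X (o := [:: Push x; Keep; Pop])).
Qed.

Definition c_dup : cmd4 :=
  Seq (cut_to false)
 (Seq (While (fun (_ : bool) (tp : 'I_4 -> option bool) => isSome (tp '#1))
      (Act (fun f tp => let b := odflt false (tp '#1) in
         Eff f (@lops 4 [:: Push b; Pop; Push b]) None)))
 (Seq (While (fun (_ : bool) (tp : 'I_4 -> option bool) => isSome (tp '#2))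
      (Act (fun f tp => Eff f (@lops 4 [:: Keep; Push (odflt false (tp '#2)); Pop]) None)))
      (back false))).

Lemma execs_dup f s q : execs X c_dup (st4 f s [::] [::] q) (st4 f ((cut 1 s).1 ++ s) [::] [::] q).
Proof.
apply: execs_seq (execs_cut_to false f s [::] [::] q) _ => /=.
set t := (cut 1 s).1; set r := drop_tree s.
have H1 a u b : execs X (While (fun (_ : bool) (tp : 'I_4 -> option bool) => isSome (tp '#1))
      (Act (fun f tp => let b := odflt false (tp '#1) in
         Eff f (@lops 4 [:: Push b; Pop; Push b]) None)))
   (st4 f u a b q) (st4 f (catrev a u) [::] (catrev a b) q).
  elim: a u b => [|x a IH] u b; first exact: execs_whileF.
  apply: execs_whileT (IH (x :: u) (x :: b)) => //.
  exact: (execs_actl X (o := [:: Push x; Pop; Push x])).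
have H2 u a b : execs X (While (fun (_ : bool) (tp : 'I_4 -> option bool) => isSome (tp '#2))
      (Act (fun f tp => Eff f (@lops 4 [:: Keep; Push (odflt false (tp '#2)); Pop]) None)))
   (st4 f u a b q) (st4 f u (catrev b a) [::] q).
  elim: b a => [|x b IH] a; first exact: execs_whileF.
  apply: execs_whileT (IH (x :: a)) => //.
  exact: (execs_actl X (o := [:: Keep; Push x; Pop])).
apply: execs_seq (H1 _ _ _) _; apply: execs_seq (H2 _ _ _) _.
have E u : catrev (catrev t [::]) u = t ++ u by rewrite !catrevE cats0 revK.
rewrite !E cats0; have -> : t ++ r = s by apply: cut_cat.
by have := execs_backA f s (catrev t [::]) [::] q; rewrite E.
Qed.

Definition c_swap : cmd4 := Seq (cut_to false) (Seq (cut_to true) (Seq (back false) (back true))).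

Lemma execs_swap f s q : execs X c_swap (st4 f s [::] [::] q)
  (st4 f ((cut 1 (drop_tree s)).1 ++ (cut 1 s).1 ++ drop_tree (drop_tree s)) [::] [::] q).
Proof.
apply: execs_seq (execs_cut_to false f s [::] [::] q) _ => /=.
apply: execs_seq (execs_cut_to true f _ _ _ q) _ => /=.
apply: execs_seq (execs_backA f _ _ _ q) _ => /=.
have E t u : catrev (catrev t [::]) u = t ++ u by rewrite !catrevE cats0 revK.
by have := execs_backB f (catrev (catrev (cut 1 s).1 [::]) (drop_tree (drop_tree s))) [::]
  (catrev (cut 1 (drop_tree s)).1 [::]) q; rewrite !E.
Qed.

Definition c_drop : cmd4 := Seq (cut_to true) (whilene 2 (sa [:: Keep; Keep; Pop])).

Lemma execs_drop f s a q : execs X c_drop (st4 f s a [::] q) (st4 f (drop_tree s) a [::] q).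
Proof.
apply: execs_seq (execs_cut_to true f s a [::] q) _ => /=.
elim: (catrev _ _) => [|x b IH]; first exact: execs_whileF.
by apply: execs_whileT IH => //; apply: (execs_actl X (o := [:: Keep; Keep; Pop])).
Qed.

Definition c_uncons : cmd4 :=
  Act (fun f (tp : 'I_4 -> option bool) => Eff f (@lops 4
    [:: match tp '#0 with Some true => Pop | Some false => Push false | None => Keep end]) None).

Definition c_sel : cmd4 :=
  Seq (Act (fun _ (tp : 'I_4 -> option bool) => Eff (tp '#0 == Some true) (@lops 4 [::]) None))
 (Seq c_drop (If (fun f _ => f) c_drop (Seq (cut_to false) (Seq c_drop (back false))))).

Definition op_cmd (b1 b2 b3 : bool) : cmd4 :=
  match b1, b2, b3 with
  | false, false, false => sa [::]
  | false, false, true => c_dup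
  | false, true, false => c_swap
  | false, true, true => c_drop
  | true, false, false => sa [:: Push false]
  | true, false, true => sa [:: Push true]
  | true, true, false => c_uncons
  | true, true, true => c_sel
  end.

Lemma execs_op b1 b2 b3 f s q : exists f',
  execs X (op_cmd b1 b2 b3) (st4 f s [::] [::] q) (st4 f' (op_sem b1 b2 b3 s) [::] [::] q).
Proof.
case: b1 b2 b3 => -[] [] /=.
- exists (ohead s == Some true); apply: (execs_seq (s1 := st4 (ohead s == Some true) s [::] [::] q)).
    exact: (execs_actl X (o := [::])).
  apply: execs_seq (execs_drop _ _ _ _) _; apply: execs_if => /=.
  case: eqP => [_|_]; first exact: execs_drop.
  apply: execs_seq (execs_cut_to false _ _ _ _ _) _ => /=.
  apply: execs_seq (execs_drop _ _ _ _) _.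
  have := execs_backA false (drop_tree (drop_tree (drop_tree s))) (catrev (cut 1 (drop_tree s)).1 [::]) [::] q.
  by rewrite !catrevE cats0 revK.
- exists f; case: s => [|[] s].
  + exact: (execs_actl X (o := [:: Keep])).
  + exact: (execs_actl X (o := [:: Pop])).
  + exact: (execs_actl X (o := [:: Push false])).
- by exists f; apply: (execs_actl X (o := [:: Push true])).
- by exists f; apply: (execs_actl X (o := [:: Push false])).
- by exists f; apply: execs_drop.
- by exists f; apply: execs_swap.
- by exists f; apply: execs_dup.
- by exists f; apply: (execs_actl X (o := [::])).
Qed.

End Ops.

Inductive tree := Lf | Nd of tree & tree.

Fixpoint ser (t : tree) : seq bool :=
  match t with Lf => [:: false] | Nd a b => true :: ser a ++ ser b end.

Definition tsym (a : Sym) : tree :=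
  match a with None => Lf | Some false => Nd Lf Lf | Some true => Nd (Nd Lf Lf) Lf end.

Fixpoint tlist (l : seq Sym) : tree := if l is a :: l' then Nd (tsym a) (tlist l') else Lf.

Definition lead (x : seq bool) : nat := find negb x.

(* Most significant digit first. *)
Fixpoint digits (fuel e : nat) (l : seq bool) : seq bool :=
  if fuel is f.+1 then if e is 0 then l else digits f e./2 (odd e :: l) else l.

(** The leading binary digit is dropped, so that codes may begin with [false] and every bit string
    has an index. *)
Definition code_of (e : nat) : seq bool := behead (digits e e [::]).

(** If the code comes from a machine, the leaf in front of the input makes the first pass set up the
    initial configuration, and each later pass performs one step; [2 ^ size x] passes yield
    [2 ^ size x - 1] steps. *)
Definition memory (x : seq bool) : seq bool :=
  iter (2 ^ size x) (run_code (code_of (lead x))) (ser (Nd Lf (tlist (map Some x)))).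

(** For the code of a machine these bits are the root of the configuration, the root of its [estate]
    and the root of the rejection flag stored there; only the last one can be [false]. *)
Definition hard_lang : lang := fun x =>
  [&& ohead (memory x) == Some true, ohead (behead (memory x)) == Some true
    & ohead (behead (behead (memory x))) == Some true].

(** * An interpreter for the codes *)

Section UProg.
Variable X : lang.

(* (only trues read so far; parity or result; opcode; flag of the memory operations) *)
Definition uF : finType := (bool * bool * (bool * bool * bool) * bool)%type.
(* In ['I_8]: 0 the input and 1 its reversal, later the code still to be run; 2 the number coding
   the machine; 3 the length of the input; 4 the clock and 5 a temporary; 6 and 7 the code.
   In ['I_4]: the memory and the temporaries of [op_cmd]. *)
Definition uV : finType := ('I_8 + 'I_4)%type.
Local Notation "'# i" := (inl (@Ordinal 8 i isT)) (at level 8).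
Local Notation "'% i" := (inr (@Ordinal 4 i isT)) (at level 8).
Local Notation tps := (uV -> option bool).

Definition uops (o1 o2 : seq sop) : uV -> sop := fun v =>
  match v with inl v => lops o1 v | inr v => lops o2 v end.
Definition ust f (l1 l2 : seq (seq bool)) : st uF uV := St f (sjoin (@stk 8 l1) (@stk 4 l2)) [::].

Lemma execs_actu (a : uF -> tps -> eff uF uV) o1 o2 f f' l1 l2 l1' l2' :
  a f (fun v => ohead (sjoin (@stk 8 l1) (@stk 4 l2) v)) = Eff f' (uops o1 o2) None ->
  size o1 <= size l1 -> size o2 <= size l2 -> zapp o1 l1 = l1' -> zapp o2 l2 = l2' ->
  execs X (Act a) (ust f l1 l2) (ust f' l1' l2').
Proof.
move=> E le1 le2 <- <-; exists 1; apply: exec_act; rewrite E /aeff /=; congr St.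
apply: functional_extensionality => -[v|v] /=.
  by rewrite -(@zappE 8 o1 l1 le1).
by rewrite -(@zappE 4 o2 l2 le2).
Qed.

Local Notation ua o1 o2 := (Act (fun (f : uF) (_ : tps) => Eff f (uops o1 o2) None)).
Local Notation uwhile i c := (While (fun (_ : uF) (tp : tps) => isSome (tp '#i)) c).

Definition u_parse : cmd uF uV :=
  uwhile 0 (Act (fun (f : uF) (tp : tps) =>
    let: (lead, par, op, fl) := f in let b := odflt false (tp '#0) in
    Eff (lead && b, par, op, fl)
        (uops [:: Pop; Push b; if lead && b then Push true else Keep; Push true] [::]) None)).

Lemma execs_parse ld par op fl x xr e n l m : exists ld',
  execs X u_parse (ust (ld, par, op, fl) [:: x, xr, nt e, nt n & l] m)
   (ust (ld', par, op, fl) [:: [::], catrev x xr, nt ((if ld then lead x else 0) + e), nt (size x + n) & l] m).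
Proof.
elim: x ld xr e n => [|b x IH] ld xr e n.
  by exists ld; rewrite if_same; apply: execs_whileF.
have [ld' H] := IH (ld && b) (b :: xr) ((ld && b) + e) n.+1.
have E1 : (if ld && b then lead x else 0) + ((ld && b) + e) = (if ld then lead (b :: x) else 0) + e.
  by case: (ld); case: b {H}; rewrite /lead //= addnCA addnA.
exists ld'; rewrite E1 [size x + n.+1]addnS in H.
apply: execs_whileT H => //.
apply: (execs_actu (o1 := [:: Pop; Push b; if ld && b then Push true else Keep; Push true]) (o2 := [::])) => //.
by case: (ld && b).
Qed.

Fixpoint u_push (w : seq bool) : cmd uF uV :=
  if w is b :: w' then Seq (u_push w') (ua [::] [:: Push b]) else ua [::] [::].

Lemma execs_push w f l s m : execs X (u_push w) (ust f l (s :: m)) (ust f l ((w ++ s) :: m)).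
Proof.
elim: w s => [|b w IH] s /=; first exact: (execs_actu (o1 := [::]) (o2 := [::])).
by apply: execs_seq (IH s) _; apply: (execs_actu (o1 := [::]) (o2 := [:: Push b])).
Qed.

Definition u_build : cmd uF uV :=
  Seq (u_push [:: false])
 (Seq (uwhile 1
   (Seq (Act (fun (f : uF) (tp : tps) => let: (lead, par, op, fl) := f in
          Eff (lead, odflt false (tp '#1), op, fl) (uops [:: Keep; Pop] [::]) None))
        (If (fun (f : uF) _ => f.1.1.2) (u_push [:: true; true; true; false; false; false])
                                        (u_push [:: true; true; false; false]))))
   (u_push [:: true; false])).

Lemma execs_build ld par op fl x l m : exists par',
  execs X u_build (ust (ld, par, op, fl) [:: [::], rev x & l] ([::] :: m))
   (ust (ld, par', op, fl) [:: [::], [::] & l] (ser (Nd Lf (tlist (map Some x))) :: m)).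
Proof.
have loop y z par0 : exists par',
  execs X (uwhile 1
   (Seq (Act (fun (f : uF) (tp : tps) => let: (lead, par, op, fl) := f in
          Eff (lead, odflt false (tp '#1), op, fl) (uops [:: Keep; Pop] [::]) None))
        (If (fun (f : uF) _ => f.1.1.2) (u_push [:: true; true; true; false; false; false])
                                        (u_push [:: true; true; false; false]))))
   (ust (ld, par0, op, fl) [:: [::], y & l] (ser (tlist (map Some z)) :: m))
   (ust (ld, par', op, fl) [:: [::], [::] & l] (ser (tlist (map Some (catrev y z))) :: m)).
  elim: y z par0 => [|b y IH] z par0; first by exists par0; apply: execs_whileF.
  have [par' H] := IH (b :: z) b; exists par'; apply: execs_whileT H => //.
  apply: (execs_seq (s1 := ust (ld, b, op, fl) [:: [::], y & l] (ser (tlist (map Some z)) :: m))).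
    exact: (execs_actu (o1 := [:: Keep; Pop]) (o2 := [::])).
  apply: execs_if => /=; case: b.
    exact: (execs_push [:: true; true; true; false; false; false] _ _ (ser (tlist (map Some z)))).
  exact: (execs_push [:: true; true; false; false] _ _ (ser (tlist (map Some z)))).
have [par' H] := loop (rev x) [::] par; exists par'.
apply: execs_seq (execs_push [:: false] _ _ _ _) _; apply: execs_seq H _.
by rewrite catrevE revK cats0; exact: (execs_push [:: true; false] (ld, par', op, fl)).
Qed.

Definition u_digits : cmd uF uV :=
  uwhile 2
   (Seq (Act (fun (f : uF) (_ : tps) => let: (lead, par, op, fl) := f in
          Eff (lead, false, op, fl) (uops [::] [::]) None))
   (Seq (uwhile 2 (Act (fun (f : uF) (_ : tps) => let: (lead, par, op, fl) := f in
          Eff (lead, ~~ par, op, fl)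
              (uops [:: Keep; Keep; Pop; Keep; Keep; if par then Push true else Keep] [::]) None)))
   (Seq (Act (fun (f : uF) (_ : tps) => let: (lead, par, op, fl) := f in
          Eff f (uops [:: Keep; Keep; Keep; Keep; Keep; Keep; Push par] [::]) None))
        (uwhile 5 (ua [:: Keep; Keep; Push true; Keep; Keep; Pop] [::]))))).

Lemma execs_move5 f x xr e n t k l m :
  execs X (uwhile 5 (ua [:: Keep; Keep; Push true; Keep; Keep; Pop] [::]))
    (ust f [:: x, xr, nt e, n, t, nt k & l] m) (ust f [:: x, xr, nt (k + e), n, t, [::] & l] m).
Proof.
elim: k e => [|k IH] e; first exact: execs_whileF.
have H := IH e.+1; rewrite -addSnnS in H; apply: execs_whileT H => //.
exact: (execs_actu (o1 := [:: Keep; Keep; Push true; Keep; Keep; Pop]) (o2 := [::])).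
Qed.

Lemma execs_digits ld par op fl x xr e n t k l m : exists par',
  execs X u_digits (ust (ld, par, op, fl) [:: x, xr, nt e, n, t, [::], k & l] m)
   (ust (ld, par', op, fl) [:: x, xr, [::], n, t, [::], digits e e k & l] m).
Proof.
have halve p h r kk : execs X (uwhile 2 (Act (fun (f : uF) (_ : tps) => let: (lead, par, op, fl) := f in
          Eff (lead, ~~ par, op, fl)
              (uops [:: Keep; Keep; Pop; Keep; Keep; if par then Push true else Keep] [::]) None)))
   (ust (ld, p, op, fl) [:: x, xr, nt h, n, t, nt r, kk & l] m)
   (ust (ld, p (+) odd h, op, fl) [:: x, xr, [::], n, t, nt (r + (h + p)./2), kk & l] m).
  elim: h p r => [|h IH] p r.
    by rewrite addbF add0n (_ : p./2 = 0) ?addn0; [exact: execs_whileF | case: p].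
  have := IH (~~ p) (r + p).
  have -> : ~~ p (+) odd h = p (+) odd h.+1 by rewrite /= addbN addNb.
  have -> : r + p + (h + ~~ p)./2 = r + (h.+1 + p)./2 by lia.
  apply: execs_whileT => //.
  apply: (execs_actu (o1 := [:: Keep; Keep; Pop; Keep; Keep; if p then Push true else Keep]) (o2 := [::])) => //.
  by case: (p); rewrite ?addn1 ?addn0.
have main fu h k' p : h <= fu -> exists p', execs X u_digits
   (ust (ld, p, op, fl) [:: x, xr, nt h, n, t, [::], k' & l] m)
   (ust (ld, p', op, fl) [:: x, xr, [::], n, t, [::], digits fu h k' & l] m).
  elim: fu h k' p => [|fu IH] h k' p; first by case: h => // _; exists p; apply: execs_whileF.
  case: h => [_|h le]; first by exists p; apply: execs_whileF.
  have [|p' H] := IH h.+1./2 (odd h.+1 :: k') (odd h.+1); first lia.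
  exists p'; apply: execs_whileT H => //.
  apply: (execs_seq (s1 := ust (ld, false, op, fl) [:: x, xr, nt h.+1, n, t, [::], k' & l] m)).
    exact: (execs_actu (o1 := [::]) (o2 := [::])).
  have Hh := halve false h.+1 0 k'; rewrite /= !addn0 add0n in Hh.
  apply: execs_seq Hh _.
  apply: (execs_seq (s1 := ust (ld, odd h.+1, op, fl) [:: x, xr, nt 0, n, t, nt h.+1./2, odd h.+1 :: k' & l] m)).
    exact: (execs_actu (o1 := [:: Keep; Keep; Keep; Keep; Keep; Keep; Push (odd h.+1)]) (o2 := [::])).
  by have := execs_move5 (ld, odd h.+1, op, fl) x xr 0 n t h.+1./2 ((odd h.+1 :: k') :: l) m; rewrite addn0.
exact: main.
Qed.

Definition u_pow : cmd uF uV :=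
  Seq (ua [:: Keep; Keep; Keep; Keep; Push true] [::])
      (uwhile 3
        (Seq (ua [:: Keep; Keep; Keep; Pop] [::])
        (Seq (uwhile 4 (ua [:: Keep; Keep; Keep; Keep; Pop; Push true] [::]))
             (uwhile 5 (Seq (ua [:: Keep; Keep; Keep; Keep; Push true; Pop] [::])
                            (ua [:: Keep; Keep; Keep; Keep; Push true] [::])))))).

Lemma execs_pow f x xr e n l m :
  execs X u_pow (ust f [:: x, xr, e, nt n, [::], [::] & l] m)
              (ust f [:: x, xr, e, [::], nt (2 ^ n), [::] & l] m).
Proof.
have mv h k n' : execs X (uwhile 4 (ua [:: Keep; Keep; Keep; Keep; Pop; Push true] [::]))
    (ust f [:: x, xr, e, n', nt h, nt k & l] m) (ust f [:: x, xr, e, n', [::], nt (h + k) & l] m).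
  elim: h k => [|h IH] k; first exact: execs_whileF.
  have H := IH k.+1; rewrite -addSnnS in H; apply: execs_whileT H => //.
  exact: (execs_actu (o1 := [:: Keep; Keep; Keep; Keep; Pop; Push true]) (o2 := [::])).
have db h k n' : execs X (uwhile 5 (Seq (ua [:: Keep; Keep; Keep; Keep; Push true; Pop] [::])
                            (ua [:: Keep; Keep; Keep; Keep; Push true] [::])))
    (ust f [:: x, xr, e, n', nt k, nt h & l] m) (ust f [:: x, xr, e, n', nt (2 * h + k), [::] & l] m).
  elim: h k => [|h IH] k; first exact: execs_whileF.
  have H := IH k.+2; have E : 2 * h + k.+2 = 2 * h.+1 + k by lia.
  rewrite E in H; apply: execs_whileT H => //.
  apply: (execs_seq (s1 := ust f [:: x, xr, e, n', nt k.+1, nt h & l] m)).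
    exact: (execs_actu (o1 := [:: Keep; Keep; Keep; Keep; Push true; Pop]) (o2 := [::])).
  exact: (execs_actu (o1 := [:: Keep; Keep; Keep; Keep; Push true]) (o2 := [::])).
apply: (execs_seq (s1 := ust f [:: x, xr, e, nt n, nt (2 ^ 0), [::] & l] m)).
  exact: (execs_actu (o1 := [:: Keep; Keep; Keep; Keep; Push true]) (o2 := [::])).
suff loop h : execs X (uwhile 3
        (Seq (ua [:: Keep; Keep; Keep; Pop] [::])
        (Seq (uwhile 4 (ua [:: Keep; Keep; Keep; Keep; Pop; Push true] [::]))
             (uwhile 5 (Seq (ua [:: Keep; Keep; Keep; Keep; Push true; Pop] [::])
                            (ua [:: Keep; Keep; Keep; Keep; Push true] [::]))))))
    (ust f [:: x, xr, e, nt n, nt (2 ^ h), [::] & l] m)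
    (ust f [:: x, xr, e, [::], nt (2 ^ (n + h)), [::] & l] m).
  by have := loop 0; rewrite addn0.
elim: n h => [|n IH] h; first exact: execs_whileF.
have H := IH h.+1; rewrite -addSnnS in H; apply: execs_whileT H => //.
apply: (execs_seq (s1 := ust f [:: x, xr, e, nt n, nt (2 ^ h), [::] & l] m)).
  exact: (execs_actu (o1 := [:: Keep; Keep; Keep; Pop]) (o2 := [::])).
apply: execs_seq (mv _ 0 _) _.
by have := db (2 ^ h + 0) 0 (nt n); rewrite !addn0 -expnS.
Qed.

Definition u_shift : cmd uF uV :=
  Act (fun (f : uF) (tp : tps) => let: (lead, par, (b1, b2, b3), fl) := f in
    Eff (lead, par, (b2, b3, odflt false (tp '#1)), fl) (uops [:: Keep; Pop] [::]) None).

Definition u_op (b1 b2 b3 : bool) : cmd uF uV := liftR _ _ (op_cmd b1 b2 b3).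

Definition u_dispatch : cmd uF uV :=
  If (fun (f : uF) _ => f.1.2.1.1)
    (If (fun (f : uF) _ => f.1.2.1.2)
       (If (fun (f : uF) _ => f.1.2.2) (u_op true true true) (u_op true true false))
       (If (fun (f : uF) _ => f.1.2.2) (u_op true false true) (u_op true false false)))
    (If (fun (f : uF) _ => f.1.2.1.2)
       (If (fun (f : uF) _ => f.1.2.2) (u_op false true true) (u_op false true false))
       (If (fun (f : uF) _ => f.1.2.2) (u_op false false true) (u_op false false false))).

Definition u_pass : cmd uF uV :=
  Seq (uwhile 6 (Act (fun (f : uF) (tp : tps) => Eff f (uops
        [:: Keep; Keep; Keep; Keep; Keep; Keep; Pop; Push (odflt false (tp '#6))] [::]) None)))
 (Seq (uwhile 7 (Act (fun (f : uF) (tp : tps) => let b := odflt false (tp '#7) in Eff f (uops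
        [:: Keep; Push b; Keep; Keep; Keep; Keep; Push b; Pop] [::]) None)))
      (uwhile 1 (Seq u_shift (Seq u_shift (Seq u_shift u_dispatch))))).

Lemma execs_dispatch lp b1 b2 b3 fl l s : exists fl',
  execs X u_dispatch (ust (lp, (b1, b2, b3), fl) l [:: s; [::]; [::]; [::]])
                   (ust (lp, (b1, b2, b3), fl') l [:: op_sem b1 b2 b3 s; [::]; [::]; [::]]).
Proof.
have [fl' [t H]] := execs_op X b1 b2 b3 fl s [::]; exists fl'.
have H' : execs X (u_op b1 b2 b3) (ust (lp, (b1, b2, b3), fl) l [:: s; [::]; [::]; [::]])
                   (ust (lp, (b1, b2, b3), fl') l [:: op_sem b1 b2 b3 s; [::]; [::]; [::]]).
  by exists t; apply: (exec_liftR (s := St _ _ _) (s' := St _ _ _) (lp, (b1, b2, b3)) (@stk 8 l) H).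
by case: b1 b2 b3 H' {H} => -[] [] H'; do 3 (apply: execs_if => /=).
Qed.

Lemma execs_shift lp b1 b2 b3 fl x k l m :
  execs X u_shift (ust (lp, (b1, b2, b3), fl) [:: x, k & l] m)
    (ust (lp, (b2, b3, head false k), fl) [:: x, behead k & l] m).
Proof.
case: lp => ld par; case: k => [|b k];
  exact: (execs_actu (o1 := [:: Keep; Pop]) (o2 := [::])).
Qed.

Lemma execs_pass lp op fl x e n t t2 k s : exists op' fl',
  execs X u_pass (ust (lp, op, fl) [:: x; [::]; e; n; t; t2; k; [::]] [:: s; [::]; [::]; [::]])
    (ust (lp, op', fl') [:: x; [::]; e; n; t; t2; k; [::]] [:: run_code k s; [::]; [::]; [::]]).
Proof.
have A h g : execs X (uwhile 6 (Act (fun (f : uF) (tp : tps) => Eff f (uops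
        [:: Keep; Keep; Keep; Keep; Keep; Keep; Pop; Push (odflt false (tp '#6))] [::]) None)))
   (ust (lp, op, fl) [:: x; [::]; e; n; t; t2; h; g] [:: s; [::]; [::]; [::]])
   (ust (lp, op, fl) [:: x; [::]; e; n; t; t2; [::]; catrev h g] [:: s; [::]; [::]; [::]]).
  elim: h g => [|b h IH] g; first exact: execs_whileF.
  apply: execs_whileT (IH (b :: g)) => //.
  exact: (execs_actu (o1 := [:: Keep; Keep; Keep; Keep; Keep; Keep; Pop; Push b]) (o2 := [::])).
have B g h : execs X (uwhile 7 (Act (fun (f : uF) (tp : tps) => let b := odflt false (tp '#7) in Eff f (uops
        [:: Keep; Push b; Keep; Keep; Keep; Keep; Push b; Pop] [::]) None)))
   (ust (lp, op, fl) [:: x; h; e; n; t; t2; h; g] [:: s; [::]; [::]; [::]])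
   (ust (lp, op, fl) [:: x; catrev g h; e; n; t; t2; catrev g h; [::]] [:: s; [::]; [::]; [::]]).
  elim: g h => [|b g IH] h; first exact: execs_whileF.
  apply: execs_whileT (IH (b :: h)) => //.
  exact: (execs_actu (o1 := [:: Keep; Push b; Keep; Keep; Keep; Keep; Push b; Pop]) (o2 := [::])).
have C g op0 fl0 s0 : exists op' fl', execs X (uwhile 1 (Seq u_shift (Seq u_shift (Seq u_shift u_dispatch))))
   (ust (lp, op0, fl0) [:: x; g; e; n; t; t2; k; [::]] [:: s0; [::]; [::]; [::]])
   (ust (lp, op', fl') [:: x; [::]; e; n; t; t2; k; [::]] [:: run_code g s0; [::]; [::]; [::]]).
  have step1 g0 o f0 s1 : exists o' f', execs X (Seq u_shift (Seq u_shift (Seq u_shift u_dispatch)))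
     (ust (lp, o, f0) [:: x; g0; e; n; t; t2; k; [::]] [:: s1; [::]; [::]; [::]])
     (ust (lp, o', f') [:: x; behead (behead (behead g0)); e; n; t; t2; k; [::]]
       [:: op_sem (head false g0) (head false (behead g0)) (head false (behead (behead g0))) s1; [::]; [::]; [::]]).
    case: o => [[b1 b2] b3].
    have [f' H] := execs_dispatch lp (head false g0) (head false (behead g0))
      (head false (behead (behead g0))) f0 [:: x; behead (behead (behead g0)); e; n; t; t2; k; [::]] s1.
    eexists; exists f'; do 3 (apply: execs_seq (execs_shift _ _ _ _ _ _ _ _ _) _); exact: H.
  move: (leqnn (size g)); move: {2}(size g) => u.
  elim: u g op0 fl0 s0 => [|u IH] g op0 fl0 s0.
    by case: g => // _; exists op0, fl0; apply: execs_whileF.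
  case: g => [|a [|b [|c g]]] le.
  - by exists op0, fl0; apply: execs_whileF.
  - have [o' [f' H]] := step1 [:: a] op0 fl0 s0; exists o', f'.
    by apply: execs_whileT H _ => //; apply: execs_whileF.
  - have [o' [f' H]] := step1 [:: a; b] op0 fl0 s0; exists o', f'.
    by apply: execs_whileT H _ => //; apply: execs_whileF.
  - have [o' [f' H]] := step1 [:: a, b, c & g] op0 fl0 s0.
    have [|o2 [f2 H2]] := IH g o' f' (op_sem a b c s0); first by move: le => /=; lia.
    by exists o2, f2; apply: execs_whileT H H2.
have [op' [fl' H]] := C k op fl s; exists op', fl'.
apply: execs_seq (A _ _) _; apply: execs_seq (B _ _) _.
by have E : catrev (catrev k [::]) [::] = k; [rewrite !catrevE !cats0 revK | rewrite E].
Qed.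

Definition u_test : cmd uF uV :=
  Act (fun (f : uF) (tp : tps) => let: (lead, par, op, fl) := f in
    Eff (lead, par && (tp '%0 == Some true), op, fl) (uops [::] [:: Pop]) None).

Definition u_prog : cmd uF uV :=
  Seq u_parse
 (Seq u_build
 (Seq u_digits
 (Seq (ua [:: Keep; Keep; Keep; Keep; Keep; Keep; Pop] [::])
 (Seq u_pow
 (Seq (uwhile 4 (Seq (ua [:: Keep; Keep; Keep; Keep; Pop] [::]) u_pass))
 (Seq (Act (fun (f : uF) (_ : tps) => let: (lead, par, op, fl) := f in
         Eff (lead, true, op, fl) (uops [::] [::]) None))
 (Seq u_test (Seq u_test u_test)))))))).

Definition u_start : uF := (true, false, (false, false, false), false).
Definition u_out (f : uF) : bool := f.1.1.2.

Lemma execs_prog x : exists f l m,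
  execs X u_prog (ust u_start [:: x; [::]; [::]; [::]; [::]; [::]; [::]; [::]] [:: [::]; [::]; [::]; [::]])
    (ust f l m) /\ u_out f = hard_lang x.
Proof.
have [ld1 H1] := execs_parse true false (false, false, false) false x [::] 0 0
  [:: [::]; [::]; [::]; [::]] [:: [::]; [::]; [::]; [::]].
rewrite !addn0 catrevE cats0 in H1.
have [p2 H2] := execs_build ld1 false (false, false, false) false x
  [:: nt (lead x); nt (size x); [::]; [::]; [::]; [::]] [:: [::]; [::]; [::]].
set s0 := ser _ in H2.
have [p3 H3] := execs_digits ld1 p2 (false, false, false) false [::] [::] (lead x) (nt (size x)) [::] [::]
  [:: [::]] [:: s0; [::]; [::]; [::]].
have H4 := execs_pow (ld1, p3, (false, false, false), false) [::] [::] [::] (size x)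
  [:: code_of (lead x); [::]] [:: s0; [::]; [::]; [::]].
have loop u op fl s : exists op' fl', execs X (uwhile 4 (Seq (ua [:: Keep; Keep; Keep; Keep; Pop] [::]) u_pass))
   (ust (ld1, p3, op, fl) [:: [::]; [::]; [::]; [::]; nt u; [::]; code_of (lead x); [::]] [:: s; [::]; [::]; [::]])
   (ust (ld1, p3, op', fl') [:: [::]; [::]; [::]; [::]; [::]; [::]; code_of (lead x); [::]]
      [:: iter u (run_code (code_of (lead x))) s; [::]; [::]; [::]]).
  elim: u op fl s => [|u IH] op fl s; first by exists op, fl; apply: execs_whileF.
  have [o1 [f1 Hp]] := execs_pass (ld1, p3) op fl [::] [::] [::] (nt u) [::] (code_of (lead x)) s.
  have [o2 [f2 H]] := IH o1 f1 (run_code (code_of (lead x)) s).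
  exists o2, f2; rewrite iterSr; apply: execs_whileT H => //; apply: execs_seq Hp.
  exact: (execs_actu (o1 := [:: Keep; Keep; Keep; Keep; Pop]) (o2 := [::])).
have [o5 [f5 H5]] := loop (2 ^ size x) (false, false, false) false s0.
have test ld par op fl l s m : execs X u_test (ust (ld, par, op, fl) l (s :: m))
    (ust (ld, par && (ohead s == Some true), op, fl) l (behead s :: m)).
  exact: (execs_actu (o1 := [::]) (o2 := [:: Pop])).
do 3 eexists; split.
  apply: execs_seq H1 _; apply: execs_seq H2 _; apply: execs_seq H3 _.
  apply: execs_seq; first exact: (execs_actu (o1 := [:: Keep; Keep; Keep; Keep; Keep; Keep; Pop]) (o2 := [::])).
  apply: execs_seq H4 _; apply: execs_seq H5 _.
  apply: execs_seq; first exact: (execs_actu (f' := (ld1, true, o5, f5)) (o1 := [::]) (o2 := [::])).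
  do 2 (apply: execs_seq (test _ _ _ _ _ _ _) _); exact: test.
by rewrite /u_out /hard_lang /memory /= -/s0 andbA.
Qed.

End UProg.

Lemma hard_lang_computable : computable hard_lang.
Proof.
have [n [k [M HM]]] := compile u_prog (inl (@Ordinal 8 0 isT)) u_start u_out.
exists n, k, M => x; have [f [l [m [[t H] E]]]] := execs_prog empty_oracle x.
have Ei : init_st (inl (@Ordinal 8 0 isT)) u_start x = ust u_start
    [:: x; [::]; [::]; [::]; [::]; [::]; [::]; [::]] [:: [::]; [::]; [::]; [::]].
  congr St; apply: functional_extensionality => -[] v /=.
    by case: v => -[|[|[|[|[|[|[|[|//]]]]]]]].
  by case: v => -[|[|[|[|//]]]].
have [|m' _ [h Ea]] := HM empty_oracle x t (ust f l m); first by rewrite Ei.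
by exists m'; rewrite Ea E.
Qed.

(** * Terms on binary trees and their translation into codes *)

Inductive tm :=
| TId | TLf | TFst | TSnd | TComp of tm & tm | TNd of tm & tm | TIf of tm & tm & tm.

Definition tfst t := if t is Nd a _ then a else Lf.
Definition tsnd t := if t is Nd _ b then b else Lf.
Definition is_leaf t := if t is Lf then true else false.

(** There is no recursion: a term describes one step and [memory] iterates it. Projections of a leaf
    are leaves, so that the end of a tape reads as a blank cell followed by an empty tape. *)
Fixpoint den (c : tm) (t : tree) : tree :=
  match c with
  | TId => t
  | TLf => Lf
  | TFst => tfst t
  | TSnd => tsnd t
  | TComp f g => den f (den g t)
  | TNd f g => Nd (den f t) (den g t)
  | TIf c a b => if is_leaf (den c t) then den a t else den b t
  end.

Definition oDUP := [:: false; false; true].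
Definition oSWAP := [:: false; true; false].
Definition oDROP := [:: false; true; true].
Definition oLEAF := [:: true; false; false].
Definition oCONS := [:: true; false; true].
Definition oUNCONS := [:: true; true; false].
Definition oSEL := [:: true; true; true].

(** The code replaces the top tree by its value and keeps everything below. There are no jumps:
    [TIf] evaluates both branches and the test on copies of the argument and then selects. *)
Fixpoint asm (c : tm) : seq bool :=
  match c with
  | TId => [::]
  | TLf => oDROP ++ oLEAF
  | TFst => oUNCONS ++ oSWAP ++ oDROP
  | TSnd => oUNCONS ++ oDROP
  | TComp f g => asm g ++ asm f
  | TNd f g => oDUP ++ asm g ++ oSWAP ++ asm f ++ oCONS
  | TIf c a b => oDUP ++ asm b ++ oSWAP ++ oDUP ++ asm a ++ oSWAP ++ asm c ++ oSEL
  end.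

Lemma cut_ser t n s : cut n.+1 (ser t ++ s) = (ser t ++ (cut n s).1, (cut n s).2).
Proof.
elim: t n s => [|a IHa b IHb] n s /=; first by case: (cut n s).
by rewrite -catA IHa IHb /= catA.
Qed.

Lemma cut1_ser t s : cut 1 (ser t ++ s) = (ser t, s).
Proof. by rewrite cut_ser cut0 cats0. Qed.

Lemma drop_ser t s : drop_tree (ser t ++ s) = s.
Proof. by rewrite /drop_tree cut1_ser. Qed.

(** Opcodes have three bits, so codes compose by concatenation only at multiples of three. *)
Fixpoint whole (K : seq bool) : bool := 
  match K with [::] => true | [:: _, _, _ & K'] => whole K' | _ => false end.

Lemma seq3_ind (Q : seq bool -> Prop) : Q [::] -> (forall a b c K, Q K -> Q [:: a, b, c & K]) ->
  forall K, whole K -> Q K.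
Proof.
move=> Q0 Q3 K; move: (leqnn (size K)); move: {2}(size K) => u.
elim: u K => [|u IH] [|a [|b [|c K]]] //= le w; apply: Q3; apply: IH => //; lia.
Qed.

Lemma run_code_cat K1 K2 s : whole K1 -> run_code (K1 ++ K2) s = run_code K2 (run_code K1 s).
Proof. by move=> w; move: K1 w s; apply: seq3_ind => //= a b c K IH s; rewrite IH. Qed.

Lemma whole_cat K1 K2 : whole K1 -> whole K2 -> whole (K1 ++ K2).
Proof. by move=> w w2; move: K1 w; apply: seq3_ind. Qed.

Lemma whole_asm c : whole (asm c).
Proof. by elim: c => //= [f Hf g Hg|f Hf g Hg|c Hc a Ha b Hb]; do ![apply: whole_cat => //]. Qed.

Lemma run_dup t s : run_code oDUP (ser t ++ s) = ser t ++ ser t ++ s.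
Proof. by rewrite /= cut1_ser. Qed.
Lemma run_swap a b s : run_code oSWAP (ser a ++ ser b ++ s) = ser b ++ ser a ++ s.
Proof. by rewrite /= !drop_ser !cut1_ser. Qed.
Lemma run_drop t s : run_code oDROP (ser t ++ s) = s.
Proof. exact: drop_ser. Qed.
Lemma run_cons a b s : run_code oCONS (ser a ++ ser b ++ s) = ser (Nd a b) ++ s.
Proof. by rewrite /= catA. Qed.
Lemma run_uncons t s : run_code oUNCONS (ser t ++ s) = ser (tfst t) ++ ser (tsnd t) ++ s.
Proof. by case: t => [|a b] //=; rewrite -catA. Qed.
Lemma run_sel c a b s : run_code oSEL (ser c ++ ser a ++ ser b ++ s) =
  ser (if is_leaf c then a else b) ++ s.
Proof. by rewrite /= !drop_ser cut1_ser; case: c. Qed.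

Lemma run_asm c t s : run_code (asm c) (ser t ++ s) = ser (den c t) ++ s.
Proof.
elim: c t s => [||||f IHf g IHg|f IHf g IHg|c IHc a IHa b IHb] t s; cbn [asm den].
- by [].
- by rewrite (@run_code_cat oDROP) // run_drop.
- by rewrite (@run_code_cat oUNCONS) // run_uncons (@run_code_cat oSWAP) // run_swap run_drop.
- by rewrite (@run_code_cat oUNCONS) // run_uncons run_drop.
- by rewrite run_code_cat ?whole_asm // IHg IHf.
- rewrite (@run_code_cat oDUP) // run_dup run_code_cat ?whole_asm // IHg.
  rewrite (@run_code_cat oSWAP) // run_swap.
  by rewrite run_code_cat ?whole_asm // IHf run_cons.
- rewrite (@run_code_cat oDUP) // run_dup run_code_cat ?whole_asm // IHb.
  rewrite (@run_code_cat oSWAP) // run_swap.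
  rewrite (@run_code_cat oDUP) // run_dup run_code_cat ?whole_asm // IHa.
  rewrite (@run_code_cat oSWAP) // run_swap.
  by rewrite run_code_cat ?whole_asm // IHc run_sel; case: ifP.
Qed.

(** The index is the number with binary digits [true :: K]. The induction adds a last digit and
    needs the digits for every sufficient amount of fuel. *)
Lemma code_of_surj K : exists e, code_of e = K.
Proof.
suff [e E] : exists e, forall fu l, e <= fu -> digits fu e l = true :: K ++ l.
  by exists e; rewrite /code_of E // cats0.
elim/last_ind: K => [|K b [e IH]].
  by exists 1 => -[|[|fu]] l.
have e_gt0 : 0 < e by case: e IH => // IH; have := IH 0 [::] isT.
exists (e.*2 + b) => -[|fu] l le; first by lia.
case E : (e.*2 + b) le => [|u] le; first by lia.
have E1 : u.+1./2 = e by lia.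
have E2 : odd u.+1 = b by lia.
have -> : digits fu.+1 u.+1 l = digits fu u.+1./2 (odd u.+1 :: l) by [].
by rewrite E1 E2 IH ?cat_rcons //; lia.
Qed.

(** * Machine configurations as trees and the step as a term *)

Fixpoint tconst (t : tree) : tm := if t is Nd a b then TNd (tconst a) (tconst b) else TLf.

Lemma den_const t x : den (tconst t) x = t.
Proof. by elim: t => //= a -> b ->. Qed.

Definition utree (m : nat) : tree := iter m (Nd Lf) Lf.

Definition etape (t : Tape) : tree := Nd (tlist (tleft t)) (Nd (tsym (thead t)) (tlist (tright t))).

Definition etapes (ts : seq Tape) : tree := foldr (fun t r => Nd (etape t) r) Lf ts.

Definition ttail (i : nat) : tm := iter i (TComp TSnd) TSnd.
Definition ttape (i : nat) : tm := TComp TFst (ttail i).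
Definition thd (i : nat) : tm := TComp TFst (TComp TSnd (ttape i)).

Lemma den_ttail i q ts : den (ttail i) (Nd q (etapes ts)) = etapes (drop i ts).
Proof.
rewrite /ttail; elim: i => [|i IH]; first by rewrite drop0.
by rewrite iterS /= IH -add1n -drop_drop; case: (drop i ts) => //= t r; rewrite drop0.
Qed.

Lemma den_ttape i q ts : i < size ts -> den (ttape i) (Nd q (etapes ts)) = etape (nth blank_tape ts i).
Proof. by move=> lt; rewrite /= den_ttail (drop_nth blank_tape lt). Qed.

Definition symcase (i : nat) (br : Sym -> tm) : tm :=
  TIf (thd i) (br None) (TIf (TComp TFst (thd i)) (br (Some false)) (br (Some true))).

Lemma den_symcase i br q ts : i < size ts ->
  den (symcase i br) (Nd q (etapes ts)) =
  den (br (thead (nth blank_tape ts i))) (Nd q (etapes ts)).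
Proof.
move=> lt; have E : den (thd i) (Nd q (etapes ts)) = tsym (thead (nth blank_tape ts i)).
  by rewrite -[LHS]/(tfst (tsnd (den (ttape i) (Nd q (etapes ts))))) den_ttape.
rewrite /symcase; cbn [den]; rewrite E; by case: (thead _) => [[]|].
Qed.

(** The symbols under the heads are collected in the list [hs] while the term is being built. So
    [delta] is evaluated outside the term language, and each branch of the finite case tree is a
    fixed update. *)
Fixpoint headcase (m i : nat) (hs : seq Sym) (br : seq Sym -> tm) : tm :=
  if m is m'.+1 then symcase i (fun a => headcase m' i.+1 (rcons hs a) br) else br hs.

Lemma den_headcase m i hs br q ts : m + i = size ts ->
  den (headcase m i hs br) (Nd q (etapes ts)) =
  den (br (hs ++ map thead (drop i ts))) (Nd q (etapes ts)).
Proof.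
elim: m i hs => [|m IH] i hs E; first by rewrite drop_oversize ?cats0 // -E.
have lt : i < size ts by rewrite -E; lia.
by rewrite den_symcase // IH ?addnS // (drop_nth blank_tape lt) /= cat_rcons.
Qed.

Fixpoint statecase (m j : nat) (br : nat -> tm) : tm :=
  if m is m'.+1 then
    TIf (iter j (TComp TSnd) (TComp TSnd TFst)) (br j) (statecase m' j.+1 br)
  else TLf.

Lemma den_statecase m j br f q r : j <= q < j + m ->
  den (statecase m j br) (Nd (Nd f (utree q)) r) = den (br q) (Nd (Nd f (utree q)) r).
Proof.
have E i : den (iter i (TComp TSnd) (TComp TSnd TFst)) (Nd (Nd f (utree q)) r) = utree (q - i).
  elim: i => [|i IH]; first by rewrite subn0.
  by rewrite iterS /= IH subnS; case: (q - i).
elim: m j => [|m IH] j lt; first by lia.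
cbn [statecase den]; rewrite E.
have [->|ne] := eqVneq j q; first by rewrite subnn.
have -> : q - j = (q - j).-1.+1 by lia.
by rewrite /= IH //; lia.
Qed.

Definition upd (am : Sym * Move) (p : tm) : tm :=
  let a := tconst (tsym am.1) in
  let l := TComp TFst p in
  let r := TComp TSnd (TComp TSnd p) in
  match am.2 with
  | MoveS => TNd l (TNd a r)
  | MoveL => TNd (TComp TSnd l) (TNd (TComp TFst l) (TNd a r))
  | MoveR => TNd (TNd a l) (TNd (TComp TFst r) (TComp TSnd r))
  end.

Lemma den_upd am p x t : den p x = etape t ->
  den (upd am p) x = etape (tape_move (tape_write t am.1) am.2).
Proof.
case: am t => a mv [l h r] E; rewrite /upd; case: mv; cbn [den snd fst]; rewrite E den_const //.
- by case: l E.
- by case: r E.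
Qed.

Fixpoint upds (i : nat) (acts : seq (Sym * Move)) : tm :=
  if acts is am :: acts' then TNd (upd am (ttape i)) (upds i.+1 acts') else TLf.

Lemma den_upds i acts q ts : size acts + i = size ts ->
  den (upds i acts) (Nd q (etapes ts)) =
  etapes [seq tape_move (tape_write x.2 x.1.1) x.1.2 | x <- zip acts (drop i ts)].
Proof.
elim: acts i => [|am acts IH] i E; first by case: (drop i ts).
have lt : i < size ts by rewrite -E /=; lia.
cbn [upds den]; rewrite (den_upd _ (den_ttape q lt)) IH; last by rewrite -E /=; lia.
by rewrite (drop_nth blank_tape lt).
Qed.

Section Encoding.
Variables (n k : nat) (M : OTM n k).

(** The flag is what [hard_lang] reads. If the accepting and rejecting states coincide, halting
    counts as acceptance; hence the second conjunct. *)
Definition estate (q : 'I_n) : tree :=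
  Nd (if (q == rej M) && (q != acc M) then Nd Lf Lf else Lf) (utree q).

Definition tapes_of (c : Cfg n k) : seq Tape := cq c :: [seq ctapes c i | i <- enum 'I_k.+1].

Definition ecfg (c : Cfg n k) : tree := Nd (estate (cst c)) (etapes (tapes_of c)).

Definition leaf_term (q : 'I_n) (hs : seq Sym) : tm :=
  if (q == acc M) || (q == rej M) then TId
  else if q == qry M then
    TNd (tconst (estate (qno M))) (TNd (tconst (etape blank_tape)) (ttail 1))
  else let: (q', w, am) := delta M q [tuple nth None (behead hs) i | i < k.+1] (head None hs) in
    TNd (tconst (estate q')) (upds 0 (am :: w)).

Definition step_term : tm :=
  statecase n 0 (fun j => if insub j is Some q then headcase k.+2 0 [::] (leaf_term q) else TLf).

Lemma size_tapes_of c : size (tapes_of c) = k.+2.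
Proof. by rewrite /= size_map size_enum_ord. Qed.

Lemma den_step c : den step_term (ecfg c) = ecfg (step M empty_oracle c).
Proof.
rewrite /ecfg /step_term {1}/estate den_statecase ?add0n ?ltn_ord // -/(estate _) valK.
rewrite den_headcase ?size_tapes_of ?addn0 // ?drop0 /= /leaf_term /step /halted.
case: ifP => // _; case: ifP => _.
  by rewrite /= !den_const.
have -> : [tuple nth None (behead (thead (cq c) :: [seq thead t | t <- [seq ctapes c i | i <- enum 'I_k.+1]])) i | i < k.+1]
   = [tuple thead (ctapes c i) | i < k.+1].
  apply: eq_from_tnth => i; rewrite !tnth_mktuple /= -map_comp (nth_map i) ?size_enum_ord //.
  by rewrite /= nth_ord_enum.
rewrite [head _ _]/=; case: (delta _ _ _ _) => [[q' w] [a mv]]; cbn [den]; rewrite den_const.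
congr Nd; have Hu : size ((a, mv) :: w) + 0 = size (tapes_of c).
  by rewrite size_tapes_of /= size_tuple addn0.
rewrite [LHS](den_upds (estate (cst c)) Hu) /=; congr (Nd _ (etapes _)).
apply: (@eq_from_nth _ blank_tape).
  by rewrite [LHS]size_map [RHS]size_map size_zip size_map size_enum_ord size_tuple minnn.
move=> i; rewrite size_map size_zip size_map size_tuple size_enum_ord minnn => lt.
have i0 : 'I_k.+1 := ord0.
rewrite (nth_map ((None, MoveS), blank_tape)); last by rewrite size_zip size_map size_tuple size_enum_ord minnn.
rewrite nth_zip /=; last by rewrite size_tuple size_map size_enum_ord.
have En (f : 'I_k.+1 -> Tape) : nth blank_tape [seq f j | j <- enum 'I_k.+1] i = f (Ordinal lt).
  rewrite (nth_map i0) ?size_enum_ord //; congr f; apply: val_inj.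
  by rewrite /= nth_enum_ord.
by rewrite !En (tnth_nth (None, MoveS)) /=; case: (nth _ w i).
Qed.

Definition init_term : tm :=
  TNd (tconst (estate (start M)))
      (TNd (tconst (etape blank_tape))
           (TNd (TNd TLf (TNd (TComp TFst TSnd) (TComp TSnd TSnd)))
                (tconst (etapes (nseq k blank_tape))))).

Lemma den_init x : den init_term (Nd Lf (tlist (map Some x))) = ecfg (init M x).
Proof.
rewrite /ecfg /init_term; cbn [den]; rewrite !den_const; congr Nd.
rewrite /tapes_of /= enum_ordSl /=; congr (Nd _ (Nd _ _)); first by case: x.
congr etapes; rewrite -map_comp; apply: (@eq_from_nth _ blank_tape).
  by rewrite size_nseq size_map size_enum_ord.
move=> i; rewrite size_nseq => lt; rewrite nth_nseq lt (nth_map (Ordinal lt)) ?size_enum_ord //=.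
Qed.

Definition machine_term : tm := TIf TFst init_term step_term.

Lemma memory_machine x m : code_of (lead x) = asm machine_term ->
  iter m.+1 (run_code (code_of (lead x))) (ser (Nd Lf (tlist (map Some x)))) =
  ser (ecfg (run M empty_oracle x m)).
Proof.
move=> ->; elim: m => [|m IH].
  rewrite iterS [iter 0 _ _]/= -[true :: _]/(ser (Nd Lf (tlist (map Some x)))) -[X in run_code _ X]cats0.
  by rewrite run_asm cats0; cbn [machine_term den]; rewrite den_init.
rewrite iterS IH -[X in run_code _ X]cats0 run_asm cats0.
by cbn [machine_term den]; rewrite den_step.
Qed.

Lemma hard_lang_machine x : code_of (lead x) = asm machine_term ->
  hard_lang x = let q := cst (run M empty_oracle x (2 ^ size x).-1) in (q == rej M) && (q != acc M).
Proof.
move=> E; rewrite /hard_lang /memory.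
have -> : 2 ^ size x = (2 ^ size x).-1.+1 by have := expn_gt0 2 (size x); lia.
rewrite memory_machine //= /ecfg /=; by case: (_ && _).
Qed.

(* [hard_lang] disagrees with every verdict that [M] reaches before time [2 ^ size x]. *)
Lemma hard_lang_diag e : code_of e = asm machine_term -> decides M empty_oracle hard_lang ->
  forall x, lead x = e ->
    hard_lang x = false /\ forall t, t < 2 ^ size x -> ~~ halted M (run M empty_oracle x t).
Proof.
move=> Ee dec x Ex; have H := hard_lang_machine (x := x); rewrite Ex in H; move/(_ Ee): H => /=.
set T := (2 ^ size x).-1 => H.
have [t [ht Et]] := dec x.
have nh : ~~ halted M (run M empty_oracle x T).
  apply/negP => hT; move: Et; rewrite (run_halted_eq ht hT) H.
  by move: hT; rewrite /halted; case: (_ == acc M); case: (_ == rej M).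
split; first by rewrite H; move: nh; rewrite /halted negb_or => /andP[_ /negPf->].
move=> t' lt; apply/negP => h; move/negP: nh; apply.
by rewrite (run_halted h) //; rewrite /T; lia.
Qed.

End Encoding.

Lemma exists_code n k (M : OTM n k) : exists e, code_of e = asm (machine_term M).
Proof. exact: code_of_surj. Qed.

(** * Speed-up from the join *)

Section JoinStrings.

Lemma foldl_true a P : foldl (fun acc (b : bool) => acc.*2 + b) a (nseq P true) = (a.+1 * 2 ^ P).-1.
Proof.
elim: P a => [|P IH] a; first by rewrite muln1.
by rewrite /= IH expnS mulnA; congr ((_ * _).-1); lia.
Qed.

Lemma foldl_false a P : foldl (fun acc (b : bool) => acc.*2 + b) a (nseq P false) = a * 2 ^ P.
Proof.
elim: P a => [|P IH] a; first by rewrite muln1.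
by rewrite /= IH expnS mulnA addn0 -muln2.
Qed.

Lemma nat2str_pow P : nat2str (2 ^ P).-1 = nseq P false.
Proof.
rewrite /nat2str prednK ?expn_gt0 //.
suff E f : P < f -> bin_digits f (2 ^ P) = true :: nseq P false by rewrite E // ltn_expl.
elim: P f => [|P IH] [|f] // lt; first by case: f {lt}.
have -> : bin_digits f.+1 (2 ^ P.+1) = rcons (bin_digits f (2 ^ P.+1)./2) (odd (2 ^ P.+1)).
  by case: (2 ^ P.+1) (expn_gt0 2 P.+1).
rewrite expnS mul2n doubleK odd_double IH //= -cats1.
by congr cons; elim: (P) => //= Q <-.
Qed.

Variables A B : lang.

(** The word 0^P has index 2^P - 1, while 1^P has index 2(2^P - 1) and 0^(P+1) has index 2(2^P - 1)
    + 1. So both halves of the join are read at words made of one repeated letter, without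
    arithmetic on indices. *)
Lemma join_true P : 0 < P -> join A B (nseq P true) = A (nseq P false).
Proof.
move=> P_gt0; rewrite /join /str2nat foldl_true.
have E : (2 * 2 ^ P).-2 = (2 ^ P).-1.*2 by have := expn_gt0 2 P; lia.
by rewrite /= E odd_double doubleK nat2str_pow.
Qed.

Lemma join_false P : join A B (nseq P.+1 false) = B (nseq P false).
Proof.
rewrite /join /str2nat foldl_false mul1n expnS.
have E : (2 * 2 ^ P).-1 = (2 ^ P).-1.*2.+1 by have := expn_gt0 2 P; lia.
by rewrite E /= odd_double /= uphalf_double nat2str_pow.
Qed.

End JoinStrings.

Lemma powset_zeros al i : powset al (nseq (2 ^ i) false) = al i.
Proof.
rewrite /powset count_nseq mul1n pw_pow.
by rewrite has_nseq andbF.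
Qed.

Lemma turing_red_refl (A : lang) : turing_red A A.
Proof.
pose c : cmd bool 'I_1 := Seq (While (fun _ (tp : 'I_1 -> option bool) => isSome (tp ord0))
    (Act (fun f (tp : 'I_1 -> option bool) => Eff f (fun=> Pop) (tp ord0)))) (Ask _ (fun _ b => b)).
have [n [k [M HM]]] := compile c ord0 false id.
exists n, k, M => x.
suff [t H] : execs A c (init_st ord0 false x) (St (A x) (fun=> [::]) [::]).
  by have [m _ Hm] := HM _ _ _ _ H; exists m.
have loop y w : execs A (While (fun _ (tp : 'I_1 -> option bool) => isSome (tp ord0))
    (Act (fun f (tp : 'I_1 -> option bool) => Eff f (fun=> Pop) (tp ord0))))
   (St false (fun=> y) w) (St false (fun=> [::]) (w ++ y)).
  elim: y w => [|b y IH] w; first by rewrite cats0; apply: execs_whileF.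
  have H := IH (w ++ [:: b]); rewrite -catA in H; apply: execs_whileT H => //.
  by exists 1; apply: exec_act.
have -> : init_st ord0 false x = St false (fun=> x) [::] :> st bool 'I_1.
  by congr St; apply: functional_extensionality => v; rewrite ord1.
apply: execs_seq (loop x [::]) _.
by exists 1; apply: (ExAsk A (fun _ b => b) (St false (fun=> [::]) x)).
Qed.

(** * Decoding the coded set from an oracle that computes the join *)

Section Decode.
Local Notation "'# i" := (inr (@Ordinal 4 i isT)) (at level 8).
Variables (n k : nat) (M : OTM n k) (C : lang) (al be : nat -> bool).
Hypothesis decM : decides M C (join (powset al) (powset be)).

(* (leading trues; last mark seen; stop; answer; the two bits read) *)
Definition dF2 : finType := (bool * bool * bool * bool * bool * bool)%type.
Let F : finType := (simF n k * dF2)%type.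
Let V : finType := (simV k + 'I_4)%type.
Local Notation K := (fun _ : simV k => Keep).
Local Notation jst := (@jstk k 4).
Local Notation nil_ := (fun _ : tid k => [::]).
Local Notation tps := (V -> option bool).
Local Notation sK o := (Act (fun (f : F) (_ : tps) => Eff f (ojoin K o) None)).
Local Notation dwhile i c := (While (fun (_ : F) (tp : tps) => isSome (tp '#i)) c).

Definition pushR0 (c : bool) : simV k -> sop := fun v =>
  let: (i, d, b) := v in if (i == Some ord0) && ~~ d then Push (sbit b (Some c)) else Keep.

(** Stack 2 holds [2 ^ i] for the current position i, stack 1 the number of marks still to be
    skipped; stack 3 lets stack 2 survive the copying. *)
Definition load (c : bool) : cmd F V :=
  Seq (dwhile 2 (sK [:: Keep; Keep; Pop; Push true]))
      (dwhile 3 (Act (fun (f : F) (_ : tps) =>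
          Eff f (ojoin (pushR0 c) [:: Keep; Keep; Push true; Pop]) None))).

Lemma pushR0P c r i d b :
  appop (pushR0 c (i, d, b)) (map (sbit b) (if d then [::] else init_simR r i)) =
  map (sbit b) (if d then [::] else init_simR (Some c :: r) i).
Proof. by rewrite /pushR0 /init_simR; case: d; rewrite ?andbF //= andbT; case: eqP. Qed.

Lemma execs_load c f x e P : execs C (load c) (St f (jst nil_ nil_ [:: x; e; nt P; [::]]) [::])
  (St f (jst nil_ (init_simR (map Some (nseq P c))) [:: x; e; nt P; [::]]) [::]).
Proof.
have A h t : execs C (dwhile 2 (sK [:: Keep; Keep; Pop; Push true]))
   (St f (jst nil_ nil_ [:: x; e; nt h; nt t]) [::])
   (St f (jst nil_ nil_ [:: x; e; [::]; nt (h + t)]) [::]).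
  elim: h t => [|h IH] t; first exact: execs_whileF.
  have H := IH t.+1; rewrite -addSnnS in H; apply: execs_whileT H => //.
  by exists 1; apply: (@exec_actj _ _ _ _ _ _ K [:: Keep; Keep; Pop; Push true]).
have B h t : execs C (dwhile 3 (Act (fun (f : F) (_ : tps) =>
          Eff f (ojoin (pushR0 c) [:: Keep; Keep; Push true; Pop]) None)))
   (St f (jst nil_ (init_simR (map Some (nseq t c))) [:: x; e; nt t; nt h]) [::])
   (St f (jst nil_ (init_simR (map Some (nseq (h + t) c))) [:: x; e; nt (h + t); [::]]) [::]).
  elim: h t => [|h IH] t; first exact: execs_whileF.
  have H := IH t.+1; rewrite -addSnnS in H; apply: execs_whileT H => //.
  exists 1; apply: (@exec_actj _ _ _ _ _ _ (pushR0 c) [:: Keep; Keep; Push true; Pop]) => // i d b.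
  exact: pushR0P.
have E0 : init_simR (map Some (nseq 0 c)) = nil_.
  by apply: functional_extensionality => i; rewrite /init_simR; case: eqP.
apply: execs_seq (A P 0) _; rewrite addn0.
by have := B P 0; rewrite E0 addn0.
Qed.

Definition set_bit (isB : bool) (v : bool) (fl : dF2) : dF2 :=
  let: (ld, aft, stp, ans, a, b) := fl in
  if isB then (ld, aft, stp, ans, a, v) else (ld, aft, stp, ans, v, b).

Definition run_input : cmd F V :=
  Seq (Act (fun (f : F) (tp : tps) =>
         Eff (init_simf k (start M) (dectop (fun v => tp (inl v)) (Some ord0) false), f.2)
             (ojoin (@popR0 k) [::]) None))
      (liftL _ _ (sim_run M)).

(** The word asked about is 1^P for the first sequence and 0^(P+1) for the second, with P = [2 ^ i];
    the additional [false] is pushed after [load]. *)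
Definition read (isB : bool) : cmd F V :=
  Seq (load (~~ isB))
 (Seq (if isB then Act (fun (f : F) (_ : tps) => Eff f (ojoin (pushR0 false) [::]) None) else sK [::])
 (Seq run_input
 (Seq (Act (fun (f : F) (_ : tps) => Eff (f.1, set_bit isB (f.1.1 == acc M) f.2) (ojoin K [::]) None))
      (liftL _ _ (sim_clear n k))))).

Lemma execs_run_input y f x e P : exists s', execs C run_input
   (St f (jst nil_ (init_simR (map Some y)) [:: x; e; P; [::]]) [::]) s' /\
   exists s L R, s' = St (s, f.2) (jst L R [:: x; e; P; [::]]) [::] /\
     (s.1 == acc M) = join (powset al) (powset be) y.
Proof.
have [t [ht Et]] := decM y.
have Hs := @srel_init n k M t y y (fun _ _ => erefl).
have [u [s [L [R [H E]]]]] := exec_sim_run Hs ht.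
exists (St (s, f.2) (jst L R [:: x; e; P; [::]]) [::]); split; last first.
  by exists s, L, R; split=> //; rewrite E.
apply: (execs_seq (s1 := St (init_simf k (start M) (head None (map Some y)), f.2)
    (jst nil_ (init_simR (behead (map Some y))) [:: x; e; P; [::]]) [::])).
  exists 1; apply: (@exec_actj _ _ _ _ _ _ (@popR0 k) [::]) => //=.
    by rewrite (dectopE nil_ (init_simR (map Some y))) /= /init_simR eqxx.
  move=> i d b; rewrite /= /init_simR; case: d => /=; rewrite ?andbF //= andbT.
  by case: eqP => //= _; rewrite behead_map.
by exists u; apply: (exec_liftL (s := St _ _ _) (s' := St _ _ _) _ _ H).
Qed.

Lemma execs_clear_sim s fl L R l : exists s', execs C (liftL dF2 'I_4 (sim_clear n k))
   (St (s, fl) (jst L R l) [::]) (St (s', fl) (jst nil_ nil_ l) [::]).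
Proof.
pose m := \max_(i : tid k) maxn (size (L i)) (size (R i)).
have H : exec C (sim_clear n k) (St s (simsk L R) [::]) (2 * m + 2) (St (clear_heads s) (fun=> [::]) [::]).
  apply: exec_sim_clear => -[[i d] b] /=; rewrite size_map.
  apply: leq_trans (leq_bigmax i); case: d; [exact: leq_maxl | exact: leq_maxr].
exists (clear_heads s), (2 * m + 2).
have E : simsk nil_ nil_ = fun=> [::] by apply: functional_extensionality => -[[i []] b].
have := exec_liftL (s := St _ _ _) (s' := St _ _ _) fl (@stk 4 l) H.
by rewrite /jstk E.
Qed.

Lemma execs_read isB i s0 fl x e : exists s',
  execs C (read isB) (St (s0, fl) (jst nil_ nil_ [:: x; e; nt (2 ^ i); [::]]) [::])
    (St (s', set_bit isB (if isB then be i else al i) fl) (jst nil_ nil_ [:: x; e; nt (2 ^ i); [::]]) [::]).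
Proof.
pose y := if isB then nseq (2 ^ i).+1 false else nseq (2 ^ i) true.
have Ey : join (powset al) (powset be) y = if isB then be i else al i.
  by rewrite /y; case: (isB); rewrite ?join_false ?join_true ?expn_gt0 // powset_zeros.
have [s1 [H1 [s [L [R [E1 E2]]]]]] := execs_run_input y (s0, fl) x e (nt (2 ^ i)).
have [s' H3] := execs_clear_sim s (set_bit isB (s.1 == acc M) fl) L R [:: x; e; nt (2 ^ i); [::]].
exists s'; rewrite -Ey -E2.
apply: execs_seq (execs_load _ _ _ _ _) _.
apply: (execs_seq (s1 := St (s0, fl) (jst nil_ (init_simR (map Some y)) [:: x; e; nt (2 ^ i); [::]]) [::])).
  rewrite /y; case: (isB) => /=; exists 1.
    apply: (@exec_actj _ _ _ _ _ _ (pushR0 false) [::]) => // i' d b; exact: pushR0P.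
  exact: (@exec_actj _ _ _ _ _ _ K [::]).
apply: execs_seq H1 _; rewrite E1; apply: execs_seq H3.
by exists 1; apply: (@exec_actj _ _ _ _ _ _ K [::]).
Qed.

(** The mark found when stack 1 is empty is the right one, and the bit [a] at the next position is
    the answer. Bits stored behind earlier marks are passed like ordinary positions, the second
    sequence being [false] there. *)
Definition update : cmd F V :=
  Act (fun (f : F) (tp : tps) => let: (s, (ld, aft, stp, ans, a, b)) := f in
    if aft then Eff (s, (ld, aft, true, a, a, b)) (ojoin K [::]) None
    else if a && b then
      if tp '#1 is None then Eff (s, (ld, true, stp, ans, a, b)) (ojoin K [::]) None
      else Eff f (ojoin K [:: Keep; Pop]) None
    else Eff f (ojoin K [::]) None).

Definition double_pos : cmd F V :=
  Seq (dwhile 2 (sK [:: Keep; Keep; Pop; Push true]))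
      (dwhile 3 (Seq (sK [:: Keep; Keep; Push true; Pop]) (sK [:: Keep; Keep; Push true]))).

Lemma execs_double_pos f x e P : execs C double_pos (St f (jst nil_ nil_ [:: x; e; nt P; [::]]) [::])
  (St f (jst nil_ nil_ [:: x; e; nt (2 * P); [::]]) [::]).
Proof.
have A h t : execs C (dwhile 2 (sK [:: Keep; Keep; Pop; Push true]))
   (St f (jst nil_ nil_ [:: x; e; nt h; nt t]) [::])
   (St f (jst nil_ nil_ [:: x; e; [::]; nt (h + t)]) [::]).
  elim: h t => [|h IH] t; first exact: execs_whileF.
  have H := IH t.+1; rewrite -addSnnS in H; apply: execs_whileT H => //.
  by exists 1; apply: (@exec_actj _ _ _ _ _ _ K [:: Keep; Keep; Pop; Push true]).
have B h t : execs C (dwhile 3 (Seq (sK [:: Keep; Keep; Push true; Pop]) (sK [:: Keep; Keep; Push true])))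
   (St f (jst nil_ nil_ [:: x; e; nt t; nt h]) [::])
   (St f (jst nil_ nil_ [:: x; e; nt (2 * h + t); [::]]) [::]).
  elim: h t => [|h IH] t; first exact: execs_whileF.
  have H := IH t.+2; have E : 2 * h + t.+2 = 2 * h.+1 + t by lia.
  rewrite E in H; apply: execs_whileT H => //.
  apply: (execs_seq (s1 := St f (jst nil_ nil_ [:: x; e; nt t.+1; nt h]) [::])).
    by exists 1; apply: (@exec_actj _ _ _ _ _ _ K [:: Keep; Keep; Push true; Pop]).
  by exists 1; apply: (@exec_actj _ _ _ _ _ _ K [:: Keep; Keep; Push true]).
by apply: execs_seq (A P 0) _; have := B (P + 0) 0; rewrite !addn0.
Qed.

Definition dstep : cmd F V := Seq (read false) (Seq (read true) (Seq update double_pos)).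
Definition decode : cmd F V :=
  While (fun (f : F) _ => let: (s, (ld, aft, stp, ans, a, b)) := f in ~~ stp) dstep.

Definition dst s ld aft stp ans a b x e i : st F V :=
  St (s, (ld, aft, stp, ans, a, b)) (jst nil_ nil_ [:: x; nt e; nt (2 ^ i); [::]]) [::].

Lemma execs_dstep s ld aft stp ans a b x e i : exists s', execs C dstep
  (dst s ld aft stp ans a b x e i)
  (if aft then dst s' ld aft true (al i) (al i) (be i) x e i.+1
   else if al i && be i then
     if e is e'.+1 then dst s' ld aft stp ans (al i) (be i) x e' i.+1
     else dst s' ld true stp ans (al i) (be i) x e i.+1
   else dst s' ld aft stp ans (al i) (be i) x e i.+1).
Proof.
have [s1 H1] := execs_read false i s (ld, aft, stp, ans, a, b) x (nt e).
have [s2 H2] := execs_read true i s1 (ld, aft, stp, ans, al i, b) x (nt e).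
exists s2; apply: execs_seq H1 _; apply: execs_seq H2 _.
rewrite /dst expnS.
have U f' e' : aeff ((fun (f : F) (tp : tps) => let: (s, (ld, aft, stp, ans, a, b)) := f in
    if aft then Eff (s, (ld, aft, true, a, a, b)) (ojoin K [::]) None
    else if a && b then
      if tp '#1 is None then Eff (s, (ld, true, stp, ans, a, b)) (ojoin K [::]) None
      else Eff f (ojoin K [:: Keep; Pop]) None
    else Eff f (ojoin K [::]) None) (s2, (ld, aft, stp, ans, al i, be i))
       (fun v => ohead (jst nil_ nil_ [:: x; nt e; nt (2 ^ i); [::]] v)))
      (St (s2, (ld, aft, stp, ans, al i, be i)) (jst nil_ nil_ [:: x; nt e; nt (2 ^ i); [::]]) [::]) =
      St f' (jst nil_ nil_ [:: x; nt e'; nt (2 ^ i); [::]]) [::] ->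
  execs C (Seq update double_pos)
   (St (s2, (ld, aft, stp, ans, al i, be i)) (jst nil_ nil_ [:: x; nt e; nt (2 ^ i); [::]]) [::])
   (St f' (jst nil_ nil_ [:: x; nt e'; nt (2 * 2 ^ i); [::]]) [::]).
  by move=> E; apply: execs_seq (execs_double_pos _ _ _ _); exists 1; apply: exec_act.
have Z o : size o <= 4 -> forall f' l', zapp o [:: x; nt e; nt (2 ^ i); [::]] = l' ->
   aeff (Eff f' (ojoin K o) None)
     (St (s2, (ld, aft, stp, ans, al i, be i)) (jst nil_ nil_ [:: x; nt e; nt (2 ^ i); [::]]) [::]) =
   St f' (jst nil_ nil_ l') [::].
  move=> le f' l' <-; rewrite /aeff /=; congr St.
  apply: functional_extensionality => -[[[j d] c]|v] //=.
  by rewrite -(@zappE 4 o [:: x; nt e; nt (2 ^ i); [::]]).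
case: aft U Z => U Z; first by apply: U; apply: Z.
case: (al i && be i) U => U; last by apply: U; apply: Z.
case: e U Z => [|e] U Z; apply: U.
  by apply: (Z [::]).
exact: (Z [:: Keep; Pop]).
Qed.

Variables (G : nat -> bool) (len : nat -> nat).
Hypothesis len0 : len 0 = 0.
Hypothesis lenP : forall s, exists m, [/\ len s <= m, forall i, len s <= i < m -> ~~ (al i && be i),
         al m && be m, al m.+1 = G s /\ be m.+1 = false & len s.+1 = m.+2].

Lemma execs_decode s x e : exists s' x' a b e' i',
  execs C decode (dst s true false false false false false x e 0)
    (dst s' true true true (G e) a b x' e' i').
Proof.
(* A continuation is used because the store left by each reading is only known to exist. *)
have skip d i s1 e1 a b z : (forall j, i <= j < i + d -> ~~ (al j && be j)) ->
  (forall s2 a2 b2, exists2 z', execs C decode (dst s2 true false false false a2 b2 x e1 (i + d)) z' & z z') ->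
  exists2 z', execs C decode (dst s1 true false false false a b x e1 i) z' & z z'.
  elim: d i s1 a b => [|d IH] i s1 a b nm H; first by rewrite addn0 in H; apply: H.
  have [s2 H2] := execs_dstep s1 true false false false a b x e1 i.
  have nmi : al i && be i = false by apply: negbTE; apply: nm; lia.
  rewrite nmi in H2.
  have [||z' Hz zz'] := IH i.+1 s2 (al i) (be i).
  - by move=> j lt; apply: nm; lia.
  - by move=> s3 a3 b3; rewrite addSnnS.
  by exists z' => //; apply: execs_whileT H2 Hz.
pose z (w : st F V) := exists s' x' a b e' i', w = dst s' true true true (G e) a b x' e' i'.
(* [q] marks have been passed and [r] remain to be skipped; [len q] is where the segment with the
   next mark begins. *)
suff main r s1 a b q : q + r = e ->
    exists2 z', execs C decode (dst s1 true false false false a b x r (len q)) z' & z z'.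
  have [z' H [s' [x' [a [b [e' [i' E]]]]]]] := main e s false false 0 (add0n e).
  by exists s', x', a, b, e', i'; rewrite -E -len0.
elim: r s1 a b q => [|r IH] s1 a b q Eq.
  have [m [le nm mk [Ea Eb] _]] := lenP q.
  apply: (skip (m - len q)); first by move=> j lt; apply: nm; lia.
  rewrite subnKC // => s2 a2 b2.
  have [s3 H3] := execs_dstep s2 true false false false a2 b2 x 0 m.
  rewrite mk in H3.
  have [s4 H4] := execs_dstep s3 true true false false (al m) (be m) x 0 m.+1.
  exists (dst s4 true true true (al m.+1) (al m.+1) (be m.+1) x 0 m.+2).
    apply: execs_whileT H3 _ => //; apply: execs_whileT H4 _ => //; exact: execs_whileF.
  by rewrite Ea; exists s4, x, (G q), (be m.+1), 0, m.+2; rewrite -Eq addn0.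
have [m [le nm mk [Ea Eb] El]] := lenP q.
apply: (skip (m - len q)); first by move=> j lt; apply: nm; lia.
rewrite subnKC // => s2 a2 b2.
have [s3 H3] := execs_dstep s2 true false false false a2 b2 x r.+1 m.
rewrite mk in H3.
have [s4 H4] := execs_dstep s3 true false false false (al m) (be m) x r m.+1.
rewrite Eb andbF in H4.
have [|z' Hz zz'] := IH s4 (al m.+1) false q.+1; first by lia.
exists z' => //; apply: execs_whileT H3 _ => //; apply: execs_whileT H4 _ => //.
by rewrite -El.
Qed.

End Decode.

(** * A decision procedure that is fast where the coded bit is 0 *)

Section Speedup.
Variables (n k : nat) (M : OTM n k).
Let F : finType := ((simF n k * dF2) * uF)%type.
Let V : finType := ((simV k + 'I_4) + uV)%type.
Local Notation tps := (V -> option bool).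
Local Notation "'#x'" := (inr (inl (@Ordinal 8 0 isT))).
Local Notation "'#y'" := (inl (inr (@Ordinal 4 0 isT))).
Local Notation nil_ := (fun _ : tid k => [::]).

Definition mops (o1 o2 : seq sop) : V -> sop := fun v =>
  match v with
  | inl (inl _) => Keep
  | inl (inr v) => lops o1 v
  | inr (inl v) => lops o2 v
  | inr (inr _) => Keep
  end.

Definition mst (s : simF n k) (fl : dF2) (l1 l2 : seq (seq bool)) : st F V :=
  St ((s, fl), u_start) (sjoin (@jstk k 4 nil_ nil_ l1) (sjoin (@stk 8 l2) (@stk 4 [:: [::]; [::]; [::]; [::]]))) [::].

Lemma exec_actm X (a : F -> tps -> eff F V) o1 o2 s fl fl' l1 l2 l1' l2' :
  a ((s, fl), u_start) (fun v => ohead (sk (mst s fl l1 l2) v)) = Eff ((s, fl'), u_start) (mops o1 o2) None ->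
  size o1 <= size l1 -> size o2 <= size l2 -> zapp o1 l1 = l1' -> zapp o2 l2 = l2' ->
  exec X (Act a) (mst s fl l1 l2) 1 (mst s fl' l1' l2').
Proof.
move=> E le1 le2 <- <-; apply: exec_act; rewrite E /aeff /=; congr St.
apply: functional_extensionality => -[[v|v]|[v|v]] //=.
  by rewrite -(@zappE 4 o1 l1 le1).
by rewrite -(@zappE 8 o2 l2 le2).
Qed.

Definition scan : cmd F V :=
  While (fun (_ : F) (tp : tps) => isSome (tp #x))
    (Act (fun (f : F) (tp : tps) => let: ((s, (ld, aft, stp, ans, a, b)), u) := f in
       let c := odflt false (tp #x) in
       Eff ((s, (ld && c, aft, stp, ans, a, b)), u)
         (mops [:: Push c; if ld && c then Push true else Keep] [:: Pop]) None)).

Definition rescan : cmd F V :=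
  While (fun (_ : F) (tp : tps) => isSome (tp #y))
    (Act (fun (f : F) (tp : tps) => Eff f (mops [:: Pop] [:: Push (odflt false (tp #y))]) None)).

Definition reset : cmd F V :=
  Act (fun (f : F) (_ : tps) => let: ((s, (ld, aft, stp, ans, a, b)), u) := f in
       Eff ((s, (true, aft, stp, ans, a, b)), u) (mops [:: Keep; Keep; Push true] [::]) None).

Definition speedup : cmd F V :=
  Seq scan (Seq rescan (Seq reset (Seq (liftL _ _ (decode M))
    (If (fun (f : F) _ => let: ((s, (ld, aft, stp, ans, a, b)), u) := f in ans)
        (liftR _ _ u_prog) (Act (fun (f : F) _ => nop V f)))))).

Definition speedup_out (f : F) : bool :=
  let: ((s, (ld, aft, stp, ans, a, b)), u) := f in ans && u_out u.

Variables (C : lang) (al be : nat -> bool).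
Hypothesis decM : decides M C (join (powset al) (powset be)).
Variables (G : nat -> bool) (len : nat -> nat).
Hypothesis len0 : len 0 = 0.
Hypothesis lenP : forall s, exists m, [/\ len s <= m, forall i, len s <= i < m -> ~~ (al i && be i),
         al m && be m, al m.+1 = G s /\ be m.+1 = false & len s.+1 = m.+2].
Hypothesis GP : forall x, hard_lang x -> G (lead x).

Let s0 : simF n k := (start M, [ffun=> None]).
Let f0 : F := ((s0, (true, false, false, false, false, false)), u_start).
Local Notation nil7 := [:: [::]; [::]; [::]; [::]; [::]; [::]; [::]].

(** The word waits in the store of [u_prog] while its index is decoded, so the decoding run is the
    same for all words with that index, and [h] is chosen before [x]. If [G e] holds, the
    interpreter runs and no bound is claimed. *)
Lemma exec_speedup e : exists h, forall x, lead x = e -> exists t s,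
  [/\ exec C speedup (init_st #x f0 x) t s, speedup_out (fc s) = hard_lang x &
      ~~ G e -> t <= h + 4 * size x].
Proof.
have [s1 [x1 [a [b [e1 [i1 [h Hd]]]]]]] := execs_decode decM len0 lenP s0 [::] e.
exists (h + 5) => x Ex.
have H1 ld y xr e0 : exists ld', exec C scan
   (mst s0 (ld, false, false, false, false, false) [:: xr; nt e0; [::]; [::]] (y :: nil7)) (2 * size y + 1)
   (mst s0 (ld', false, false, false, false, false)
      [:: catrev y xr; nt ((if ld then lead y else 0) + e0); [::]; [::]] ([::] :: nil7)).
  elim: y ld xr e0 => [|c y IH] ld xr e0.
    by exists ld; rewrite if_same; apply: ExWhileF.
  have [ld' H] := IH (ld && c) (c :: xr) ((ld && c) + e0).
  have E1 : (if ld && c then lead y else 0) + ((ld && c) + e0) = (if ld then lead (c :: y) else 0) + e0.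
    by case: (ld); case: c {H}; rewrite /lead //= addnCA addnA.
  exists ld'; rewrite E1 in H.
  apply: (exec_le (t := 1 + 1 + (2 * size y + 1))); first by rewrite /=; lia.
  apply: ExWhileT H => //.
  apply: (@exec_actm _ _ [:: Push c; if ld && c then Push true else Keep] [:: Pop]) => //.
  by case: (ld && c).
have H2 fl xr y e0 : exec C rescan (mst s0 fl [:: xr; e0; [::]; [::]] (y :: nil7)) (2 * size xr + 1)
   (mst s0 fl [:: [::]; e0; [::]; [::]] (catrev xr y :: nil7)).
  elim: xr y => [|c xr IH] y; first exact: ExWhileF.
  apply: (exec_le (t := 1 + 1 + (2 * size xr + 1))); first by rewrite /=; lia.
  apply: ExWhileT (IH (c :: y)) => //.
  exact: (@exec_actm _ _ [:: Pop] [:: Push c]).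
have Ei : init_st #x f0 x = mst s0 (true, false, false, false, false, false)
    [:: [::]; nt 0; [::]; [::]] (x :: nil7).
  congr St; apply: functional_extensionality => -[[[[i d] c]|v]|[v|v]] //=.
  - by case: d.
  - by case: v => -[|[|[|[|//]]]].
  - by case: v => -[|[|[|[|[|[|[|[|//]]]]]]]].
  - by case: v => -[|[|[|[|//]]]].
have [ld {}H1] := H1 true x [::] 0; rewrite Ex addn0 in H1.
have {}H2 := H2 (ld, false, false, false, false, false) (catrev x [::]) [::] (nt e).
have Er : catrev (catrev x [::]) [::] = x by rewrite !catrevE !cats0 revK.
rewrite Er in H2.
have H3 : exec C reset (mst s0 (ld, false, false, false, false, false) [:: [::]; nt e; [::]; [::]] (x :: nil7)) 1
   (mst s0 (true, false, false, false, false, false) [:: [::]; nt e; nt 1; [::]] (x :: nil7)).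
  exact: (@exec_actm _ _ [:: Keep; Keep; Push true] [::]).
have H4 := exec_liftL u_start (sjoin (@stk 8 (x :: nil7)) (@stk 4 [:: [::]; [::]; [::]; [::]])) Hd.
have Sz : size (catrev x [::]) = size x by rewrite catrevE cats0 size_rev.
case Ge: (G e) H4 => H4.
  have [f [l [m [[t H5] E5]]]] := execs_prog C x.
  have H6 := exec_liftR (fc (dst s1 true true true (G e) a b x1 e1 i1))
     (sk (dst s1 true true true (G e) a b x1 e1 i1)) H5.
  exists ((2 * size x + 1) + ((2 * size (catrev x [::]) + 1) + (1 + (h + t.+1)))).
  eexists; split=> //.
    rewrite Ei; apply: ExSeq; first exact: H1.
    apply: ExSeq; first exact: H2.
    apply: ExSeq; first exact: H3.
    apply: ExSeq; first exact: H4.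
    by rewrite Ge in H6; apply: ExIfT; [ | exact: H6].
  exact: E5.
exists ((2 * size x + 1) + ((2 * size (catrev x [::]) + 1) + (1 + (h + 2)))).
eexists; split.
- rewrite Ei; apply: ExSeq; first exact: H1.
  apply: ExSeq; first exact: H2.
  apply: ExSeq; first exact: H3.
  apply: ExSeq; first exact: H4.
  by apply: ExIfF; last exact: ExAct.
- rewrite /speedup_out /=; apply/esym/negbTE/negP => /GP.
  by rewrite Ex Ge.
- by move=> _; rewrite Sz; lia.
Qed.

End Speedup.

(** * Exponential against polynomial time, and the contradiction *)

Lemma peval_le p m : peval p m <= sumn p * m.+1 ^ size p.
Proof.
rewrite /peval sumnE (big_nth 0) big_mkord big_distrl /=; apply: leq_sum => i _.
rewrite leq_mul2l; apply/orP; right.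
apply: (leq_trans (n := m.+1 ^ i)); last by rewrite leq_pexp2l // ltnW.
by case: (nat_of_ord i) => // j; rewrite leq_exp2r.
Qed.

(** For n + 1 = 2^j the left side is at most 2 to the power S + (c + j) d, so this exponent has to
    stay below 2^j - 1. With j = 2i, 2^j is at least (i + 1)^2, and i >= 2d + K makes the square
    absorb the term j d = 2 i d. *)
Lemma exp_beats_poly S c d n1 : exists n, n1 <= n /\ S * (c * n.+1) ^ d < 2 ^ n.
Proof.
pose K := S + c * d + n1 + 2; pose i := 2 * d + K; pose j := i + i.
have le_i : i.+1 * i.+1 <= 2 ^ j by rewrite expnD leq_mul // ltn_expl.
exists (2 ^ j).-1; have E : (2 ^ j).-1.+1 = 2 ^ j by rewrite prednK // expn_gt0.
have big : S + (c + j) * d < (2 ^ j).-1 /\ n1 <= (2 ^ j).-1.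
  have : S + (c + j) * d + n1 + 2 <= i.+1 * i.+1 by rewrite /j /i /K; nia.
  by lia.
split; first by case: big.
rewrite E; apply: (leq_ltn_trans (n := 2 ^ (S + (c + j) * d))); last first.
  by rewrite ltn_exp2l //; case: big.
rewrite expnD leq_mul ?(ltnW (ltn_expl _ _)) // expnM.
case: (posnP d) => [->|d_gt0]; first by rewrite !expn0.
by rewrite leq_exp2r // expnD leq_mul // ltnW // ltn_expl.
Qed.

Lemma join_not_low (G : nat -> bool) al be len n k (M : OTM n k) C :
  (forall e, reflect (exists2 x, lead x = e & hard_lang x) (G e)) ->
  len 0 = 0 ->
  (forall s, exists m, [/\ len s <= m, forall i, len s <= i < m -> ~~ (al i && be i),
         al m && be m, al m.+1 = G s /\ be m.+1 = false & len s.+1 = m.+2]) ->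
  decides M C (join (powset al) (powset be)) -> ~ low_for_speed C.
Proof.
move=> GP len0 lenP decM low.
have GP1 x : hard_lang x -> G (lead x) by move=> hx; apply/GP; exists x.
pose f0 : (simF n k * dF2) * uF := (((start M, [ffun=> None]), (true, false, false, false, false, false)), u_start).
pose vx : (simV k + 'I_4) + uV := inr (inl (@Ordinal 8 0 isT)).
have [n1 [k1 [M1 HM1]]] := compile (speedup M) vx f0 (@speedup_out n k).
pose good x t := halted M1 (run M1 C x t) && ((cst (run M1 C x t) == acc M1) == hard_lang x).
have Hh e : exists h, forall x, lead x = e -> exists2 t, good x t & ~~ G e -> t <= 4 * (h + 4 * size x).
  have [h Hh] := exec_speedup decM len0 lenP GP1 e; exists h => x Ex.
  have [t [s [Ht Es le]]] := Hh x Ex.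
  have [m le_m [hm Em]] := HM1 _ _ _ _ Ht.
  exists m; first by rewrite /good hm Em Es eqxx.
  by move=> /le le'; apply: leq_trans le_m _; rewrite leq_mul2l le' orbT.
have ex_good x : exists t, good x t.
  by have [h Hx] := Hh (lead x); have [t gt _] := Hx x erefl; exists t.
(* The bound handed to lowness is the least time at which [M1] has halted correctly. It exists
   everywhere, and no explicit bound is demanded on words whose index satisfies [G]. *)
have dec1 : decides_within M1 C hard_lang (fun x => ex_minn (ex_good x)).
  move=> x; case: ex_minnP => t /andP[ht /eqP Et] _; by exists t.
have [n2 [k2 [N [p decN]]]] := low _ hard_lang_computable _ _ _ _ dec1.
have [e Ee] := exists_code N.
have diag x : lead x = e -> hard_lang x = false /\
    forall t, t < 2 ^ size x -> ~~ halted N (run N empty_oracle x t).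
  apply: hard_lang_diag => // {}x; have [t [_ H]] := decN x; by exists t.
have nG : ~~ G e by apply/GP => -[x Ex]; have [-> _] := diag x Ex.
have [h Hx] := Hh e.
(* On a word of length m with index [e] the bound is at most 4(h + 4m), whose successor is at most
   (4h + 17)(m + 1). Taking m above [e] leaves room for the leading ones. *)
have [m [le_m lt_m]] := exp_beats_poly (sumn p) (4 * h + 16 + 1) (size p) e.+1.
pose x := nseq e true ++ nseq (m - e) false.
have Ex : lead x = e.
  rewrite /lead /x find_cat has_nseq andbF size_nseq.
  by case: (m - e) (subn_gt0 e m) => [|d] E; [lia | rewrite /= addn0].
have Sx : size x = m by rewrite size_cat !size_nseq; lia.
have [t [le_t [ht _]]] := decN x.
have [_ /(_ t)] := diag x Ex; rewrite ht Sx => H.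
suff : t < 2 ^ m by move/H.
apply: leq_ltn_trans le_t _; apply: leq_ltn_trans (peval_le _ _) _.
apply: leq_ltn_trans lt_m; rewrite leq_mul2l; apply/orP; right.
have [t1 g1 le1] := Hx x Ex.
have : ex_minn (ex_good x) <= t1 by case: ex_minnP => t2 _; apply.
have := le1 nG; rewrite Sx => le2 le3.
have le4 : (ex_minn (ex_good x)).+1 <= (4 * h + 16 + 1) * m.+1 by nia.
by case: (size p) => [|d]; rewrite ?expn0 ?leq_exp2r.
Qed.

(* There are degrees a = deg A, b = deg B in LFS with a v b = deg (A (+) B) not in LFS. *)
Theorem theorem5p6 :
  exists A B : lang, in_LFS A /\ in_LFS B /\ ~ in_LFS (join A B).
Proof.
pose G e : bool := excluded_middle_informative (exists2 x, lead x = e & hard_lang x).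
have GP e : reflect (exists2 x, lead x = e & hard_lang x) (G e).
  by rewrite /G; case: excluded_middle_informative => H; constructor.
have [al [be [len [ga gb len0 lenP]]]] := exists_generic_pair G.
exists (powset al), (powset be); split; last split.
- by exists (powset al); split; [split; apply: turing_red_refl | apply: powset_low].
- by exists (powset be); split; [split; apply: turing_red_refl | apply: powset_low].
- move=> [C [[_ [n [k [M decM]]]] low]].
  exact: (join_not_low GP len0 lenP decM low).
Qed.
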